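(* Let $d\in\{1,2,3\}$ and $\alpha>d/2$. Let $u$ be the solution of $i\partial_tu=-\Delta u+\mu|u|^2u$ on $\mathbb{T}^d$, $u(0)=u_0$, let $T>0$ be smaller than its maximal existence time, and suppose $M_{\alpha+1}<\infty$. Let $u^n$ be computed by the scheme sLRI1: $$u^{n+1}=e^{2i\tau\Delta}u^{n-1}-2i\mu\tau e^{i\tau\Delta}\bigl((u^n)^2\varphi_s(2\tau\Delta)\overline{u^n}\bigr)\ (n\ge1),$$ $$u^1=e^{i\tau\Delta}u_0-i\mu\tau e^{i\tau\Delta}\bigl(u_0^2\,\varphi_1(-2i\tau\Delta)\overline{u_0}\bigr),\qquad u^0=u_0.$$ Then for all $0<\tau\le\tau_0$ with $\tau_0>0$ sufficiently small depending on $M_{\alpha+1}$ and $T$, $$\|u(t_n)-u^n\|_{H^\alpha}\le C(M_{\alpha+1})\,\tau,\qquad 0\le n\le T/\tau,\quad t_n=n\tau.$$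
   Context: $\mathbb{T}^d$ is the $2\pi$-periodic torus, $\mu$ a nonzero real constant; $H^\alpha=H^\alpha(\mathbb{T}^d)$ is the periodic Sobolev space with norm $\|u\|_{H^\alpha}^2=\sum_{\mathbf{k}\in\mathbb{Z}^d}(1+|\mathbf{k}|^2)^\alpha|\hat u_{\mathbf{k}}|^2$. $M_\delta:=\sup_{0\le t\le T}\|u(t)\|_{H^\delta}$. $\varphi_s(x)=\sin(x)/x$ and $\varphi_1(z)=(e^z-1)/z$ (with value $1$ at $0$). Functions of $\Delta$ are Fourier multipliers: $f(\Delta)$ has symbol $f(-|\mathbf{k}|^2)$; e.g. $\varphi_s(2\tau\Delta)\overline{v}$ is the multiplier applied to $\overline v$. $C(M_\delta)$ denotes a positive constant depending on $M_\delta$ and on the fixed data ($T$, $\mu$, $d$, $\alpha$), but independent of $\tau$ and $n$; likewise $\tau_0$ may depend on the fixed data. *)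

(* Defs.v *)
From HB Require Import structures.
From mathcomp Require Import all_boot all_order all_algebra.
From mathcomp Require Import complex.
From mathcomp Require Import all_classical all_reals all_analysis.

Set Implicit Arguments.
Unset Strict Implicit.
Unset Printing Implicit Defensive.

Import Order.TTheory GRing.Theory Num.Theory.
Import numFieldNormedType.Exports.

Local Open Scope classical_set_scope.
Local Open Scope complex_scope.
Local Open Scope ring_scope.

Section torus.
Context {R : realType}.
Implicit Types d N : nat.

(* A function on T^d = (R / 2 pi Z)^d is a 2pi-periodic function on R^d
   (see periodicT); elements of L^2 and H^s are represented by functions, not
   by classes modulo a.e. equality. *)
Definition tpoint d := d.-tuple (measurableTypeR R).
Definition torus_fun d := tpoint d -> R[i].

Lemma pi2_gt0 : (0 : R) < pi *+ 2.
Proof. by rewrite mulrn_wgt0// pi_gt0. Qed.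

Definition cons_point d (p : measurableTypeR R * tpoint d) : tpoint d.+1 :=
  [tuple of p.1 :: p.2].

Lemma measurable_cons_point d : measurable_fun setT (@cons_point d).
Proof. exact: measurable_cons. Qed.

HB.instance Definition _ d := isMeasurableFun.Build _ _ _ _ (@cons_point d)
  (@measurable_cons_point d).

(* The normalized measure (2 pi)^-d dx on the cell [0, 2 pi]^d. *)
Fixpoint haar d : probability (tpoint d) R :=
  if d is d'.+1 then
    distribution (uniform_prob pi2_gt0 \x haar d')%E (@cons_point d')
  else \d_([tuple] : tpoint 0).

Definition periodicT d (u : torus_fun d) : Prop :=
  forall (x y : tpoint d) (i : 'I_d),
    tnth y i = tnth x i + pi *+ 2 :> R ->
    (forall j, j != i -> tnth y j = tnth x j) -> u y = u x.

Definition L2 d (u : torus_fun d) : Prop :=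
  [/\ periodicT u,
      ((fun x => complex.Re (u x)) : tpoint d -> R) \in Lfun (haar d) 2%:E &
      ((fun x => complex.Im (u x)) : tpoint d -> R) \in Lfun (haar d) 2%:E].

Definition cintegral d (u : torus_fun d) : R[i] :=
  (\int[haar d]_x complex.Re (u x)) +i* (\int[haar d]_x complex.Im (u x)).

Definition cexp (z : R[i]) : R[i] :=
  (expR (complex.Re z))%:C * (cos (complex.Im z) +i* sin (complex.Im z)).

Definition freq d := d.-tuple int.

Definition normsq d (k : freq d) : R := \sum_(i < d) (tnth k i)%:~R ^+ 2.

Definition echar d (k : freq d) : torus_fun d :=
  fun x => cexp ('i%C * (\sum_(i < d) (tnth k i)%:~R * (tnth x i : R))%:C).

Definition fourier d (u : torus_fun d) (k : freq d) : R[i] :=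
  cintegral (fun x => u x * (echar k x)^*).

(* For s >= 0, where H^s is a subspace of L^2; the value is +oo exactly when
   u is not in H^s. *)
Definition sobolev_norm d (s : R) (u : torus_fun d) : \bar R :=
  if `[< L2 u >] then
    sqrte (\esum_(k in [set: freq d])
             ((1 + normsq k) `^ s * ComplexField.Normc.normc (fourier u k) ^+ 2)%:E)
  else +oo%E.

Definition sobolev d (s : R) (u : torus_fun d) : Prop :=
  (sobolev_norm s u < +oo)%E.

(* M_s = sup over 0 <= t <= T of the H^s norm of u(t) *)
Definition sup_sobolev_norm d (T s : R) (u : R -> torus_fun d) : \bar R :=
  ereal_sup [set sobolev_norm s (u t) | t in `[0, T]].

Definition climn (z : nat -> R[i]) : R[i] :=
  limn (fun N => complex.Re (z N)) +i* limn (fun N => complex.Im (z N)).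

Definition cube_freq d N (j : d.-tuple 'I_N.*2.+1) : freq d :=
  [tuple (tnth j i)%:Z - N%:Z | i < d].

(* The multiplier f(Delta), of symbol f(-|k|^2), as the sum over Z^d of its
   Fourier series. On H^s with s > d/2 and for bounded f the series converges
   absolutely, so the choice of cubes as partial sums is immaterial. *)
Definition fDelta d (f : R -> R[i]) (v : torus_fun d) : torus_fun d :=
  fun x => climn (fun N => \sum_(j : d.-tuple 'I_N.*2.+1)
    let k := cube_freq j in f (- normsq k) * fourier v k * echar k x).

Definition phis (x : R) : R := if x == 0 then 1 else sin x / x.

Definition phi1 (z : R[i]) : R[i] := if z == 0 then 1 else (cexp z - 1) / z.

Definition is_cderiv (f : R -> R[i]) (t : R) (w : R[i]) : Prop :=
  is_derive t 1 (fun s => complex.Re (f s)) (complex.Re w) /\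
  is_derive t 1 (fun s => complex.Im (f s)) (complex.Im w).

(* u is in C([0, S); H^alpha) and satisfies
     i d_t u = - Delta u + mu |u|^2 u,  u(0) = u0
   on (0, S) in the sense of periodic distributions, that is, tested against
   every character; Delta has symbol - |k|^2. *)
Definition nls_solution d (mu alpha : R) (u0 : torus_fun d) (S : \bar R)
    (u : R -> torus_fun d) : Prop :=
  [/\ u 0 = u0,
      forall t : R, 0 <= t -> (t%:E < S)%E -> sobolev alpha (u t),
      forall t : R, 0 <= t -> (t%:E < S)%E ->
        sobolev_norm alpha (fun x => u s x - u t x)
          @[s --> within [set s | 0 <= s /\ (s%:E < S)%E] (nbhs t)] --> 0%E &
      forall t : R, 0 < t -> (t%:E < S)%E -> forall k : freq d,
        exists2 w, is_cderiv (fun s => fourier (u s) k) t w &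
          'i%C * w = - (- normsq k)%:C * fourier (u t) k
                   + mu%:C * fourier (fun x => `|u t x| ^+ 2 * u t x) k].

Definition maximal_nls_solution d (mu alpha : R) (u0 : torus_fun d)
    (Tmax : \bar R) (u : R -> torus_fun d) : Prop :=
  nls_solution mu alpha u0 Tmax u /\
  forall (S : \bar R) (v : R -> torus_fun d),
    nls_solution mu alpha u0 S v -> (S <= Tmax)%E.

Fixpoint sLRI1 d (mu tau : R) (u0 : torus_fun d) (n : nat) : torus_fun d :=
  match n with
  | 0 => u0
  | n'.+1 =>
    match n' with
    | 0 => fun x =>
        fDelta (fun l => cexp ('i%C * (tau * l)%:C)) u0 x
        - 'i%C * (mu * tau)%:C *
          fDelta (fun l => cexp ('i%C * (tau * l)%:C))
            (fun y => u0 y ^+ 2 *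
               fDelta (fun l => phi1 (- 2 * 'i%C * (tau * l)%:C))
                 (fun z => (u0 z)^*) y) x
    | m.+1 =>
      let un := sLRI1 mu tau u0 n' in
      let up := sLRI1 mu tau u0 m in
      fun x =>
        fDelta (fun l => cexp (2 * 'i%C * (tau * l)%:C)) up x
        - 2 * 'i%C * (mu * tau)%:C *
          fDelta (fun l => cexp ('i%C * (tau * l)%:C))
            (fun y => un y ^+ 2 *
               fDelta (fun l => (phis (2 * tau * l))%:C)
                 (fun z => (un z)^*) y) x
    end
  end.

End torus.

(* Main.v *)
(** In the twisted variable v(t) = e^{-it Delta} u(t) the equation reads
    v' = -i mu e^{-it Delta} (|u|^2 u).  For s >= 0 and frequencies k = k1 + k2 - k3,
    the phase of the cubic term around time t is 2 (r - t) |k3|^2 up to products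
    |ki| |kj| with i <> j, so it costs at most one derivative on each of two factors;
    the phase that is kept integrates exactly to the filters phi_s and phi_1 of the
    scheme.  Hence one step has local error O(tau^2) in H^alpha when u is bounded
    in H^(alpha + 1).

    Products are handled on the Fourier side: absolutely convergent cubic
    convolutions are limits of finite ones, for which the algebra property of
    H^alpha is an estimate on sequences.  The Duhamel integral is replaced by
    the mean value inequality in weighted l^2, tested against the increment
    itself.  The global error is bounded by
    n C tau^2 (1 + L tau)^n, by induction on n for the two-step recursion. *)

From HB Require Import structures.
Require Import Defs.
From mathcomp Require Import all_boot all_order all_algebra.
From mathcomp Require Import complex ring lra zify.
From mathcomp Require Import all_classical all_reals all_analysis.
From mathcomp Require Import measurable_realfun lebesgue_measure.

Set Implicit Arguments.
Unset Strict Implicit.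
Unset Printing Implicit Defensive.

Import Order.TTheory GRing.Theory Num.Theory.
Import numFieldNormedType.Exports.

Local Open Scope classical_set_scope.
Local Open Scope complex_scope.
Local Open Scope ring_scope.

(** * Square-summable and summable families *)

(** Fourier coefficients determine a function only almost everywhere, while the scheme multiplies
    values at points. Passing to sequences therefore rests on a uniqueness theorem: an integrable
    function with zero Fourier coefficients vanishes almost everywhere. It is proved by
    approximating indicators of coordinate rays by trigonometric polynomials, followed by a Dynkin
    class argument.

    The bound in H^(alpha + 1) serves twice: it pays for the discarded phase, and it makes the
    truncation of frequencies to the cube of size N cost only a factor 1 / (N + 1). Truncated sums
    are finite, hence differentiable in time; N goes to infinity once the step has been estimated.

    The starting step integrates over [0, tau] and the others over an interval symmetric about t_n;
    both are instances of [one_step]. The threshold tau_0 keeps the error at most 1, so the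
    numerical solution stays in the ball of radius M + 1 of H^alpha, where the cubic term has a
    fixed Lipschitz constant. *)

Lemma ler_sum_uniq (R : numDomainType) (I : eqType) (s t : seq I) (F : I -> R) :
  uniq s -> {subset s <= t} -> (forall i, 0 <= F i) ->
  \sum_(i <- s) F i <= \sum_(i <- t) F i.
Proof.
move=> us st F0.
have -> : \sum_(i <- s) F i = \sum_(i <- undup t | i \in s) F i.
  rewrite -[RHS]big_filter; apply: perm_big; apply: uniq_perm => //.
    by rewrite filter_uniq// undup_uniq.
  by move=> i; rewrite mem_filter mem_undup; case: (boolP (i \in s)) => // /st ->.
apply: le_trans (_ : \sum_(i <- undup t) F i <= _).
  by rewrite [leRHS](bigID (mem s))/= lerDl sumr_ge0.
elim: t {st} => [//|i t IH /=]; rewrite big_cons.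
case: ifP => _; first by rewrite (le_trans IH)// lerDr.
by rewrite big_cons lerD2l.
Qed.

Section l2.
Context {R : realType}.
Implicit Types (I J : eqType) (B C : R).

(** Norm bounds are expressed through finite subfamilies: no infinite sum has to converge first, and
    such bounds pass to pointwise limits. *)
Definition l2_le I B (x : I -> R) :=
  0 <= B /\ forall K : seq I, uniq K -> \sum_(k <- K) x k ^+ 2 <= B ^+ 2.

Definition l1_le I B (x : I -> R) :=
  0 <= B /\ forall K : seq I, uniq K -> \sum_(k <- K) `|x k| <= B.

Lemma l2_le_mono I B (x y : I -> R) :
  (forall k, `|x k| <= `|y k|) -> l2_le B y -> l2_le B x.
Proof.
move=> xy [B0 H]; split=> // K uK; apply: le_trans (H K uK).
by apply: ler_sum => k _; rewrite -(real_normK (num_real (x k)))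
  -(real_normK (num_real (y k))) lerXn2r ?nnegrE.
Qed.

Lemma l2_le_weaken I B C (x : I -> R) : B <= C -> l2_le B x -> l2_le C x.
Proof.
move=> BC [B0 H]; have C0 := le_trans B0 BC; split=> // K uK.
by rewrite (le_trans (H K uK))// lerXn2r ?nnegrE.
Qed.

Lemma l2_le0 I : l2_le 0 (fun _ : I => 0 : R).
Proof. by split=> // K _; rewrite big1// => k _; rewrite expr0n. Qed.

Lemma l2_leZ I B c (x : I -> R) : l2_le B x -> l2_le (`|c| * B) (fun k => c * x k).
Proof.
move=> [B0 H]; split=> [|K uK]; first by rewrite mulr_ge0.
under eq_bigr do rewrite exprMn.
by rewrite -mulr_sumr exprMn real_normK ?num_real// ler_wpM2l ?sqr_ge0 ?H.
Qed.

Lemma l2_le_eps I B (x : I -> R) : 0 <= B ->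
  (forall e, 0 < e -> l2_le (B + e) x) -> l2_le B x.
Proof.
move=> B0 H; split=> // K uK; apply/ler_addgt0Pl => e e0.
(* Chosen so that (B + f)^2 - B^2 = f (2 B + f) <= e, since f <= 1. *)
pose f := e / (B *+ 2 + 1 + e).
have den : 0 < B *+ 2 + 1 + e by rewrite addr_gt0// ltr_wpDl// mulrn_wge0.
have f0 : 0 < f by rewrite divr_gt0.
have f1 : f <= 1 by rewrite ler_pdivrMr// mul1r lerDr addr_ge0// mulrn_wge0.
have [_ /(_ K uK)/le_trans->//] := H f f0.
have fe : f * (B *+ 2 + 1 + e) = e by rewrite divfK// gt_eqF.
have -> : (B + f) ^+ 2 = f * (B *+ 2 + f) + B ^+ 2 by ring.
rewrite lerD2r -[leRHS]fe; apply: ler_wpM2l; first exact: ltW.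
lra.
Qed.

(* The weighted convexity bound [(x + y)^2 <= (B + C)(x^2 / B + y^2 / C)] gives
   Minkowski's inequality without square roots. *)
Lemma l2_leD I B C (x y : I -> R) :
  l2_le B x -> l2_le C y -> l2_le (B + C) (fun k => x k + y k).
Proof.
move=> hx hy; have [[B0 _] [C0 _]] := (hx, hy).
apply: l2_le_eps => [|e e0]; first exact: addr_ge0.
(* The shift by e / 2 makes both radii positive, so that one can divide by them. *)
pose b := B + e / 2; pose c := C + e / 2.
have e20 : 0 < e / 2 by rewrite divr_gt0.
have b0 : 0 < b by rewrite ltr_wpDl.
have c0 : 0 < c by rewrite ltr_wpDl.
have -> : B + C + e = b + c by rewrite /b /c addrACA -splitr.
have [_ {}hx] : l2_le b x by apply: l2_le_weaken hx; rewrite lerDl ltW.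
have [_ {}hy] : l2_le c y by apply: l2_le_weaken hy; rewrite lerDl ltW.
split=> [|K uK]; first by rewrite addr_ge0// ltW.
have key k : (x k + y k) ^+ 2 <= (b + c) * (x k ^+ 2 / b + y k ^+ 2 / c).
  rewrite -subr_ge0.
  have -> : (b + c) * (x k ^+ 2 / b + y k ^+ 2 / c) - (x k + y k) ^+ 2
            = (c * x k - b * y k) ^+ 2 / (b * c).
    by field; rewrite !gt_eqF.
  by rewrite divr_ge0 ?sqr_ge0// mulr_ge0 ?ltW.
apply: (le_trans (ler_sum _ (fun k _ => key k))).
rewrite -mulr_sumr big_split/= -!mulr_suml expr2.
apply: ler_wpM2l; first by rewrite addr_ge0// ltW.
by rewrite lerD// ler_pdivrMr// -expr2 ?hx ?hy.
Qed.

Lemma l2_le_comp I J B (f : J -> I) (x : I -> R) :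
  injective f -> l2_le B x -> l2_le B (fun k => x (f k)).
Proof.
move=> fI [B0 H]; split=> // K uK.
by have := H (map f K); rewrite map_inj_uniq// big_map; apply.
Qed.

Lemma l2_le_at I B (x : I -> R) k : l2_le B x -> `|x k| <= B.
Proof.
move=> [B0 H]; have := H [:: k] isT; rewrite big_seq1 => h.
by rewrite -(@ler_pXn2r _ 2)// ?nnegrE// real_normK ?num_real.
Qed.

Lemma l2_le_sum I J B (s : seq J) (c : J -> R) (z : J -> I -> R) :
  (forall j, 0 <= c j) -> (forall j, l2_le B (z j)) -> 0 <= B ->
  l2_le ((\sum_(j <- s) c j) * B) (fun k => \sum_(j <- s) c j * z j k).
Proof.
move=> c0 hz B0; elim: s => [|j s IH].
  rewrite big_nil mul0r; split=> // K _.
  by rewrite big1 ?expr0n// => k _; rewrite big_nil expr0n.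
rewrite big_cons mulrDl.
have := l2_leD (l2_leZ (c j) (hz j)) IH; rewrite ger0_norm//.
by apply: l2_le_mono => k; rewrite big_cons.
Qed.

Lemma cvg_sum_seq I (K : seq I) (z : nat -> I -> R) (x : I -> R) :
  (forall k, z n k @[n --> \oo] --> x k) ->
  \sum_(k <- K) z n k @[n --> \oo] --> \sum_(k <- K) x k.
Proof. by move=> h; apply: cvg_big => //; exact: add_continuous. Qed.

(** A form of Fatou's lemma. The slack [e] absorbs truncation errors that vanish only in the
    limit. *)
Lemma l2_le_lim I B (z : nat -> I -> R) (x : I -> R) : 0 <= B ->
  (forall e, 0 < e -> \forall n \near \oo, l2_le (B + e) (z n)) ->
  (forall k, z n k @[n --> \oo] --> x k) -> l2_le B x.
Proof.
move=> B0 H zx; apply: l2_le_eps => // e e0.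
split=> [|K uK]; first by rewrite addr_ge0// ltW.
have cv : \sum_(k <- K) z n k ^+ 2 @[n --> \oo] --> \sum_(k <- K) x k ^+ 2.
  by apply: cvg_sum_seq => k; rewrite expr2; under eq_fun do rewrite expr2; apply: cvgM; exact: zx.
apply: (cvgr_to_le cv).
near=> n; have [_] : l2_le (B + e) (z n) by near: n; exact: H.
exact.
Unshelve. all: by end_near. Qed.

Lemma l1_le_mono I B (x y : I -> R) :
  (forall k, `|x k| <= `|y k|) -> l1_le B y -> l1_le B x.
Proof.
by move=> xy [B0 H]; split=> // K uK; apply: le_trans (H K uK); exact: ler_sum.
Qed.

Lemma le_amgm (v y b : R) : 0 < v -> 0 < b -> 0 <= y ->
  y <= (v * y) ^+ 2 / b + b * (v ^+ 2)^-1.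
Proof.
move=> v0 b0 y0; rewrite -subr_ge0.
have -> : (v * y) ^+ 2 / b + b * (v ^+ 2)^-1 - y
    = ((v * y - b / v) ^+ 2 + b * y) / b by field; rewrite !gt_eqF.
by rewrite divr_ge0 ?addr_ge0 ?sqr_ge0 ?mulr_ge0// ltW.
Qed.

(** The Fourier side of the Sobolev embedding into absolutely convergent series. Summing [le_amgm]
    replaces Cauchy-Schwarz, so the constant is 1 + S instead of a square root of S. *)
Lemma l2_le_l1 I B S (w x : I -> R) : (forall k, 0 < w k) ->
  l1_le S (fun k => (w k ^+ 2)^-1) -> l2_le B (fun k => w k * x k) ->
  l1_le (B * (1 + S)) x.
Proof.
move=> w0 [S0 hS] hx; have [B0 _] := hx.
split=> [|K uK]; first by rewrite mulr_ge0// addr_ge0.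
(* Every b > B is positive, so [le_amgm] applies; b then decreases to B. *)
suff H b : B < b -> \sum_(k <- K) `|x k| <= b * (1 + S).
  apply/ler_addgt0Pl => e e0.
  have S10 : 0 < 1 + S by rewrite ltr_wpDr.
  apply: (le_trans (H (B + e / (1 + S)) _)); first by rewrite ltrDl divr_gt0.
  by rewrite mulrDl divfK ?gt_eqF// addrC.
move=> Bb; have b0 := le_lt_trans B0 Bb.
have [_ /(_ K uK) {}hx] := l2_le_weaken (ltW Bb) hx.
have key k : `|x k| <= (w k * x k) ^+ 2 / b + b * `|(w k ^+ 2)^-1|.
  have -> : `|(w k ^+ 2)^-1| = (w k ^+ 2)^-1.
    by rewrite ger0_norm// invr_ge0 sqr_ge0.
  rewrite -(real_normK (num_real (w k * x k))) normrM (gtr0_norm (w0 k)).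
  exact: le_amgm.

apply: (le_trans (ler_sum _ (fun k _ => key k))).
rewrite big_split/= -mulr_suml -mulr_sumr mulrDr mulr1 lerD//.
  by rewrite ler_pdivrMr// -expr2.
by rewrite ler_wpM2l ?hS// ltW.
Qed.

End l2.

(** * The frequency lattice *)

Section zeta.
Context {R : realType}.
Variables (q : R) (q1 : 1 < q).

(* Dyadic blocks: [2^j] terms of size at most [2^(-j q)]. *)
Lemma zeta_dyadic J :
  \sum_(1 <= m < 2 ^ J) (m%:R : R) `^ (- q) <= \sum_(j < J) (2 `^ (1 - q)) ^+ j.
Proof.
elim: J => [|J IH]; first by rewrite expn0 big_geq// big_ord0.
rewrite big_ord_recr/= (@big_cat_nat _ _ _ (2 ^ J))/= ?expn_gt0 ?leq_exp2l//.
rewrite lerD//.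
apply: (@le_trans _ _ (\sum_(2 ^ J <= m < 2 ^ J.+1) (2 ^ J)%:R `^ (- q))).
  rewrite big_seq [leRHS]big_seq; apply: ler_sum => m; rewrite mem_index_iota => /andP[Jm _].
  rewrite !powRN lef_pV2 ?posrE ?powR_gt0 ?ltr0n ?expn_gt0 ?(leq_trans _ Jm) ?expn_gt0//.
  by rewrite ge0_ler_powR ?nnegrE ?ler0n ?ler_nat// ltW// (lt_trans _ q1).
rewrite sumr_const_nat expnS mul2n -addnn addnK natrX.
rewrite -[leLHS]mulr_natl natrX -!powR_mulrn ?powR_ge0// -!powRrM.
rewrite -powRD; last by rewrite pnatr_eq0 implybT.
by rewrite mulrBl mul1r mulrN [q * _]mulrC.
Qed.

Lemma zeta_bounded : exists S : R, forall N, \sum_(1 <= m < N) (m%:R : R) `^ (- q) <= S.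
Proof.
pose r : R := 2 `^ (1 - q).
have r0 : 0 < r by rewrite powR_gt0.
have r1 : r < 1.
  have e : 1 - q = - (q - 1) by rewrite opprB.
  rewrite /r e powRN invf_lt1 ?powR_gt0//.
  by rewrite /powR pnatr_eq0/= expR_gt1 mulr_gt0 ?subr_gt0// ln_gt0// ltr1n.
exists (1 - r)^-1 => N.
have N2 : (N <= 2 ^ N)%N by rewrite ltnW// ltn_expl.
apply: (@le_trans _ _ (\sum_(1 <= m < 2 ^ N) (m%:R : R) `^ (- q))).
  have [N1|N0] := leqP 1 N; last by rewrite big_geq// ?sumr_ge0 // ltnW.
  by rewrite [leRHS](@big_cat_nat _ _ _ N)//= lerDl sumr_ge0// => m _; exact: powR_ge0.
apply: (le_trans (zeta_dyadic N)).
have := subrX1 r N; rewrite -/r => e.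
have {}e : (1 - r) * \sum_(i < N) r ^+ i = 1 - r ^+ N.
  by rewrite -[LHS]opprK -mulNr opprB -e opprB.
have r1' : 0 < 1 - r by rewrite subr_gt0.
by rewrite -[leRHS]mul1r ler_pdivlMr// mulrC e gerBl exprn_ge0// ltW.
Qed.

End zeta.

Section int_sum.
Context {R : realType}.

(** From (n + 1)^2 <= 2 (1 + n^2), the terms are dominated by those of a zeta series of exponent 2 p
    > 1. *)
Lemma int_l1 (p : R) : 1 / 2 < p ->
  exists S, l1_le S (fun z : int => (1 + z%:~R ^+ 2) `^ (- p) : R).
Proof.
move=> p2; have q1 : 1 < 2 * p by lra.
have [S HS] := zeta_bounded q1.
pose g n : R := (1 + n%:R ^+ 2) `^ (- p).
have g0 n : 0 <= g n by exact: powR_ge0.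
have gmono m n : (m <= n)%N -> g n <= g m.
  move=> mn; rewrite /g !powRN lef_pV2 ?posrE ?powR_gt0 ?ltr_wpDr ?sqr_ge0//.
  rewrite ge0_ler_powR ?nnegrE ?addr_ge0 ?sqr_ge0//; first lra.
  by rewrite lerD2l lerXn2r ?nnegrE ?ler0n ?ler_nat.
have gb n : g n <= 2 `^ p * n.+1%:R `^ (- (2 * p)).
  have n0 : 0 < 1 + n%:R ^+ 2 :> R by rewrite ltr_wpDr ?sqr_ge0.
  rewrite /g !powRN -[leLHS]mul1r ler_pdivrMr ?powR_gt0// -mulrA mulrC -mulrA.
  rewrite powRrM powR_mulrn// -powRM ?(ltW n0)// [leRHS]mulrC ler_pdivlMr ?powR_gt0 ?exprn_gt0//.
  rewrite mul1r ge0_ler_powR ?nnegrE ?mulr_ge0 ?exprn_ge0 ?(ltW n0)//; first lra.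
  rewrite -natr1; have : (0:R) <= (n%:R - 1) ^+ 2 by exact: sqr_ge0.
  by nra.
pose S' := 2 `^ p * S.
have gS N : \sum_(n <- iota 0 N) g n <= S'.
  apply: (@le_trans _ _ (2 `^ p * \sum_(1 <= m < N.+1) m%:R `^ (- (2 * p)))).
    rewrite mulr_sumr big_add1/= /index_iota subn0.
    by apply: ler_sum => n _; exact: gb.
  by rewrite ler_wpM2l ?powR_ge0.
have S'0 : 0 <= S' by have := gS 0%N; rewrite big_nil.
(* One copy bounds the nonnegative integers, the other the negative ones. *)
exists (S' + S'); split=> [|K uK]; first exact: addr_ge0.
pose N := (\max_(z <- K) `|z|.+1)%N.
have KN z : z \in K -> (`|z| < N)%N by move=> zK; rewrite /N (big_rem z)//= leq_max ltnSn.
under eq_bigr do rewrite ger0_norm ?powR_ge0//.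
apply: (le_trans (@ler_sum_uniq _ _ K
  ([seq Posz n | n <- iota 0 N] ++ [seq Negz n | n <- iota 0 N]) _ uK _ _)).
- move=> [n|n] /KN/= nN; rewrite mem_cat; apply/orP; [left|right];
    apply/mapP; exists n => //; rewrite mem_iota//=.
  exact: ltnW.
- by move=> z; exact: powR_ge0.
rewrite big_cat !big_map/= lerD//; apply: le_trans (gS N); apply: ler_sum => n _ //.
by rewrite NegzE mulrNz sqrrN; exact: gmono.
Qed.

End int_sum.

(** * Cubes of frequencies and summability over the lattice *)

Section lattice.
Context {R : realType} {d : nat}.
Implicit Types (k l m : freq d) (N : nat).

Definition cube N : seq (freq d) :=
  [seq cube_freq j | j <- enum {: d.-tuple 'I_N.*2.+1}].

Lemma mem_cube N k : (k \in cube N) = [forall i, (`|tnth k i| <= N)%N].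
Proof.
apply/mapP/forallP => [[j _ ->] i|kN].
  rewrite tnth_mktuple; move: (ltn_ord (tnth j i)).
  by move: (nat_of_ord (tnth j i)) => n; lia.
have jP i : (`|(tnth k i + N%:Z)%R| < N.*2.+1)%N by have := kN i; lia.
exists [tuple Ordinal (jP i) | i < d]; first by rewrite mem_enum.
apply: eq_from_tnth => i; rewrite !tnth_mktuple/=.
by have := kN i; lia.
Qed.

Lemma cube_uniq N : uniq (cube N).
Proof.
rewrite map_inj_uniq ?enum_uniq// => j j' e; apply: eq_from_tnth => i.
have := congr1 (fun t : freq d => tnth t i) e; rewrite !tnth_mktuple => /addIr[].
exact: val_inj.
Qed.

Lemma sub_cube N N' : (N <= N')%N -> {subset cube N <= cube N'}.
Proof.
move=> NN' k; rewrite !mem_cube => /forallP kN; apply/forallP => i.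
exact: leq_trans (kN i) NN'.
Qed.

Lemma seq_sub_cube (K : seq (freq d)) : exists N, {subset K <= cube N}.
Proof.
exists (\max_(k <- K) \max_i `|tnth k i|%N)%N => k kK.
rewrite mem_cube; apply/forallP => i; rewrite (big_rem k)//= leq_max.
by rewrite (@leq_bigmax _ (fun i => `|tnth k i|%N)).
Qed.

(** The square of the Japanese bracket of k. *)
Definition jap k : R := 1 + normsq k.

Lemma normsq_ge0 k : 0 <= normsq k :> R.
Proof. by apply: sumr_ge0 => i _; exact: sqr_ge0. Qed.

Lemma normsq_ge k i : (tnth k i)%:~R ^+ 2 <= normsq k :> R.
Proof. by rewrite /normsq (bigD1 i)//= lerDl sumr_ge0// => j _; exact: sqr_ge0. Qed.

Lemma jap_ge1 k : 1 <= jap k. Proof. by rewrite lerDl normsq_ge0. Qed.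

Lemma jap_gt0 k : 0 < jap k. Proof. exact: lt_le_trans (jap_ge1 k). Qed.

(** Writing [jap k] to the power s as d factors of exponent s / d and keeping one coordinate in each
    bounds the sum by the d-th power of a one-dimensional sum, whose exponent s / d exceeds 1 /
    2. *)
Lemma jap_l1 (s : R) : d%:R / 2 < s -> exists S, l1_le S (fun k => (jap k `^ s)^-1).
Proof.
(* For d = 0 the lattice is a single point, of weight 1. *)
case: (posnP d) => [d0 _|d0 sd].
  exists 1; split=> // K uK.
  have kk k l : k = l by apply: eq_from_tnth => -[i id]; exfalso; rewrite d0 in id.
  have j1 k : jap k = 1.
    by rewrite /jap /normsq big1 ?addr0// => -[i id]; exfalso; rewrite d0 in id.
  under eq_bigr do rewrite j1 powR1 invr1 normr1.
  case: K uK => [|k [|l K]]; rewrite ?big_nil ?big_seq1//.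
  by rewrite (kk l k)/= inE eqxx.
have dR : 0 < d%:R :> R by rewrite ltr0n.
have p2 : 1 / 2 < s / d%:R.
  by rewrite ltr_pdivlMr// mul1r mulrC.
have [S hS] := int_l1 p2; have [S0 _] := hS.
exists (S ^+ d); split=> [|K uK]; first exact: exprn_ge0.
have [N KN] := seq_sub_cube K.
pose h (z : int) : R := (1 + z%:~R ^+ 2) `^ (- (s / d%:R)).
have h0 z : 0 <= h z by exact: powR_ge0.
have s0 : 0 <= s / d%:R by lra.
have key k : `|(jap k `^ s)^-1| <= \prod_i h (tnth k i).
  have -> : \prod_i h (tnth k i) = (\prod_i (1 + (tnth k i)%:~R ^+ 2) `^ (s / d%:R))^-1.
    by rewrite -prodfV; apply: eq_bigr => i _; rewrite /h powRN.
  rewrite ger0_norm ?invr_ge0 ?powR_ge0// lef_pV2 ?posrE ?powR_gt0 ?jap_gt0//; last first.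
    by apply: prodr_gt0 => i _; rewrite powR_gt0// ltr_wpDr ?sqr_ge0.
  have -> : jap k `^ s = \prod_(i < d) jap k `^ (s / d%:R).
    by rewrite prodr_const card_ord -powR_mulrn ?powR_ge0// -powRrM divfK// gt_eqF.
  apply: ler_prod => i _; rewrite powR_ge0/= ge0_ler_powR ?nnegrE ?addr_ge0 ?sqr_ge0 ?normsq_ge0//.
  by rewrite lerD2l normsq_ge.
apply: (le_trans (ler_sum _ (fun k _ => key k))).
(* The cube is reindexed by functions of the coordinate, over which a sum of products factors. *)
pose e (f : {ffun 'I_d -> 'I_N.*2.+1}) : freq d := [tuple (f i)%:Z - N%:Z | i < d].
apply: (le_trans (@ler_sum_uniq _ _ K [seq e f | f <- enum {: {ffun 'I_d -> 'I_N.*2.+1}}]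
   (fun k => \prod_i h (tnth k i)) uK _ _)).
- move=> k /KN /mapP[j _ ->]; apply/mapP; exists [ffun i => tnth j i].
    by rewrite mem_enum.
  by apply: eq_from_tnth => i; rewrite !tnth_mktuple ffunE.
- by move=> k; exact: prodr_ge0.
rewrite big_map big_enum/=.
under eq_bigr do under eq_bigr do rewrite tnth_mktuple.
rewrite -(@bigA_distr_bigA _ _ _ _ _ _ _ (fun _ (j : 'I_N.*2.+1) => h ((j : nat)%:Z - N%:Z))).
rewrite prodr_const card_ord lerXn2r ?nnegrE ?sumr_ge0//.
have [_ /(_ [seq (j%:Z - N%:Z) | j : 'I_N.*2.+1])] := hS.
rewrite big_map big_enum/= map_inj_uniq ?enum_uniq//; last first.
  by move=> i j /addIr[]; exact: val_inj.
move=> /(_ isT); apply: le_trans; apply: ler_sum => j _.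
exact: ler_norm.
Qed.

End lattice.

(** * Weighted sequence spaces and the cubic convolution *)

Section weights.
Context {R : realType} {d : nat}.
Implicit Types (k l m : freq d) (S : seq (freq d)) (s B : R) (x y z : freq d -> R).

(* the square root of the weight of H^s *)
Definition sobw s k : R := jap k `^ (s / 2).

Definition hs_le s B x := l2_le B (fun k => sobw s k * x k).

Lemma sobw_gt0 s k : 0 < sobw s k.
Proof. by rewrite powR_gt0 ?jap_gt0. Qed.

Lemma sobw_sq s k : sobw s k ^+ 2 = jap k `^ s.
Proof. by rewrite /sobw -powR_mulrn ?powR_ge0// -powRrM divfK. Qed.

Lemma sobw_ge1 s k : 0 <= s -> 1 <= sobw s k.
Proof.
move=> s0; rewrite -[leLHS](powRr0 (jap k)) ler_powR ?jap_ge1//.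
by rewrite divr_ge0.
Qed.

Lemma hs_le_mono s B x y :
  (forall k, `|x k| <= `|y k|) -> hs_le s B y -> hs_le s B x.
Proof.
by move=> xy; apply: l2_le_mono => k; rewrite !normrM ler_wpM2l.
Qed.

Lemma hs_leD s B C x y :
  hs_le s B x -> hs_le s C y -> hs_le s (B + C) (fun k => x k + y k).
Proof.
by move=> hx hy; apply: l2_le_mono (l2_leD hx hy) => k; rewrite mulrDr.
Qed.

Lemma hs_leZ s B c x : hs_le s B x -> hs_le s (`|c| * B) (fun k => c * x k).
Proof.
by move=> hx; apply: l2_le_mono (l2_leZ c hx) => k; rewrite mulrCA.
Qed.

Lemma hs_le_lim s B (z : nat -> freq d -> R) x : 0 <= B ->
  (forall e, 0 < e -> \forall n \near \oo, hs_le s (B + e) (z n)) ->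
  (forall k, z n k @[n --> \oo] --> x k) -> hs_le s B x.
Proof.
move=> B0 H zx; apply: (l2_le_lim B0 H) => k.
by apply: cvgM => //; exact: cvg_cst.
Qed.

Lemma hs_le_at s B x k : 0 <= s -> hs_le s B x -> `|x k| <= B.
Proof.
move=> s0 hx; apply: le_trans (l2_le_at k hx).
by rewrite normrM ler_peMl// gtr0_norm ?sobw_gt0// sobw_ge1.
Qed.

(** Since |k| is at most the Japanese bracket of k, one derivative costs one unit of regularity. *)
Lemma hs_le_weight s B x :
  hs_le (s + 1) B x -> hs_le s B (fun k => Num.sqrt (normsq k) * x k).
Proof.
apply: l2_le_mono => k; rewrite !normrM mulrA ler_wpM2r//.
rewrite !(gtr0_norm (sobw_gt0 _ _)) ger0_norm ?sqrtr_ge0//.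
rewrite /sobw mulrDl powRD ?(gt_eqF (jap_gt0 _)) ?implybT//.
rewrite ler_wpM2l ?powR_ge0// div1r powR12_sqrt ?(ltW (jap_gt0 _))//.
by rewrite ler_sqrt ?(ltW (jap_gt0 _))// /jap lerDr.
Qed.

Lemma hs_le_drop s B x : hs_le (s + 1) B x -> hs_le s B x.
Proof.
apply: l2_le_mono => k; rewrite !normrM ler_wpM2r//.
rewrite !(gtr0_norm (sobw_gt0 _ _)) ler_powR ?jap_ge1//.
by rewrite ler_pM2r// lerDl.
Qed.

(** Outside the cube some coordinate is at least N + 1 in absolute value, so the extra derivative
    gains 1 / (N + 1). This rate depends on x only through B, hence is uniform along the
    solution. *)
Lemma hs_le_tail s B N x : hs_le (s + 1) B x ->
  hs_le s (N.+1%:R^-1 * B) (fun k => if k \in cube N then 0 else x k).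
Proof.
move=> hx; have N0 : 0 < N.+1%:R^-1 :> R by rewrite invr_gt0.
have := l2_leZ N.+1%:R^-1 hx; rewrite gtr0_norm//; apply: l2_le_mono => k.
case: ifPn => [_|]; first by rewrite mulr0 normr0.
rewrite mem_cube => kN.
have [i Ni] : exists i, (N < `|tnth k i|)%N.
  apply: contrapT => H; move/negP: kN; apply; apply/forallP => i.
  by rewrite leqNgt; apply/negP => Ni; apply: H; exists i.
rewrite !normrM mulrA ler_wpM2r// !(gtr0_norm (sobw_gt0 _ _)).
rewrite (gtr0_norm N0) mulrC ler_pdivlMr// /sobw mulrDl powRD ?(gt_eqF (jap_gt0 _)) ?implybT//.
rewrite ler_wpM2l ?powR_ge0// div1r powR12_sqrt ?(ltW (jap_gt0 _))//.
rewrite -[leLHS](ger0_norm (ler0n _ _)) -sqrtr_sqr ler_sqrt ?(ltW (jap_gt0 _))//.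
apply: le_trans (_ : normsq k <= _); last by rewrite /jap lerDr.
apply: le_trans (normsq_ge k i).
rewrite -[leRHS]real_normK ?num_real// lerXn2r ?nnegrE ?ler0n//.
by rewrite -intr_norm -abszE -pmulrn ler_nat.
Qed.

(* The resonance [k1 + k2 - k3], the frequency of [e_k1 * e_k2 * conj e_k3]. *)
Definition reso k l m : freq d := [tuple tnth k i + tnth l i - tnth m i | i < d].

(** Solving for one entry of a resonance gives a resonance again; this turns the constrained sums of
    [tri] into superpositions of reindexed sequences. *)
Lemma reso_eq1 k l m n : (reso k l m == n) = (k == reso n m l).
Proof.
by apply/eqP/eqP => e; [rewrite -e|rewrite e]; apply: eq_from_tnth => i;
  rewrite !tnth_mktuple; ring.
Qed.

Lemma reso_eq2 k l m n : (reso k l m == n) = (l == reso n m k).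
Proof.
by apply/eqP/eqP => e; [rewrite -e|rewrite e]; apply: eq_from_tnth => i;
  rewrite !tnth_mktuple; ring.
Qed.

Lemma reso_eq3 k l m n : (reso k l m == n) = (m == reso k l n).
Proof.
by apply/eqP/eqP => e; [rewrite -e|rewrite e]; apply: eq_from_tnth => i;
  rewrite !tnth_mktuple; ring.
Qed.

Lemma reso_inj1 l m : injective (fun k => reso k l m).
Proof. by move=> k k' /eqP; rewrite reso_eq1 => /eqP->; apply/esym/eqP; rewrite -reso_eq1. Qed.

Lemma reso_inj3 k l : injective (fun m => reso k l m).
Proof. by move=> m m' /eqP; rewrite reso_eq3 => /eqP->; apply/esym/eqP; rewrite -reso_eq3. Qed.

(** The trilinear convolution with input frequencies restricted to [S]. The value type is left open
    to serve both complex sums and their real majorants. *)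
Definition tri (V : nmodType) S (F : freq d -> freq d -> freq d -> V) k : V :=
  \sum_(k1 <- S) \sum_(k2 <- S) \sum_(k3 <- S | reso k1 k2 k3 == k) F k1 k2 k3.

Lemma eq_tri (V : nmodType) S (F G : freq d -> freq d -> freq d -> V) k :
  (forall k1 k2 k3, k1 \in S -> k2 \in S -> k3 \in S -> F k1 k2 k3 = G k1 k2 k3) ->
  tri S F k = tri S G k.
Proof.
move=> FG; rewrite /tri big_seq [RHS]big_seq; apply: eq_bigr => k1 h1.
rewrite big_seq [RHS]big_seq; apply: eq_bigr => k2 h2.
by rewrite big_seq_cond [RHS]big_seq_cond; apply: eq_bigr => k3 /andP[h3 _]; exact: FG.
Qed.

Lemma triD (V : nmodType) S (F G : freq d -> freq d -> freq d -> V) k :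
  tri S (fun k1 k2 k3 => F k1 k2 k3 + G k1 k2 k3) k = tri S F k + tri S G k.
Proof.
rewrite /tri -big_split; apply: eq_bigr => k1 _; rewrite -big_split.
by apply: eq_bigr => k2 _; rewrite -big_split.
Qed.

Lemma triZ (V : pzRingType) S (F : freq d -> freq d -> freq d -> V) c k :
  tri S (fun k1 k2 k3 => c * F k1 k2 k3) k = c * tri S F k.
Proof.
rewrite /tri mulr_sumr; apply: eq_bigr => k1 _; rewrite mulr_sumr.
by apply: eq_bigr => k2 _; rewrite mulr_sumr.
Qed.

Lemma triN (V : zmodType) S (F : freq d -> freq d -> freq d -> V) k :
  tri S (fun k1 k2 k3 => - F k1 k2 k3) k = - tri S F k.
Proof.
rewrite /tri -sumrN; apply: eq_bigr => k1 _; rewrite -sumrN.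
by apply: eq_bigr => k2 _; rewrite -sumrN.
Qed.

Lemma ler_tri S (F G : freq d -> freq d -> freq d -> R) k :
  (forall k1 k2 k3, reso k1 k2 k3 = k -> F k1 k2 k3 <= G k1 k2 k3) ->
  tri S F k <= tri S G k.
Proof.
move=> FG; apply: ler_sum => k1 _; apply: ler_sum => k2 _.
by apply: ler_sum => k3 /eqP; exact: FG.
Qed.

Lemma tri_ge0 S (F : freq d -> freq d -> freq d -> R) k :
  (forall k1 k2 k3, 0 <= F k1 k2 k3) -> 0 <= tri S F k.
Proof. by move=> F0; apply: sumr_ge0 => *; apply: sumr_ge0 => *; exact: sumr_ge0. Qed.

Lemma sum_pred1_le S x k : uniq S -> (forall k, 0 <= x k) ->
  \sum_(l <- S | l == k) x l <= x k.
Proof.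
move=> uS x0; rewrite big_mkcond; have [kS|kS] := boolP (k \in S).
  rewrite (bigD1_seq k)//= eqxx big1 ?addr0// => l /negPf lk.
  by rewrite lk.
rewrite big_seq big1// => l lS; case: eqP => // lk; by rewrite -lk lS in kS.
Qed.

(** Young's inequality by Minkowski: the sum superposes injective reindexings of x, all with the
    same square-summable bound, with total weight at most Y Z. *)
Lemma l2_le_sum2 S (f : freq d -> freq d -> freq d -> freq d) B Y Z x y z :
  (forall l m, injective (f l m)) ->
  (forall k, 0 <= y k) -> (forall k, 0 <= z k) -> uniq S ->
  l2_le B x -> l1_le Y y -> l1_le Z z ->
  l2_le (B * Y * Z)
    (fun k => \sum_(l <- S) y l * (\sum_(m <- S) z m * x (f l m k))).
Proof.
move=> fI y0 z0 uS hx hy hz.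
have [[[B0 _] [Y0 /(_ S uS) hyS]] [Z0 /(_ S uS) hzS]] := (hx, hy, hz).
have sy : \sum_(l <- S) y l <= Y.
  by apply: le_trans hyS; apply: ler_sum => l _; exact: ler_norm.
have sz : \sum_(l <- S) z l <= Z.
  by apply: le_trans hzS; apply: ler_sum => l _; exact: ler_norm.
have -> : B * Y * Z = Y * (Z * B) by ring.
have ZB : 0 <= Z * B by rewrite mulr_ge0.
apply: (@l2_le_weaken _ _ ((\sum_(l <- S) y l) * (Z * B))).
  by rewrite ler_wpM2r.
apply: (l2_le_sum S y0 (z := fun l k => \sum_(m <- S) z m * x (f l m k))) => // l.
apply: (@l2_le_weaken _ _ ((\sum_(l <- S) z l) * B)); first by rewrite ler_wpM2r.
apply: (l2_le_sum S z0 (z := fun m k => x (f l m k))) => // m.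
exact: l2_le_comp hx.
Qed.

Section young.
Variables (S : seq (freq d)) (uS : uniq S) (X Y Z : R) (x y z : freq d -> R).
Hypotheses (x0 : forall k, 0 <= x k) (y0 : forall k, 0 <= y k).
Hypotheses (z0 : forall k, 0 <= z k).

Let F k1 k2 k3 := x k1 * y k2 * z k3.

Let F0 k1 k2 k3 : 0 <= F k1 k2 k3. Proof. by rewrite !mulr_ge0. Qed.

(** Once k2 and k3 are fixed, the constraint leaves at most one k1 in [S]. The two companion lemmas
    put the square-summable factor in the second and third slot. *)
Lemma tri_young1 : l2_le X x -> l1_le Y y -> l1_le Z z ->
  l2_le (X * Y * Z) (tri S F).
Proof.
move=> hx hy hz.
apply: l2_le_mono (l2_le_sum2 (f := fun l m k => reso k m l) _ y0 z0 uS hx hy hz);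
  last by move=> l m; exact: reso_inj1.
move=> k; rewrite !ger0_norm ?tri_ge0//; last first.
  by apply: sumr_ge0 => l _; rewrite mulr_ge0// sumr_ge0// => m _; rewrite mulr_ge0.
rewrite /tri exchange_big; apply: ler_sum => k2 _ /=.
rewrite (exchange_big_dep xpredT)//= mulr_sumr; apply: ler_sum => k3 _.
under eq_bigl do rewrite reso_eq1.
have -> : \sum_(k1 <- S | k1 == reso k k3 k2) F k1 k2 k3
    = y k2 * z k3 * \sum_(k1 <- S | k1 == reso k k3 k2) x k1.
  by rewrite mulr_sumr; apply: eq_bigr => k1 _; rewrite /F; ring.
by rewrite -mulrA ler_wpM2l// ler_wpM2l// sum_pred1_le.
Qed.

Lemma tri_young2 : l1_le X x -> l2_le Y y -> l1_le Z z ->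
  l2_le (X * Y * Z) (tri S F).
Proof.
move=> hx hy hz; rewrite [X * Y]mulrC.
apply: l2_le_mono (l2_le_sum2 (f := fun l m k => reso k m l) _ x0 z0 uS hy hx hz);
  last by move=> l m; exact: reso_inj1.
move=> k; rewrite !ger0_norm ?tri_ge0//; last first.
  by apply: sumr_ge0 => l _; rewrite mulr_ge0// sumr_ge0// => m _; rewrite mulr_ge0.
apply: ler_sum => k1 _ /=.
rewrite (exchange_big_dep xpredT)//= mulr_sumr; apply: ler_sum => k3 _.
under eq_bigl do rewrite reso_eq2.
have -> : \sum_(k2 <- S | k2 == reso k k3 k1) F k1 k2 k3
    = x k1 * z k3 * \sum_(k2 <- S | k2 == reso k k3 k1) y k2.
  by rewrite mulr_sumr; apply: eq_bigr => k2 _; rewrite /F; ring.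
by rewrite -mulrA ler_wpM2l// ler_wpM2l// sum_pred1_le.
Qed.

Lemma tri_young3 : l1_le X x -> l1_le Y y -> l2_le Z z ->
  l2_le (X * Y * Z) (tri S F).
Proof.
move=> hx hy hz; have -> : X * Y * Z = Z * X * Y by ring.
apply: l2_le_mono (l2_le_sum2 (f := fun l m k => reso l m k) _ x0 y0 uS hz hx hy);
  last by move=> l m; exact: reso_inj3.
move=> k; rewrite !ger0_norm ?tri_ge0//; last first.
  by apply: sumr_ge0 => l _; rewrite mulr_ge0// sumr_ge0// => m _; rewrite mulr_ge0.
apply: ler_sum => k1 _ /=.
rewrite mulr_sumr; apply: ler_sum => k2 _.
under eq_bigl do rewrite reso_eq3.
by rewrite -mulr_sumr -mulrA ler_wpM2l// ler_wpM2l// sum_pred1_le.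
Qed.

End young.

Lemma sqr3_le (a b c : R) : (a + b - c) ^+ 2 <= 3 * (a ^+ 2 + b ^+ 2 + c ^+ 2).
Proof.
rewrite -subr_ge0; have -> : 3 * (a ^+ 2 + b ^+ 2 + c ^+ 2) - (a + b - c) ^+ 2
  = (a - b) ^+ 2 + (a + c) ^+ 2 + (b + c) ^+ 2 by ring.
by rewrite !addr_ge0 ?sqr_ge0.
Qed.

Lemma sobw_reso s k1 k2 k3 : 0 <= s ->
  sobw s (reso k1 k2 k3) <= 9 `^ (s / 2) * (sobw s k1 + sobw s k2 + sobw s k3).
Proof.
move=> s0; have s20 : 0 <= s / 2 by rewrite divr_ge0.
pose m : R := Num.max (jap k1) (Num.max (jap k2) (jap k3)).
have m1 : jap k1 <= m by rewrite le_max lexx.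
have m2 : jap k2 <= m by rewrite !le_max lexx orbT.
have m3 : jap k3 <= m by rewrite !le_max lexx !orbT.
have m0 : 1 <= m := le_trans (jap_ge1 k1) m1.
(* By [sqr3_le] the left side is at most 1 + 3 (|k1|^2 + |k2|^2 + |k3|^2), which is three times the
   sum of the [jap ki], minus 8. *)
have jm : jap (reso k1 k2 k3) <= 9 * m.
  apply: (@le_trans _ _ (1 + 3 * (normsq k1 + normsq k2 + normsq k3))).
    rewrite lerD2l /normsq -!big_split/= mulr_sumr; apply: ler_sum => i _.
    rewrite tnth_mktuple rmorphB rmorphD/=.
    exact: sqr3_le.
  by move: m1 m2 m3 m0; rewrite /jap; lra.
rewrite /sobw; apply: (@le_trans _ _ ((9 * m) `^ (s / 2))).
  have m0' : 0 <= 9 * m by rewrite mulr_ge0// (le_trans _ m0).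
  by rewrite ge0_ler_powR ?nnegrE ?(ltW (jap_gt0 _)).
rewrite powRM ?(le_trans _ m0)// ler_wpM2l ?powR_ge0//.
have p0 k := powR_ge0 (jap k) (s / 2).
by rewrite /m !maxElt; case: ifP => _; [case: ifP => _|];
  move: (p0 k1) (p0 k2) (p0 k3); lra.
Qed.

(** The algebra property of H^s for s > d / 2: the weight at the output frequency falls on one
    factor at a time, and the other two factors are summable. *)
Lemma hs_tri s : d%:R / 2 < s -> 0 <= s -> exists2 K, 0 < K &
  forall S X Y Z x y z, uniq S -> (forall k, 0 <= x k) ->
    (forall k, 0 <= y k) -> (forall k, 0 <= z k) ->
    hs_le s X x -> hs_le s Y y -> hs_le s Z z ->
    hs_le s (K * X * Y * Z) (tri S (fun k1 k2 k3 => x k1 * y k2 * z k3)).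
Proof.
move=> sd s0; have [A hA] := jap_l1 sd; have [A0 _] := hA.
pose c : R := 9 `^ (s / 2).
have c0 : 0 < c by rewrite powR_gt0.
have A1 : 0 < 1 + A by rewrite ltr_wpDr.
(* c from distributing the weight, 3 from the choice of the weighted factor, and 1 + A from each of
   two embeddings. *)
exists (c * 3 * (1 + A) ^+ 2); first by rewrite !mulr_gt0// exprn_gt0.
move=> S X Y Z x y z uS x0 y0 z0 hx hy hz.
have l1 B w : hs_le s B w -> l1_le (B * (1 + A)) w.
  apply: l2_le_l1; first by move=> k; exact: sobw_gt0.
  by apply: l1_le_mono hA => k; rewrite sobw_sq.
have w0 w k : (forall k, 0 <= w k) -> 0 <= sobw s k * w k.
  by move=> w0; rewrite mulr_ge0// ltW// sobw_gt0.
have h1 := tri_young1 uS (fun k => w0 x k x0) y0 z0 hx (l1 _ _ hy) (l1 _ _ hz).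
have h2 := tri_young2 uS x0 (fun k => w0 y k y0) z0 (l1 _ _ hx) hy (l1 _ _ hz).
have h3 := tri_young3 uS x0 y0 (fun k => w0 z k z0) (l1 _ _ hx) (l1 _ _ hy) hz.
have := l2_leZ c (l2_leD (l2_leD h1 h2) h3); rewrite gtr0_norm//.
set B := (X in l2_le X _); have -> : B = c * 3 * (1 + A) ^+ 2 * X * Y * Z by rewrite /B; ring.
apply: l2_le_mono => k; rewrite -!triD -triZ -triZ.
have t0 k1 k2 k3 : 0 <= x k1 * y k2 * z k3 by rewrite !mulr_ge0.
have v0 := fun k => ltW (sobw_gt0 s k).
rewrite !ger0_norm ?tri_ge0// => [|k1 k2 k3|k1 k2 k3].
- apply: ler_tri => k1 k2 k3 <-.
  rewrite [leRHS](_ : _ = c * (sobw s k1 + sobw s k2 + sobw s k3) * (x k1 * y k2 * z k3)); last by ring.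
  by rewrite ler_wpM2r// sobw_reso.
- apply: mulr_ge0; first exact: ltW.
  by rewrite !addr_ge0 ?mulr_ge0 ?v0.
- by rewrite mulr_ge0.
Qed.

End weights.

(** * Complex-valued functions *)

Notation nc := ComplexField.Normc.normc.

Section complex_facts.
Context {R : realType}.
Implicit Types (x y : R) (z w : R[i]).

Lemma nc_ge0 z : 0 <= nc z. Proof. by case: z => a b; exact: sqrtr_ge0. Qed.

Lemma ncD z w : nc (z + w) <= nc z + nc w.
Proof. exact: le_normcD. Qed.

Lemma ncM z w : nc (z * w) = nc z * nc w.
Proof. exact: ComplexField.Normc.normcM. Qed.

Lemma ncN z : nc (- z) = nc z.
Proof. exact: normcN. Qed.

Lemma nc0 : nc (0 : R[i]) = 0. Proof. exact: ComplexField.Normc.normc0. Qed.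

Lemma nc1 : nc (1 : R[i]) = 1. Proof. exact: ComplexField.Normc.normc1. Qed.

Lemma nc_distC z w : nc (z - w) = nc (w - z).
Proof. by rewrite -ncN opprB. Qed.

Lemma ncJ z : nc z^* = nc z.
Proof. by case: z => a b /=; rewrite sqrrN. Qed.

Lemma nc_sqr z : nc z ^+ 2 = complex.Re z ^+ 2 + complex.Im z ^+ 2.
Proof. by case: z => a b /=; rewrite sqr_sqrtr// addr_ge0 ?sqr_ge0. Qed.

Lemma nc_Re z : `|complex.Re z| <= nc z.
Proof.
rewrite -(@ler_pXn2r _ 2)// ?nnegrE ?nc_ge0// nc_sqr real_normK ?num_real//.
by rewrite lerDl sqr_ge0.
Qed.

Lemma nc_Im z : `|complex.Im z| <= nc z.
Proof.
rewrite -(@ler_pXn2r _ 2)// ?nnegrE ?nc_ge0// nc_sqr real_normK ?num_real//.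
by rewrite lerDr sqr_ge0.
Qed.

Lemma nc_real x : nc x%:C = `|x|.
Proof. by rewrite /= expr0n/= addr0 sqrtr_sqr. Qed.

Lemma nc_i : nc ('i%C : R[i]) = 1.
Proof. by rewrite /= expr0n/= add0r expr1n sqrtr1. Qed.

Lemma nc_le_ReIm z : nc z <= `|complex.Re z| + `|complex.Im z|.
Proof.
rewrite [z in nc z]complexE; apply: le_trans (ncD _ _) _.
by rewrite ncM nc_i mul1r !nc_real.
Qed.

Lemma nc_sum (I : Type) (s : seq I) (P : pred I) (F : I -> R[i]) :
  nc (\sum_(i <- s | P i) F i) <= \sum_(i <- s | P i) nc (F i).
Proof.
elim/big_ind2 : _ => [|a b u v ab uv|//]; first by rewrite nc0.
exact: le_trans (ncD _ _) (lerD ab uv).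
Qed.

Lemma cReD z w : complex.Re (z + w) = complex.Re z + complex.Re w.
Proof. by case: z w => [a b] [c e]. Qed.

Lemma cImD z w : complex.Im (z + w) = complex.Im z + complex.Im w.
Proof. by case: z w => [a b] [c e]. Qed.

Lemma cReB z w : complex.Re (z - w) = complex.Re z - complex.Re w.
Proof. by case: z w => [a b] [c e]. Qed.

Lemma cImB z w : complex.Im (z - w) = complex.Im z - complex.Im w.
Proof. by case: z w => [a b] [c e]. Qed.

Lemma cReM z w : complex.Re (z * w) =
  complex.Re z * complex.Re w - complex.Im z * complex.Im w.
Proof. by case: z w => [a b] [c e]. Qed.

Lemma cImM z w : complex.Im (z * w) =
  complex.Re z * complex.Im w + complex.Im z * complex.Re w.
Proof. by case: z w => [a b] [c e]. Qed.

Lemma cReJ z : complex.Re z^* = complex.Re z. Proof. by case: z. Qed.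

Lemma cImJ z : complex.Im z^* = - complex.Im z. Proof. by case: z. Qed.

Definition cis x : R[i] := cos x +i* sin x.

Lemma cexp_i x : cexp ('i%C * x%:C) = cis x.
Proof.
rewrite /cexp cReM cImM /= !mul0r !mulr0 mul1r subr0 add0r expR0.
by rewrite mul1r.
Qed.

Lemma cis0 : cis 0 = 1. Proof. by rewrite /cis cos0 sin0. Qed.

Lemma cisD x y : cis (x + y) = cis x * cis y.
Proof. by rewrite /cis cosD sinD; apply/eqP; rewrite eq_complex/= eqxx/= addrC. Qed.

Lemma cisJ x : (cis x)^* = cis (- x).
Proof. by rewrite /cis cosN sinN. Qed.

Lemma nc_cis x : nc (cis x) = 1.
Proof. by rewrite /= cos2Dsin2 sqrtr1. Qed.

Lemma cisD2pi x (n : int) : cis (x + n%:~R * (pi *+ 2)) = cis x.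
Proof.
rewrite /cis; suff H (m : nat) y : cis (y + m%:R * (pi *+ 2)) = cis y.
  case: n => m; first exact: H.
  rewrite NegzE mulrNz mulNr; have := H m.+1 (x - m.+1%:R * (pi *+ 2)).
  by rewrite subrK.
rewrite mulr_natl /cis; congr (_ +i* _).
  exact: (periodicn (@cosD2pi R)).
exact: (periodicn (@sinD2pi R)).
Qed.

Lemma measurable_cos : measurable_fun setT (@cos R).
Proof. apply: continuous_measurable_fun; exact: continuous_cos. Qed.

Lemma measurable_sin : measurable_fun setT (@sin R).
Proof. apply: continuous_measurable_fun; exact: continuous_sin. Qed.

End complex_facts.

(** * Integration of complex-valued functions against a probability *)

Section cint.
Context dd (T : measurableType dd) (R : realType) (P : probability T R).
Implicit Types (f g : T -> R[i]) (M : R).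

Definition cmeas f := measurable_fun setT (fun x => complex.Re (f x)) /\
  measurable_fun setT (fun x => complex.Im (f x)).

Definition cintegrable f :=
  P.-integrable setT (EFin \o (fun x => complex.Re (f x))) /\
  P.-integrable setT (EFin \o (fun x => complex.Im (f x))).

Definition cint f : R[i] :=
  (\int[P]_x complex.Re (f x)) +i* (\int[P]_x complex.Im (f x)).

Lemma cmeasD f g : cmeas f -> cmeas g -> cmeas (fun x => f x + g x).
Proof.
move=> [f1 f2] [g1 g2]; split.
  under eq_fun do rewrite raddfD/=; exact: measurable_funD.
under eq_fun do rewrite raddfD/=; exact: measurable_funD.
Qed.

Lemma cmeasM f g : cmeas f -> cmeas g -> cmeas (fun x => f x * g x).
Proof.
move=> [f1 f2] [g1 g2]; split.
  under eq_fun do rewrite cReM.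
  by apply: measurable_funB; exact: measurable_funM.
under eq_fun do rewrite cImM.
by apply: measurable_funD; exact: measurable_funM.
Qed.

Lemma cmeas_cst c : cmeas (fun=> c).
Proof. by split; exact: measurable_cst. Qed.

Lemma cmeasJ f : cmeas f -> cmeas (fun x => (f x)^*).
Proof.
move=> [f1 f2]; split.
  by under eq_fun do rewrite cReJ.
under eq_fun do rewrite cImJ.
exact: measurableT_comp.
Qed.

Lemma cmeas_sum (I : Type) (s : seq I) (F : I -> T -> R[i]) :
  (forall i, cmeas (F i)) -> cmeas (fun x => \sum_(i <- s) F i x).
Proof.
move=> hF; elim: s => [|i s IH].
  by under eq_fun do rewrite big_nil; exact: cmeas_cst.
by under eq_fun do rewrite big_cons; exact: cmeasD.
Qed.

Lemma integrable_bounded (f : T -> R) M : measurable_fun setT f ->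
  (\forall x \ae P, `|f x| <= M) -> P.-integrable setT (EFin \o f).
Proof.
move=> mf fM; apply/integrableP; split; first exact/measurable_EFinP.
apply: (@le_lt_trans _ _ (\int[P]_x (Num.max M 0)%:E)%E); last first.
  by rewrite integral_cst// [X in (_ * X)%E]probability_setT mule1 ltry.
apply: ae_ge0_le_integral => //.
- by apply/measurableT_comp => //; exact/measurable_EFinP.
- by move=> x _; rewrite lee_fin le_max lexx orbT.
- apply: filterS fM => x xM _ /=.
  by rewrite lee_fin le_max xM.
Qed.

Lemma Rintegral_bounded (f : T -> R) M : 0 <= M -> measurable_fun setT f ->
  (\forall x \ae P, `|f x| <= M) -> `|\int[P]_x f x| <= M.
Proof.
move=> M0 mf fM; have fi := integrable_bounded mf fM.
rewrite -lee_fin EFin_normr_Rintegral//.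
apply: le_trans (le_abse_integral _ _ _) _ => //; first exact/measurable_EFinP.
apply: (@le_trans _ _ (\int[P]_x M%:E)%E); last first.
  by rewrite integral_cst// [X in (_ * X)%E]probability_setT mule1.
apply: ae_ge0_le_integral => //.
- by apply/measurableT_comp => //; exact/measurable_EFinP.
- by apply: filterS fM => x xM _ /=; rewrite lee_fin.
Qed.

Lemma cintegrable_bounded f M : cmeas f ->
  (\forall x \ae P, nc (f x) <= M) -> cintegrable f.
Proof.
move=> [f1 f2] fM; split; apply: (@integrable_bounded _ M) => //;
  apply: filterS fM => x; apply: le_trans; [exact: nc_Re|exact: nc_Im].
Qed.

(** Real and imaginary parts are bounded separately, hence the factor 2. *)
Lemma nc_cint_le f M : 0 <= M -> cmeas f ->
  (\forall x \ae P, nc (f x) <= M) -> nc (cint f) <= 2 * M.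
Proof.
move=> M0 [f1 f2] fM; rewrite mulr_natl mulr2n.
apply: le_trans (nc_le_ReIm _) _; apply: lerD;
  apply: Rintegral_bounded => //; apply: filterS fM => x; apply: le_trans;
  [exact: nc_Re|exact: nc_Im].
Qed.

Lemma cintegrable_meas f : cintegrable f -> cmeas f.
Proof.
by move=> [/integrableP[f1 _] /integrableP[f2 _]]; split; exact/measurable_EFinP.
Qed.

Lemma cintegrableD f g : cintegrable f -> cintegrable g ->
  cintegrable (fun x => f x + g x).
Proof.
move=> [f1 f2] [g1 g2]; split.
  rewrite (_ : _ \o _ = (EFin \o (fun x => complex.Re (f x))) \+
    (EFin \o (fun x => complex.Re (g x))))%E; first exact: integrableD.
  by apply/funext => x /=; rewrite raddfD EFinD.
rewrite (_ : _ \o _ = (EFin \o (fun x => complex.Im (f x))) \+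
  (EFin \o (fun x => complex.Im (g x))))%E; first exact: integrableD.
by apply/funext => x /=; rewrite raddfD EFinD.
Qed.

Lemma cintD f g : cintegrable f -> cintegrable g ->
  cint (fun x => f x + g x) = cint f + cint g.
Proof.
move=> [f1 f2] [g1 g2]; rewrite /cint.
under eq_Rintegral do rewrite raddfD/=.
under [X in _ +i* X]eq_Rintegral do rewrite raddfD/=.
by rewrite !RintegralD.
Qed.

Lemma integrableM_bounded (w h : T -> R) M : P.-integrable setT (EFin \o w) ->
  measurable_fun setT h -> (forall x, `|h x| <= M) ->
  P.-integrable setT (EFin \o (fun x => w x * h x)).
Proof.
move=> wi mh hM.
rewrite (_ : _ \o _ = (EFin \o w) \* (EFin \o h))%E; last first.
  by apply/funext => x /=; rewrite EFinM.
apply: integrableMl => //; exists M; split; first exact: num_real.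
by move=> y My x _; apply: le_trans (hM x) (ltW My).
Qed.

Lemma cintegrableM f g M : cintegrable f -> cmeas g -> (forall x, nc (g x) <= M) ->
  cintegrable (fun x => f x * g x).
Proof.
move=> [f1 f2] [g1 g2] gM.
have h1 x : `|complex.Re (g x)| <= M := le_trans (nc_Re _) (gM x).
have h2 x : `|complex.Im (g x)| <= M := le_trans (nc_Im _) (gM x).
split.
  rewrite (_ : _ \o _ = (EFin \o (fun x => complex.Re (f x) * complex.Re (g x))%R) \-
    (EFin \o (fun x => complex.Im (f x) * complex.Im (g x))%R))%E; last first.
    by apply/funext => x /=; rewrite cReM EFinB.
  by apply: integrableB => //; apply: integrableM_bounded.
rewrite (_ : _ \o _ = (EFin \o (fun x => complex.Re (f x) * complex.Im (g x))%R) \+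
  (EFin \o (fun x => complex.Im (f x) * complex.Re (g x))%R))%E; last first.
  by apply/funext => x /=; rewrite cImM EFinD.
by apply: integrableD => //; apply: integrableM_bounded.
Qed.

Lemma cintZ f c : cintegrable f -> cint (fun x => c * f x) = c * cint f.
Proof.
move=> [f1 f2]; rewrite /cint.
have i1 (a : R) (h : T -> R) : P.-integrable setT (EFin \o h) ->
    P.-integrable setT (EFin \o (fun x => a * h x)).
  by move=> hi; rewrite (_ : _ \o _ = (fun x => a%:E * (h x)%:E))%E//;
    exact: integrableZl.
under eq_Rintegral do rewrite cReM.
under [X in _ +i* X]eq_Rintegral do rewrite cImM.
rewrite RintegralB ?RintegralD ?RintegralZl//; try exact: i1.
by case: c => a b.
Qed.

Lemma cintegrableZ f c : cintegrable f -> cintegrable (fun x => c * f x).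
Proof.
move=> fi; under eq_fun do rewrite mulrC.
by apply: (cintegrableM (M := nc c)) => //; exact: cmeas_cst.
Qed.

Lemma cintegrableB f g : cintegrable f -> cintegrable g ->
  cintegrable (fun x => f x - g x).
Proof.
move=> fi gi; under eq_fun do rewrite -mulN1r.
by apply: cintegrableD => //; exact: cintegrableZ.
Qed.

Lemma cintB f g : cintegrable f -> cintegrable g ->
  cint (fun x => f x - g x) = cint f - cint g.
Proof.
move=> fi gi; rewrite -mulN1r -cintZ// -cintD//; last exact: cintegrableZ.
by congr cint; apply/funext => x; rewrite mulN1r.
Qed.

Lemma cintegrable0 : cintegrable (fun=> 0).
Proof. by split; exact: (@finite_measure_integrable_cst _ _ _ P). Qed.

Lemma cint0 : cint (fun=> 0) = 0.
Proof. by rewrite /cint !Rintegral_cst// !mul0r. Qed.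

Lemma cintegrable_sum (I : Type) (s : seq I) (F : I -> T -> R[i]) :
  (forall i, cintegrable (F i)) -> cintegrable (fun x => \sum_(i <- s) F i x).
Proof.
move=> hF; elim: s => [|i s IH].
  by under eq_fun do rewrite big_nil; exact: cintegrable0.
by under eq_fun do rewrite big_cons; exact: cintegrableD.
Qed.

Lemma cint_sum (I : Type) (s : seq I) (F : I -> T -> R[i]) :
  (forall i, cintegrable (F i)) ->
  cint (fun x => \sum_(i <- s) F i x) = \sum_(i <- s) cint (F i).
Proof.
move=> hF; elim: s => [|i s IH].
  by rewrite big_nil -[RHS]cint0; congr cint; apply/funext => x; rewrite big_nil.
rewrite big_cons -IH -cintD//; last exact: cintegrable_sum.
by congr cint; apply/funext => x; rewrite big_cons.
Qed.

Lemma eq_cint f g : f =1 g -> cint f = cint g.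
Proof. by move=> /funext->. Qed.

End cint.

(** * Uniqueness of an integrable function with vanishing moments *)

Section level_sets.
Context {R : realType}.
Implicit Types (q t y : R).

Lemma one_sub_expn_le y n : 0 <= y <= 1 -> 1 - (1 - y) ^+ n <= n%:R * y.
Proof.
move=> /andP[y0 y1]; elim: n => [|n IH]; first by rewrite expr0 subrr mul0r.
have u0 : 0 <= 1 - y by rewrite subr_ge0.
have u1 : (1 - y) ^+ n <= 1 by rewrite exprn_ile1// gerBl.
have h : (1 - y) ^+ n * y <= y by rewrite ler_piMl.
rewrite exprSr -natr1; lra.
Qed.

(** A consequence of (1 - y)^n (1 + n y) <= 1, a companion of Bernoulli's inequality. *)
Lemma expn_one_sub_le y n : 0 <= y <= 1 -> (1 - y) ^+ n * (n%:R * y) <= 1.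
Proof.
move=> /andP[y0 y1]; have u0 : 0 <= 1 - y by rewrite subr_ge0.
apply: (@le_trans _ _ ((1 - y) ^+ n * (1 + n%:R * y))).
  by rewrite ler_wpM2l ?exprn_ge0// lerDr.
elim: n => [|n IH]; first by rewrite expr0 mul0r addr0 mulr1.
apply: le_trans IH; rewrite exprSr -mulrA ler_wpM2l ?exprn_ge0//.
have -> : (1 - y) * (1 + n.+1%:R * y) = 1 + n%:R * y - n.+1%:R * y ^+ 2.
  by rewrite -natr1; ring.
by rewrite gerBl mulr_ge0// sqr_ge0.
Qed.

(** The polynomials 1 - (1 - q^n)^N of elementary proofs of the Stone-Weierstrass theorem, with N
    close to t^-n. Then N q^n behaves like (q / t)^n, so the polynomial tends to 0 for q < t and to
    1 for q > t. *)
Definition step_exp t n : nat := (Num.truncn (t^-1 ^+ n)).+1.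

Definition step_fun t n q : R := 1 - (1 - q ^+ n) ^+ step_exp t n.

Lemma step_itv t n q : 0 <= q <= 1 -> 0 <= step_fun t n q <= 1.
Proof.
move=> /andP[q0 q1].
have y0 : 0 <= q ^+ n by rewrite exprn_ge0.
have y1 : q ^+ n <= 1 by rewrite exprn_ile1.
by rewrite /step_fun subr_ge0 exprn_ile1 ?gerBl ?exprn_ge0 ?subr_ge0.
Qed.

Lemma step_cvg t q : 0 < t -> t < 1 -> 0 <= q <= 1 -> q != t ->
  step_fun t n q @[n --> \oo] --> ((t < q)%R%:R : R).
Proof.
move=> t0 t1 /andP[q0 q1] qt.
have yb n : 0 <= q ^+ n <= 1 by rewrite exprn_ge0// exprn_ile1.
have sb n : 0 <= step_fun t n q <= 1 by apply: step_itv; rewrite q0.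
have T0 n : 0 <= t^-1 ^+ n by rewrite exprn_ge0// invr_ge0 ltW.
have geo (z : R) : 0 <= z -> z < 1 -> z ^+ n @[n --> \oo] --> 0.
  by move=> z0 z1; apply: cvg_expr; rewrite ger0_norm.
have [tq|qt'] := ltP t q.
  have cv : 1 - (t / q) ^+ n @[n --> \oo] --> (1 : R).
    rewrite -[X in _ --> X]subr0; apply: cvgB; first exact: cvg_cst.
    have q0' := lt_trans t0 tq.
    by apply: geo; rewrite ?ltr_pdivrMr ?mul1r// divr_ge0// ltW.
  apply: (squeeze_cvgr _ cv (cvg_cst (1 : R))); apply: nearW => n.
  have /andP[_ ->] := sb n; rewrite andbT /step_fun lerD2l lerN2.
  have y0 : 0 < q ^+ n by rewrite exprn_gt0// (lt_trans t0).
  have K0 : 0 < (step_exp t n)%:R * q ^+ n by rewrite mulr_gt0.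
  have : (1 - q ^+ n) ^+ step_exp t n <= ((step_exp t n)%:R * q ^+ n)^-1.
    by rewrite -[leRHS]mul1r ler_pdivlMr// expn_one_sub_le.
  move/le_trans; apply; rewrite expr_div_n -[_ / _]invrK invf_div.
  rewrite lef_pV2 ?posrE// ?divr_gt0 ?exprn_gt0 ?(lt_trans t0 tq)// mulrC ler_wpM2r ?(ltW y0)//.
  by rewrite -exprVn ltW// /step_exp truncnS_gt.
have ltqt : q < t by rewrite lt_neqAle qt.
(* The summand q^n pays for the successor in [step_exp]. *)
have cv : (q / t) ^+ n + q ^+ n @[n --> \oo] --> (0 : R).
  rewrite -[X in _ --> X]addr0; apply: cvgD; apply: geo => //.
  - by rewrite divr_ge0// ltW.
  - by rewrite ltr_pdivrMr// mul1r.
  - exact: lt_trans ltqt t1.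
apply: (squeeze_cvgr _ (cvg_cst (0 : R)) cv); apply: nearW => n.
have /andP[-> _] := sb n; rewrite /step_fun.
apply: le_trans (one_sub_expn_le _ (yb n)) _.
rewrite expr_div_n mulrC -[X in _ + X]mulr1 -mulrDr ler_wpM2l ?exprn_ge0//.
by rewrite /step_exp -natr1 lerD2r -exprVn truncn_le.
Qed.

End level_sets.

(** * Vanishing almost everywhere, tested against a class stable under products and complements *)

Section approx.
Context dd (T : measurableType dd) (R : realType) (P : probability T R).
Variable Q : (T -> R) -> Prop.
Hypothesis Q1 : Q (fun=> 1).
Hypothesis QM : forall f g, Q f -> Q g -> Q (fun x => f x * g x).
Hypothesis QC : forall f, Q f -> Q (fun x => 1 - f x).
Hypothesis Qm : forall f, Q f -> measurable_fun setT f.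

(** Values in [0, 1] give both stability under intersection, by products, and the domination needed
    to pass to the limit under the integral. *)
Definition approximable (A : set T) := measurable A /\
  exists p : nat -> T -> R, [/\ forall n, Q (p n), forall n x, 0 <= p n x <= 1 &
    \forall x \ae P, p n x @[n --> \oo] --> (\1_A x : R)].

Lemma QX f n : Q f -> Q (fun x => f x ^+ n).
Proof.
move=> Qf; elim: n => [|n IH]; first exact: Q1.
by under eq_fun do rewrite exprS; exact: QM.
Qed.

Lemma approximableT : approximable setT.
Proof.
split=> //; exists (fun _ _ => 1); split=> [n|n x|]; first exact: Q1.
  by rewrite ler01 lexx.
by apply: aeW => x; rewrite indicT; exact: cvg_cst.
Qed.

Lemma approximableC A : approximable A -> approximable (~` A).
Proof.
move=> [mA [p [Qp pb pA]]]; split; first exact: measurableC.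
exists (fun n x => 1 - p n x); split=> [n|n x|]; first exact: QC.
  by have /andP[p0 p1] := pb n x; rewrite subr_ge0 p1 gerBl.
apply: filterS pA => x pA.
rewrite (_ : \1_(~` A) x = 1 - \1_A x); first by apply: cvgB => //; exact: cvg_cst.
by rewrite !indicE in_setC; case: (x \in A); rewrite ?subrr ?subr0.
Qed.

Lemma approximableI : setI_closed approximable.
Proof.
move=> A B [mA [p [Qp pb pA]]] [mB [q [Qq qb qB]]].
split; first exact: measurableI.
exists (fun n x => p n x * q n x); split=> [n|n x|]; first exact: QM.
  have /andP[p0 p1] := pb n x; have /andP[q0 q1] := qb n x.
  by rewrite mulr_ge0// mulr_ile1.
apply: filterS2 pA qB => x pA qB.
by rewrite indicI; exact: cvgM.
Qed.

Lemma approximable_ae A B : measurable A -> approximable B ->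
  (\forall x \ae P, A x <-> B x) -> approximable A.
Proof.
move=> mA [_ [p [Qp pb pB]]] AB; split=> //; exists p; split=> //.
apply: filterS2 pB AB => x pB AB; rewrite (_ : \1_A x = \1_B x)//.
by rewrite !indicE; congr ((nat_of_bool _)%:R); apply/idP/idP; rewrite !inE => /AB.
Qed.

(** [step_fun] uses only powers and complements to 1, so it does not leave [Q]; it converges to the
    indicator of t < q off the level q = t. *)
Lemma approximable_level A q (t : R) : measurable A -> Q q ->
  (forall x, 0 <= q x <= 1) -> 0 < t -> t < 1 ->
  (\forall x \ae P, q x != t /\ (A x <-> t < q x)) -> approximable A.
Proof.
move=> mA Qq qb t0 t1 At; split=> //; exists (fun n x => step_fun t n (q x)).
split=> [n|n x|]; first by apply: QC; apply: QX; apply: QC; exact: QX.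
  exact: step_itv.
apply: filterS At => x [qt Ax].
rewrite (_ : \1_A x = (t < q x)%R%:R); first exact: step_cvg.
by rewrite indicE; congr ((nat_of_bool _)%:R); apply/idP/idP; rewrite !inE => /Ax.
Qed.

Variable w : T -> R.
Hypothesis wi : P.-integrable setT (EFin \o w).
Hypothesis wQ : forall q, Q q -> (forall x, 0 <= q x <= 1) ->
  (\int[P]_x (w x * q x)%:E = 0)%E.

Lemma integral_indicM A : (\int[P]_(x in A) (w x)%:E = \int[P]_x (w x * \1_A x)%:E)%E.
Proof.
rewrite integral_mkcond; apply: eq_integral => x _; rewrite patchE indicE.
by case: (x \in A); rewrite ?mulr1 ?mulr0.
Qed.

Lemma integral_approximable A : approximable A -> (\int[P]_(x in A) (w x)%:E = 0)%E.
Proof.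
move=> [mA [p [Qp pb pA]]]; rewrite integral_indicM.
have mw : measurable_fun setT w by apply/measurable_EFinP; case/integrableP: wi.
have [|||||_ _] := @dominated_convergence _ T R P setT measurableT
  (fun n x => (w x * p n x)%:E) (fun x => (w x * \1_A x)%:E) (fun x => `|(w x)%:E|%E).
- move=> n; apply/measurable_EFinP; apply: measurable_funM => //; exact: Qm.
- by apply/measurable_EFinP; apply: measurable_funM.
- apply: filterS pA => x pA _; apply: cvg_EFin; first exact: nearW.
  by apply: cvgM => //; exact: cvg_cst.
- exact: integrable_abse.
- apply: aeW => x n _; rewrite /= lee_fin normrM ler_piMr//.
  by have /andP[p0 p1] := pb n x; rewrite ger0_norm.
under eq_fun do rewrite wQ//.
by move=> /cvg_lim <-//; apply: lim_cst.
Qed.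

(** The approximable sets are stable under intersection, so Dynkin's theorem carries the vanishing
    of the integrals of w to all measurable sets. *)
Lemma ae_eq0_approximable : @measurable _ T = <<s approximable >> ->
  \forall x \ae P, w x = 0.
Proof.
move=> gen.
have H A : measurable A -> (\int[P]_(x in A) (w x)%:E = 0)%E.
  rewrite {1}gen; move: A.
  apply: (@dynkin_induction _ T approximable (fun A => \int[P]_(x in A) (w x)%:E = 0)%E) => //.
  - exact: approximableI.
  - exact/integral_approximable/approximableT.
  - exact: integral_approximable.
  - move=> S mS IS; have : (\int[P]_(x in S `|` ~` S) (w x)%:E = 0)%E.
      by rewrite setUv; exact/integral_approximable/approximableT.
    rewrite integral_setU_EFin ?IS ?add0e//; first exact: measurableC.
      by rewrite setUv; apply/measurable_EFinP; case/integrableP: wi.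
    by rewrite disj_set2E setICr.
  - move=> F mF tF IF; rewrite integral_bigcup//; last first.
      by apply: integrableS wi => //; exact: bigcup_measurable.
    by apply: eseries0 => n _ _; exact: IF.
have := @integral_ae_eq _ _ _ P setT measurableT (cst 0%E) (EFin \o w) wi.
move=> /(_ (measurable_cst _)) []; last first.
  move=> N [mN N0 sN]; exists N; split=> // x /= wx; apply: sN => /= h.
  by apply: wx; have [] := h I.
by move=> E _ mE; rewrite H// integral0.
Qed.

End approx.

(** * Characters of the torus *)

Section torus_measure.
Context {R : realType}.

Notation unif := (uniform_prob (@pi2_gt0 R)).

Lemma unif_cos_ge0 (h : R -> R) (H : R -> R) : continuous h ->
  (forall x, 0 <= h x) -> (forall x : R, is_derive x 1 H (h x)) ->
  (\int[unif]_x (h x)%:E = ((pi *+ 2)^-1 * (H (pi *+ 2) - H 0))%:E)%E.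
Proof.
move=> hc h0 Hd; rewrite integral_uniform//; last first.
  by apply/measurable_EFinP; exact: continuous_measurable_fun.
rewrite subr0 (@continuous_FTC2 _ _ H) ?pi2_gt0 -?EFinM//.
- exact: continuous_subspaceT.
- split=> [x _||].
  + by have [] := Hd x.
  + apply: cvg_at_right_filter; apply: differentiable_continuous.
    by apply/derivable1_diffP; have [] := Hd 0.
  + apply: cvg_at_left_filter; apply: differentiable_continuous.
    by apply/derivable1_diffP; have [] := Hd (pi *+ 2).
- by move=> x _; rewrite derive1E; have [_ ->] := Hd x.
Qed.

Lemma Rintegral_unif_trig (g G : R -> R) : continuous g ->
  (forall x, `|g x| <= 1) -> (forall x : R, is_derive x 1 G (g x)) ->
  G (pi *+ 2) = G 0 -> \int[unif]_x g x = 0.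
Proof.
move=> gc g1 Gd G2; have pi0 := @pi2_gt0 R.
have mg : measurable_fun setT g by exact: continuous_measurable_fun.
have gi : unif.-integrable setT (EFin \o g).
  by apply: (@integrable_bounded _ _ _ unif _ 1) => //; exact: aeW.
have ci : unif.-integrable setT (EFin \o cst 1).
  exact: finite_measure_integrable_cst.
(* Adding 1 makes the integrand nonnegative, as [unif_cos_ge0] requires. *)
apply: (@addrI _ 1); rewrite addr0.
have {1}<- : \int[unif]_x (cst 1 x) = 1.
  by rewrite Rintegral_cst// [X in fine X]probability_setT mulr1.
rewrite -RintegralD// /Rintegral (@unif_cos_ge0 (fun x => 1 + g x) (fun x => x + G x)).
- by rewrite G2 add0r addrK /= mulVf// gt_eqF.
- by move=> x; apply: cvgD; [exact: cvg_cst|exact: gc].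
- by move=> x; have := g1 x; rewrite ler_norml => /andP[+ _]; rewrite -subr_ge0 opprK addrC.
Qed.

Lemma measurable_cis (a : R) : cmeas (fun x : measurableTypeR R => cis (a * x)).
Proof.
have m : measurable_fun setT (fun x : R => a * x) by exact: measurable_funM.
split; [exact: (measurableT_comp measurable_cos m)|].
exact: (measurableT_comp measurable_sin m).
Qed.

Lemma cint_unif_cis (n : int) : cint unif (fun x => cis (n%:~R * x)) = (n == 0)%:R.
Proof.
have [->|n0] := eqVneq n 0.
  under eq_fun do rewrite mul0r cis0.
  by rewrite /cint !Rintegral_cst// [X in fine X]probability_setT /= mulr1 mul0r.
have a0 : n%:~R != 0 :> R by rewrite intr_eq0.
pose a : R := n%:~R; rewrite -/a.
have lin (x : R) : is_derive x 1 (fun x => a * x) a.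
  by apply: is_derive_eq (is_deriveZ a (is_derive_id x 1)) _; rewrite /GRing.scale/= mulr1.
have per : cis (a * (pi *+ 2)) = cis (a * 0) :> R[i].
  by rewrite mulr0 -[a * _]add0r cisD2pi.
have [/= pc ps] := per.
have lc : continuous (fun x : R => a * x) by move=> x; apply: cvgM => //; exact: cvg_cst.
rewrite /cint; congr (_ +i* _).
- apply: (@Rintegral_unif_trig (fun x => cos (a * x)) (fun x => a^-1 * sin (a * x))).
  + by move=> x; apply: (continuous_comp (lc x)); exact: continuous_cos.
  + by move=> x; rewrite ler_norml cos_geN1 cos_le1.
  + move=> x; apply: (is_derive_eq (is_deriveZ a^-1 (is_derive1_comp (is_derive_sin (a * x)) (lin x)))).
    by rewrite /GRing.scale/=; field.
  + by rewrite ps.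
- apply: (@Rintegral_unif_trig (fun x => sin (a * x)) (fun x => - a^-1 * cos (a * x))).
  + by move=> x; apply: (continuous_comp (lc x)); exact: continuous_sin.
  + by move=> x; rewrite ler_norml sin_geN1 sin_le1.
  + move=> x; apply: (is_derive_eq (is_deriveZ (- a^-1) (is_derive1_comp (is_derive_cos (a * x)) (lin x)))).
    by rewrite /GRing.scale/=; field.
  + by rewrite pc.
Qed.

Lemma Rintegral_prod d1 d2 (T1 : measurableType d1) (T2 : measurableType d2)
    (P1 : probability T1 R) (P2 : probability T2 R) (g : T1 -> R) (h : T2 -> R) :
  measurable_fun setT g -> measurable_fun setT h ->
  (forall x, `|g x| <= 1) -> (forall x, `|h x| <= 1) ->
  \int[(P1 \x P2)%E]_z (g z.1 * h z.2) = \int[P1]_x g x * \int[P2]_y h y.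
Proof.
move=> mg mh g1 h1.
have gi : P1.-integrable setT (EFin \o g) by apply: (@integrable_bounded _ _ _ _ _ 1) => //; exact: aeW.
have hi : P2.-integrable setT (EFin \o h) by apply: (@integrable_bounded _ _ _ _ _ 1) => //; exact: aeW.
have fi : (P1 \x P2)%E.-integrable setT (EFin \o (fun z => g z.1 * h z.2)).
  apply: (@integrable_bounded _ _ _ (P1 \x P2)%E _ 1).
    by apply: measurable_funM; apply: measurableT_comp.
  by apply: aeW => z; rewrite normrM mulr_ile1.
rewrite /Rintegral -(integral12_prod_meas1 fi) /fubini_F/=.
under eq_integral => x _.
  under eq_integral do rewrite EFinM.
  rewrite integralZl// -[X in (_ * X)%E]fineK ?integrable_fin_num// -EFinM mulrC EFinM.
  over.
rewrite integralZl//= fineM//; last exact: integrable_fin_num.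
by rewrite mulrC.
Qed.

Lemma cint_prod d1 d2 (T1 : measurableType d1) (T2 : measurableType d2)
    (P1 : probability T1 R) (P2 : probability T2 R) (g : T1 -> R[i]) (h : T2 -> R[i]) :
  cmeas g -> cmeas h -> (forall x, nc (g x) <= 1) -> (forall x, nc (h x) <= 1) ->
  cint (P1 \x P2)%E (fun z => g z.1 * h z.2) = cint P1 g * cint P2 h.
Proof.
move=> [g1 g2] [h1 h2] gb hb.
have gR x := le_trans (nc_Re (g x)) (gb x); have gI x := le_trans (nc_Im (g x)) (gb x).
have hR x := le_trans (nc_Re (h x)) (hb x); have hI x := le_trans (nc_Im (h x)) (hb x).
have int (a : T1 -> R) (b : T2 -> R) : measurable_fun setT a -> measurable_fun setT b ->
    (forall x, `|a x| <= 1) -> (forall x, `|b x| <= 1) ->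
    (P1 \x P2)%E.-integrable setT (EFin \o (fun z => a z.1 * b z.2)).
  move=> ma mb a1 b1; apply: (@integrable_bounded _ _ _ (P1 \x P2)%E _ 1).
    by apply: measurable_funM; apply: measurableT_comp.
  by apply: aeW => z; rewrite normrM mulr_ile1.
rewrite /cint; under eq_Rintegral do rewrite cReM.
under [X in _ +i* X]eq_Rintegral do rewrite cImM.
have i1 := int _ _ g1 h1 gR hR; have i2 := int _ _ g2 h2 gI hI.
have i3 := int _ _ g1 h2 gR hI; have i4 := int _ _ g2 h1 gI hR.
rewrite RintegralB ?RintegralD// (@Rintegral_prod _ _ _ _ P1 P2 _ _ g1 h1 gR hR).
rewrite (@Rintegral_prod _ _ _ _ P1 P2 _ _ g2 h2 gI hI).
rewrite (@Rintegral_prod _ _ _ _ P1 P2 _ _ g1 h2 gR hI).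
by rewrite (@Rintegral_prod _ _ _ _ P1 P2 _ _ g2 h1 gI hR).
Qed.

Lemma echarE d (k : freq d) (x : tpoint d) :
  echar k x = cis (\sum_(i < d) (tnth k i)%:~R * (tnth x i : R)).
Proof. by rewrite /echar cexp_i. Qed.

Lemma nc_echar d (k : freq d) (x : tpoint d) : nc (echar k x : R[i]) = 1.
Proof. by rewrite echarE nc_cis. Qed.

Lemma cmeas_cis_comp dd (T : measurableType dd) (f : T -> R) :
  measurable_fun setT f -> cmeas (fun x => cis (f x)).
Proof.
move=> mf; split; [exact: (measurableT_comp measurable_cos mf)|].
exact: (measurableT_comp measurable_sin mf).
Qed.

Lemma cmeas_echar d (k : freq d) : cmeas (echar k : tpoint d -> R[i]).
Proof.
rewrite (_ : echar k = fun x => cis (\sum_(i < d) (tnth k i)%:~R * (tnth x i : R))); last first.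
  by apply: funext => x; rewrite echarE.
apply: cmeas_cis_comp; apply: measurable_sum => i.
by apply: measurable_funM => //; exact: measurable_tnth.
Qed.

Lemma cint_haarS d (f : tpoint d.+1 -> R[i]) (M : R) : cmeas f ->
  (forall x, nc (f x) <= M) ->
  cint (haar d.+1) f = cint (unif \x haar d)%E (fun p => f (cons_point p)).
Proof.
move=> [f1 f2] fM; rewrite /cint; congr (_ +i* _); rewrite /Rintegral /=;
  congr fine; rewrite integral_distribution//; try exact/measurable_EFinP.
- apply: (@integrable_bounded _ _ _ (unif \x haar d)%E _ M).
    exact: (measurableT_comp f1 (@measurable_cons_point R d)).
  by apply: aeW => x; apply: le_trans (nc_Re _) (fM _).
- apply: (@integrable_bounded _ _ _ (unif \x haar d)%E _ M).
    exact: (measurableT_comp f2 (@measurable_cons_point R d)).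
  by apply: aeW => x; apply: le_trans (nc_Im _) (fM _).
Qed.

Lemma cint_echar d (k : freq d) :
  cint (haar d) (echar k) = [forall i, tnth k i == 0]%:R :> R[i].
Proof.
elim: d k => [|d IH] k.
  have -> : [forall i, tnth k i == 0] by apply/forallP => -[].
  rewrite /cint /Rintegral !integral_dirac//; try by apply/measurable_EFinP; case: (cmeas_echar k).
  by rewrite !diracT !mul1e echarE big_ord0 cis0.
rewrite (cint_haarS (M := 1)); [|exact: cmeas_echar|by move=> x; rewrite nc_echar].
pose k' : freq d := [tuple of behead k].
have E p : echar k (cons_point p) = cis ((thead k)%:~R * p.1) * echar k' p.2 :> R[i].
  rewrite !echarE -cisD big_ord_recl; congr (cis (_ + _)).
  apply: eq_bigr => i _; rewrite tnthS; congr (_%:~R * _).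
  by rewrite (tuple_eta k) tnthS; congr tnth; apply: val_inj.
under eq_fun do rewrite E.
rewrite (@cint_prod _ _ _ _ unif (haar d) (fun x => cis ((thead k)%:~R * x)) (echar k')); first last.
- by move=> x; rewrite nc_echar.
- by move=> x; rewrite nc_cis.
- exact: cmeas_echar.
- exact: measurable_cis.
rewrite cint_unif_cis IH -natrM mulnb; congr ((nat_of_bool _)%:R).
apply/andP/forallP => [[k0 /forallP kk] i|kk].
  rewrite (tuple_eta k); case: (unliftP ord0 i) => [j ->|->]; last by rewrite tnth0.
  by rewrite tnthS; exact: kk.
split; first exact: kk.
apply/forallP => i; have := kk (lift ord0 i); rewrite {1}(tuple_eta k) tnthS.
by rewrite (_ : behead_tuple k = k')//; exact: val_inj.
Qed.

Lemma echar_mulJ d (k l : freq d) (x : tpoint d) :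
  echar k x * (echar l x)^* = echar [tuple tnth k i - tnth l i | i < d] x :> R[i].
Proof.
rewrite !echarE cisJ -cisD -sumrN -big_split/=; congr cis.
by apply: eq_bigr => i _; rewrite tnth_mktuple rmorphB/= mulrBl.
Qed.

Lemma cint_echar_mulJ d (k l : freq d) :
  cint (haar d) (fun x => echar k x * (echar l x)^*) = (k == l)%:R :> R[i].
Proof.
under eq_fun do rewrite echar_mulJ.
rewrite cint_echar; congr ((nat_of_bool _)%:R); apply/forallP/eqP => [H|->].
  by apply: eq_from_tnth => i; have := H i; rewrite tnth_mktuple subr_eq0 => /eqP.
by move=> i; rewrite tnth_mktuple subrr.
Qed.

End torus_measure.

Lemma prob_ae_filter dd (T : measurableType dd) (R : realType) (P : probability T R) :
  Filter (nbhs (almost_everywhere P)).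
Proof. exact: _. Qed.

#[global] Instance haar_ae_filter (R : realType) d :
  Filter (nbhs (almost_everywhere (@haar R d))) := prob_ae_filter (haar d).

(** * Uniqueness of Fourier coefficients on the torus *)

Section torus_uniqueness.
Context {R : realType} {d : nat}.
Implicit Types (k l : freq d) (x : @tpoint R d).

Notation unif := (uniform_prob (@pi2_gt0 R)).

Lemma haar_tnth_null n (N : set R) (i : 'I_n) : measurable N -> unif N = 0%E ->
  haar n [set x | N (tnth x i)] = 0%E.
Proof.
move=> mN N0; elim: n i => [[]//|n IH] i.
rewrite /= /distribution /pushforward.
have [j ->|->] := unliftP ord0 i.
  have -> : @cons_point R n @^-1` [set x | N (tnth x (lift ord0 j))] =
      setT `*` [set x | N (tnth x j)].
    have e (a : R) (b : @tpoint R n) : tnth (cons_point (a, b)) (lift ord0 j) = tnth b j.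
      by rewrite tnthS; congr tnth; exact: val_inj.
    by apply/seteqP; split => -[a b] /=; rewrite e; [split|case].
  rewrite product_measure1E//; first by rewrite [X in (_ * X)%E]IH mule0.
  rewrite -[X in measurable X]setTI; exact: (measurable_tnth j measurableT mN).
have -> : @cons_point R n @^-1` [set x | N (tnth x ord0)] = N `*` setT.
  by apply/seteqP; split => -[a b] /=; rewrite tnth0; [split|case].
by rewrite product_measure1E// [X in (X * _)%E]N0 mul0e.
Qed.

Lemma haar_tnth_ae (N : set R) (i : 'I_d) : measurable N -> unif N = 0%E ->
  \forall x \ae haar d, ~ N (tnth x i).
Proof.
move=> mN N0; exists [set x | N (tnth x i)]; split.
- rewrite -[X in measurable X]setTI; exact: (measurable_tnth i measurableT mN).
- exact: haar_tnth_null.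
- by move=> x /= /contrapT.
Qed.

Lemma haar_tnth_neq (i : 'I_d) (a : R) :
  \forall x \ae haar d, (tnth x i : R) != a.
Proof.
have := @haar_tnth_ae [set a] i (measurable_set1 a).
have -> : unif [set a] = 0%E.
  have /null_content_dominatesP := dominates_uniform_prob (@pi2_gt0 R).
  by apply => //; exact: lebesgue_measure_set1.
by move=> /(_ erefl); apply: filterS => x /= xa; apply/eqP.
Qed.

Lemma haar_tnth_itv (i : 'I_d) :
  \forall x \ae haar d, 0 <= (tnth x i : R) <= pi *+ 2.
Proof.
have := @haar_tnth_ae (~` `[0, pi *+ 2]%classic) i (measurableC (measurable_itv _)).
have -> : unif (~` `[0, pi *+ 2]%classic) = 0%E.
  by rewrite /uniform_prob integral_uniform_pdf setICl integral_set0.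
move=> /(_ erefl); apply: filterS => x /= /contrapT.
by rewrite in_itv/=.
Qed.

Definition trig (f : @tpoint R d -> R) := exists s : seq (R[i] * freq d),
  forall x, (f x)%:C = \sum_(c <- s) c.1 * echar c.2 x.

Definition freq0 : freq d := [tuple 0 | i < d].

Lemma echar0 x : echar freq0 x = 1 :> R[i].
Proof.
rewrite echarE big1 ?cis0// => i _; by rewrite tnth_mktuple mul0r.
Qed.

Lemma echar_mul k l x : echar k x * echar l x =
  echar [tuple tnth k i + tnth l i | i < d] x :> R[i].
Proof.
rewrite !echarE -cisD -big_split/=; congr cis.
by apply: eq_bigr => i _; rewrite tnth_mktuple rmorphD/= mulrDl.
Qed.

Lemma echarJ k x : (echar k x)^* = echar [tuple - tnth k i | i < d] x :> R[i].
Proof.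
rewrite !echarE cisJ -sumrN; congr cis.
by apply: eq_bigr => i _; rewrite tnth_mktuple rmorphN/= mulNr.
Qed.

Lemma echarJN k x : echar k x = (echar [tuple - tnth k i | i < d] x)^* :> R[i].
Proof.
rewrite echarJ.
have -> : [tuple - tnth [tuple - tnth k j | j < d] i | i < d] = k.
  by apply: eq_from_tnth => i; rewrite !tnth_mktuple opprK.
by [].
Qed.

Lemma trig1 : trig (fun=> 1).
Proof. by exists [:: (1, freq0)] => x; rewrite big_seq1 echar0 mulr1. Qed.

Lemma trigM f g : trig f -> trig g -> trig (fun x => f x * g x).
Proof.
move=> [s hs] [t ht].
exists [seq (c.1 * e.1, [tuple tnth c.2 i + tnth e.2 i | i < d]) | c <- s, e <- t] => x.
rewrite rmorphM/= hs ht big_allpairs_dep mulr_suml; apply: eq_bigr => c _.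
rewrite mulr_sumr; apply: eq_bigr => e _ /=.
by rewrite -echar_mul; ring.
Qed.

Lemma trigC f : trig f -> trig (fun x => 1 - f x).
Proof.
move=> [s hs]; exists ((1, freq0) :: [seq (- c.1, c.2) | c <- s]) => x.
rewrite big_cons big_map/= echar0 mulr1 rmorphB/= hs -sumrN; congr (_ + _).
by apply: eq_bigr => c _; rewrite mulNr.
Qed.

Lemma trig_meas f : trig f -> measurable_fun setT f.
Proof.
move=> [s hs]; have -> : f = fun x => complex.Re (\sum_(c <- s) c.1 * echar c.2 x).
  by apply: funext => x; rewrite -hs.
have [] // := @cmeas_sum _ (@tpoint R d) R _ s (fun c x => c.1 * echar c.2 x) _.
by move=> c; apply: cmeasM; [exact: cmeas_cst|exact: cmeas_echar].
Qed.

(** A trigonometric polynomial with values in [0, 1] whose superlevel sets in the i-th coordinate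
    are arcs centred at b. *)
Lemma trig_bump (i : 'I_d) (b : R) : trig (fun x => (1 + cos ((tnth x i : R) - b)) / 2).
Proof.
pose e : freq d := [tuple (j == i)%:Z | j < d].
exists [:: (2^-1, freq0); (cis (- b) / 4, e); (cis b / 4, [tuple - tnth e j | j < d])] => x.
have ee : echar e x = cis (tnth x i : R) :> R[i].
  rewrite echarE (bigD1 i)//= tnth_mktuple eqxx mul1r big1 ?addr0// => j ji.
  by rewrite tnth_mktuple (negPf ji) mul0r.
rewrite !big_cons big_nil addr0/= echar0 -echarJ ee cisJ.
have -> : cis (- b) / 4 * cis (tnth x i : R) + cis b / 4 * cis (- (tnth x i : R))
    = (cis ((tnth x i : R) - b) + cis (- ((tnth x i : R) - b))) / 4.
  by rewrite opprB !cisD; ring.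
rewrite -cisJ addcJ /= rmorphM rmorphD /= fmorphV/= rmorph_nat rmorph1.
by field.
Qed.

(** On the circle, (0, a) is the arc of points at distance less than a / 2 from a / 2, that is, a
    superlevel set of the cosine centred at a / 2. *)
Lemma cos_arc (a y : R) : 0 < a < pi *+ 2 -> 0 < y < pi *+ 2 -> y != a ->
  (cos (y - a / 2) != cos (a / 2)) /\ (y < a <-> cos (a / 2) < cos (y - a / 2)).
Proof.
move=> /andP[a0 a2] /andP[y0 y2] ya.
have p0 : 0 < pi :> R := @pi_gt0 R.
have ain : a / 2 \in `[0, pi] by rewrite in_itv/=; apply/andP; split; lra.
have [ya'|ay] := ltP y a.
  suff h : cos (a / 2) < cos (y - a / 2) by rewrite h gt_eqF.
  have [yb|yb] := leP 0 (y - a / 2).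
    by rewrite ltr_cos// ?in_itv/=; [lra|apply/andP; split; lra].
  rewrite -(cosN (y - a / 2)) ltr_cos// ?in_itv/=; last by apply/andP; split; lra.
  by lra.
have {}ay : a < y by rewrite lt_neqAle eq_sym ya.
suff h : cos (y - a / 2) < cos (a / 2).
  by rewrite lt_eqF//; split=> //; split=> //; rewrite ltNge (ltW h).
have [yb|yb] := leP (y - a / 2) pi.
  by rewrite ltr_cos// ?in_itv/=; [lra|apply/andP; split; lra].
(* Past the antipode the distance to a / 2 is 2 pi - (y - a / 2), which still exceeds a / 2 because
   y < 2 pi. *)
rewrite -(cosN (y - a / 2)) -(cosD2pi (- (y - a / 2))).
by rewrite ltr_cos// ?in_itv/=; [lra|apply/andP; split; lra].
Qed.

Let approx := approximable (haar d) trig.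

Lemma approximable_ray (i : 'I_d) (a : R) :
  approx [set x | (tnth x i : R) < a].
Proof.
have mA : measurable [set x : @tpoint R d | (tnth x i : R) < a].
  have mr : measurable (`]-oo, a[%classic : set (measurableTypeR R)) by exact: measurable_itv.
  have := measurable_tnth i measurableT mr; rewrite setTI.
  rewrite (_ : _ @^-1` _ = [set x : @tpoint R d | (tnth x i : R) < a])//.
have aT : approx setT := approximableT _ trig1.
(* For a outside (0, 2 pi) the ray is null or of full measure, since [haar] is carried by the
   cell. *)
have [a0|a0] := leP a 0.
  apply: (approximable_ae mA (approximableC trigC aT)).
  apply: filterS (haar_tnth_itv i) => x /andP[x0 _] /=; split=> [xa|/(_ I)//].
  by have := lt_le_trans xa a0; rewrite ltNge x0.
have [a2|a2] := leP (pi *+ 2) a.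
  apply: (approximable_ae mA aT).
  apply: filterS2 (haar_tnth_itv i) (haar_tnth_neq i (pi *+ 2)) => x /andP[_ x2] xn /=.
  by split=> // _; apply: lt_le_trans a2; rewrite lt_neqAle xn.
have p0 : 0 < pi :> R := @pi_gt0 R.
apply: (@approximable_level _ _ R (haar d) trig trig1 trigM trigC _
  (fun x => (1 + cos ((tnth x i : R) - a / 2)) / 2) ((1 + cos (a / 2)) / 2)) => //.
- exact: trig_bump.
- move=> x; have := cos_geN1 ((tnth x i : R) - a / 2); have := cos_le1 ((tnth x i : R) - a / 2).
  by move=> h1 h2; apply/andP; split; lra.
- have : cos pi < cos (a / 2) :> R.
    by rewrite ltr_cos ?in_itv/=; [lra|apply/andP; split; lra|apply/andP; split; lra].
  by rewrite cospi; lra.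
- have : cos (a / 2) < cos 0 :> R.
    by rewrite ltr_cos ?in_itv/=; [lra|apply/andP; split; lra|apply/andP; split; lra].
  by rewrite cos0; lra.
apply: filterS2 (filterI (haar_tnth_itv i) (haar_tnth_neq i a))
  (filterI (haar_tnth_neq i 0) (haar_tnth_neq i (pi *+ 2))) => x /= [/andP[x0 x2] xa] [xn0 xn2].
have ha : 0 < a < pi *+ 2 by rewrite a0.
have hy : 0 < (tnth x i : R) < pi *+ 2.
  by rewrite !lt_neqAle x0 x2 eq_sym xn0 xn2.
have [h1 h2] := cos_arc ha hy xa.
split; last by rewrite h2; split; lra.
by apply: contra_neq h1; lra.
Qed.

(** The coordinate rays are approximable and already generate the product sigma-algebra. *)
Lemma measurable_approximable : @measurable _ (@tpoint R d) = <<s approx >>.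
Proof.
apply/seteqP; split=> A; last first.
  apply: smallest_sub; first exact: sigma_algebra_measurable.
  by move=> B [].
move=> mA.
have : measurable_fun setT (id : g_sigma_algebraType approx -> @tpoint R d).
  apply/measurable_fun_tnthP => i.
  apply: (measurability _ (RGenInftyO.measurableE R)) => _ [_ [a ->] <-].
  apply: sub_sigma_algebra; rewrite setTI.
  have -> : (fun x : @tpoint R d => tnth x i) @^-1` `]-oo, a[%classic =
      [set x : @tpoint R d | (tnth x i : R) < a].
    by apply/seteqP; split => x /=; rewrite in_itv.
  exact: approximable_ray.
by move=> /(_ measurableT _ mA); rewrite setTI.
Qed.

(** The integral of w against a trigonometric polynomial is a finite combination of Fourier
    coefficients of w, so [ae_eq0_approximable] applies to its real and imaginary parts. *)
Lemma fourier_unique (w : @torus_fun R d) : cintegrable (haar d) w ->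
  (forall k, fourier w k = 0) -> \forall x \ae haar d, w x = 0.
Proof.
move=> wi w0.
have key q : trig q -> (forall x, 0 <= q x <= 1) ->
    cint (haar d) (fun x => w x * (q x)%:C) = 0.
  move=> [s hs] _.
  have -> : (fun x => w x * (q x)%:C) =
      fun x => \sum_(c <- s) c.1 * (w x * echar c.2 x).
    by apply: funext => x; rewrite hs mulr_sumr; apply: eq_bigr => c _; ring.
  have ie k : cintegrable (haar d) (fun x => w x * echar k x).
    by apply: (cintegrableM (M := 1)) => //; [exact: cmeas_echar|move=> x; rewrite nc_echar].
  rewrite cint_sum; last by move=> c; exact: cintegrableZ.
  rewrite big1// => c _; rewrite cintZ//.
  have -> : (fun x => w x * echar c.2 x) =
      (fun x => w x * (echar [tuple - tnth c.2 i | i < d] x)^*).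
    by apply: funext => x; rewrite -echarJN.
  by rewrite [X in _ * X](w0 [tuple - tnth c.2 i | i < d]) mulr0.
have cq q : trig q -> (forall x, 0 <= q x <= 1) -> cintegrable (haar d) (fun x => w x * (q x)%:C).
  move=> tq qb; apply: (cintegrableM (M := 1)) => //.
    by split; [exact: trig_meas|exact: measurable_cst].
  by move=> x; rewrite nc_real; have /andP[q0 q1] := qb x; rewrite ger0_norm.
have [w1 w2] := wi.
have qRe q : trig q -> (forall x, 0 <= q x <= 1) ->
    (\int[haar d]_x (complex.Re (w x) * q x)%:E = 0)%E.
  move=> tq qb; have [i1 _] := cq q tq qb; have := congr1 (@complex.Re R) (key q tq qb).
  rewrite /cint/= /Rintegral.
  under eq_integral do rewrite cReM/= mulr0 subr0.
  move=> e; rewrite -[LHS]fineK ?e//; apply: integrable_fin_num => //.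
  move: i1; rewrite (_ : _ \o _ = fun x => (complex.Re (w x) * q x)%:E)//.
  by apply: funext => x /=; rewrite cReM/= mulr0 subr0.
have h1 := @ae_eq0_approximable _ _ R (haar d) trig trig1 trigM trig_meas
  (fun x => complex.Re (w x)) w1 qRe measurable_approximable.
have qIm q : trig q -> (forall x, 0 <= q x <= 1) ->
    (\int[haar d]_x (complex.Im (w x) * q x)%:E = 0)%E.
  move=> tq qb; have [_ i1] := cq q tq qb; have := congr1 (@complex.Im R) (key q tq qb).
  rewrite /cint/= /Rintegral.
  under eq_integral do rewrite cImM/= mulr0 add0r.
  move=> e; rewrite -[LHS]fineK ?e//; apply: integrable_fin_num => //.
  move: i1; rewrite (_ : _ \o _ = fun x => (complex.Im (w x) * q x)%:E)//.
  by apply: funext => x /=; rewrite cImM/= mulr0 add0r.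
have h2 := @ae_eq0_approximable _ _ R (haar d) trig trig1 trigM trig_meas
  (fun x => complex.Im (w x)) w2 qIm measurable_approximable.
by apply: filterS2 h1 h2 => x a b; apply/eqP; rewrite eq_complex a b eqxx.
Qed.

End torus_uniqueness.

(** * Fourier synthesis *)

Section cauchy.
Context {R : realType}.

Lemma cvgn_tail (u eps : nat -> R) : eps @ \oo --> 0 ->
  (forall N M, (N <= M)%N -> `|u M - u N| <= eps N) ->
  u @ \oo --> limn u /\ forall N, `|limn u - u N| <= eps N.
Proof.
move=> e0 ue.
have cu : cvgn u.
  apply/cauchy_cvgP/cauchy_exP => e egt0.
  have [N _ HN] : \forall N \near \oo, eps N < e by exact: (cvgr_lt _ e0).
  exists (u N); exists N => // M /= NM.
  by rewrite -ball_normE /ball_/= distrC (le_lt_trans (ue _ _ NM))// HN/=.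
split=> // N.
have cv : `|u M - u N| @[M --> \oo] --> `|limn u - u N|.
  by apply: cvg_norm; apply: cvgB => //; exact: cvg_cst.
apply: (cvgr_to_le cv); exists N => // M /= NM; exact: ue.
Qed.

End cauchy.

Lemma cintJ dd (T : measurableType dd) (R : realType) (P : probability T R) (f : T -> R[i]) :
  cintegrable P f -> cint P (fun x => (f x)^*) = (cint P f)^*.
Proof.
move=> [f1 f2]; rewrite /cint; under eq_Rintegral do rewrite cReJ.
under [X in _ +i* X]eq_Rintegral do rewrite cImJ -mulN1r.
by rewrite RintegralZl// mulN1r.
Qed.

Section synthesis.
Context {R : realType} {d : nat}.
Implicit Types (k l : freq d) (x : @tpoint R d) (u v w : @torus_fun R d).

(** Partial sums over cubes, as in [fDelta], so that every multiplier is a [synthesis]. *)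
Definition syn (a : freq d -> R[i]) N x : R[i] := \sum_(k <- cube N) a k * echar k x.

Definition synthesis (a : freq d -> R[i]) x : R[i] := climn (fun N => syn a N x).

Lemma fourierE u k : fourier u k = cint (haar d) (fun x => u x * (echar k x)^*).
Proof. by []. Qed.

Lemma sum_cubeB (V : zmodType) (F : freq d -> V) N M : (N <= M)%N ->
  \sum_(k <- cube M) F k - \sum_(k <- cube N) F k =
  \sum_(k <- cube M | k \notin cube N) F k.
Proof.
move=> NM; rewrite [X in X - _](bigID (mem (cube N)))/=.
suff -> : \sum_(k <- cube M | k \in cube N) F k = \sum_(k <- cube N) F k.
  by rewrite addrAC subrr add0r.
rewrite -big_filter; apply: perm_big; apply: uniq_perm.
- by rewrite filter_uniq// cube_uniq.
- exact: cube_uniq.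
- move=> k; rewrite mem_filter; case: (boolP (k \in cube N)) => //=.
  exact: sub_cube NM _.
Qed.

Section l1.
Variables (a : freq d -> R[i]) (L : R) (aL : l1_le L (fun k => nc (a k))).

Definition l1_tail N : R := limn (fun M => \sum_(k <- cube M) nc (a k)) -
  \sum_(k <- cube N) nc (a k).

Lemma l1_partial_cvg : (fun M => \sum_(k <- cube M) nc (a k)) @ \oo -->
  limn (fun M => \sum_(k <- cube M) nc (a k)).
Proof.
have nd : nondecreasing_seq (fun M => \sum_(k <- cube M : seq (freq d)) nc (a k)).
  move=> N M NM; apply: ler_sum_uniq; [exact: cube_uniq|exact: sub_cube|].
  by move=> k; exact: nc_ge0.
apply: nondecreasing_is_cvgn => //; exists L => _ [M _ <-].
have [_ /(_ _ (cube_uniq M))] := aL; apply: le_trans; apply: ler_sum => k _.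
exact: ler_norm.
Qed.

Lemma l1_tail_cvg : l1_tail @ \oo --> 0.
Proof.
rewrite -(subrr (limn (fun M => \sum_(k <- cube M : seq (freq d)) nc (a k)))).
by apply: cvgB; [exact: cvg_cst|exact: l1_partial_cvg].
Qed.

Lemma l1_tail_ge N M : (N <= M)%N ->
  \sum_(k <- cube M | k \notin cube N) nc (a k) <= l1_tail N.
Proof.
move=> NM; rewrite -sum_cubeB// lerD2r.
apply: nondecreasing_cvgn_le; last exact: l1_partial_cvg.
move=> N' M' NM'; apply: ler_sum_uniq; [exact: cube_uniq|exact: sub_cube|].
by move=> k; exact: nc_ge0.
Qed.

Lemma l1_tail_ge0 N : 0 <= l1_tail N.
Proof.
by apply: le_trans (l1_tail_ge (leqnn N)); apply: sumr_ge0 => k _; exact: nc_ge0.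
Qed.

Lemma synB_le N M x : (N <= M)%N -> nc (syn a M x - syn a N x) <= l1_tail N.
Proof.
move=> NM; rewrite /syn sum_cubeB//; apply: le_trans (l1_tail_ge NM).
apply: le_trans (nc_sum _ _ _) _; apply: ler_sum => k _.
by rewrite ncM nc_echar mulr1.
Qed.

Lemma synthesis_cvg x :
  [/\ complex.Re (syn a N x) @[N --> \oo] --> complex.Re (synthesis a x),
      complex.Im (syn a N x) @[N --> \oo] --> complex.Im (synthesis a x) &
      forall N, nc (synthesis a x - syn a N x) <= 2 * l1_tail N].
Proof.
have [r1 r2] := cvgn_tail l1_tail_cvg (u := fun N => complex.Re (syn a N x))
  (fun N M NM => le_trans (eq_ind _ (fun z => `|z| <= _) (nc_Re _) _ (cReB _ _)) (synB_le x NM)).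
have [i1 i2] := cvgn_tail l1_tail_cvg (u := fun N => complex.Im (syn a N x))
  (fun N M NM => le_trans (eq_ind _ (fun z => `|z| <= _) (nc_Im _) _ (cImB _ _)) (synB_le x NM)).
split=> // N; apply: le_trans (nc_le_ReIm _) _.
by rewrite cReB cImB mulr_natl mulr2n lerD.
Qed.

Lemma nc_syn N x : nc (syn a N x) <= L.
Proof.
have [_ /(_ _ (cube_uniq N)) h] := aL; apply: le_trans h.
apply: le_trans (nc_sum _ _ _) _; apply: ler_sum => k _.
by rewrite ncM nc_echar mulr1 ler_norm.
Qed.

Lemma cmeas_syn N : cmeas (syn a N).
Proof.
apply: (@cmeas_sum _ _ R) => k.
by apply: cmeasM; [exact: cmeas_cst|exact: cmeas_echar].
Qed.

Lemma cmeas_synthesis : cmeas (synthesis a).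
Proof.
split.
  apply: (@measurable_fun_cvg _ _ _ _ (fun N x => complex.Re (syn a N x))) => [N|x _].
    by have [] := cmeas_syn N.
  by have [] := synthesis_cvg x.
apply: (@measurable_fun_cvg _ _ _ _ (fun N x => complex.Im (syn a N x))) => [N|x _].
  by have [] := cmeas_syn N.
by have [] := synthesis_cvg x.
Qed.

Lemma nc_synthesis x : nc (synthesis a x) <= L + 2 * l1_tail 0.
Proof.
have [_ _ /(_ 0%N) h] := synthesis_cvg x.
rewrite -[synthesis a x](subrK (syn a 0 x)) addrC.
by apply: le_trans (ncD _ _) _; rewrite lerD// nc_syn.
Qed.

Lemma fourier_syn N k : k \in cube N -> fourier (syn a N) k = a k.
Proof.
move=> kN; rewrite fourierE.
have -> : (fun x => syn a N x * (echar k x)^*) =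
    fun x => \sum_(l <- cube N) a l * (echar l x * (echar k x)^*).
  by apply: funext => x; rewrite mulr_suml; apply: eq_bigr => l _; rewrite mulrA.
have ie l : cintegrable (haar d) (fun x => echar l x * (echar k x)^*).
  apply: (@cintegrable_bounded _ _ _ _ _ 1).
    by apply: cmeasM; [|apply: cmeasJ]; exact: cmeas_echar.
  by apply: aeW => x; rewrite ncM ncJ !nc_echar mulr1.
rewrite cint_sum; last by move=> l; exact: cintegrableZ.
rewrite (bigD1_seq k) ?cube_uniq//= big1 => [|l lk].
  by rewrite cintZ// cint_echar_mulJ eqxx mulr1 addr0.
by rewrite cintZ// cint_echar_mulJ (negPf lk) mulr0.
Qed.

End l1.

Lemma periodicT_echar k (x y : @tpoint R d) (i : 'I_d) :
  tnth y i = tnth x i + pi *+ 2 :> R ->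
  (forall j, j != i -> tnth y j = tnth x j) -> echar k y = echar k x :> R[i].
Proof.
move=> yi yj; rewrite !echarE (bigD1 i)//= [in RHS](bigD1 i)//= yi mulrDr.
rewrite (eq_bigr (fun j => (tnth k j)%:~R * (tnth x j : R))) => [|j ji]; last by rewrite yj.
by rewrite addrAC cisD2pi.
Qed.

Lemma periodicT_synthesis a : periodicT (synthesis a).
Proof.
move=> x y i yi yj; rewrite /synthesis; congr climn; apply: funext => N.
by apply: eq_bigr => k _; rewrite (periodicT_echar k yi yj).
Qed.

Lemma L2_cintegrable u : L2 u -> cintegrable (haar d) u.
Proof.
have fin : haar d [set: @tpoint R d] \is a fin_num by exact: fin_num_measure.
by move=> [_ h1 h2]; split; apply/Lfun1_integrable; apply: (Lfun_subset12 fin).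
Qed.

Lemma Lfun2_bounded (f : @tpoint R d -> R) M : measurable_fun setT f ->
  (\forall x \ae haar d, `|f x| <= M) -> f \in Lfun (haar d) 2%:E.
Proof.
move=> mf fM; rewrite inE; apply/andP; split; rewrite inE//= /finite_norm unlock /Lnorm.
apply: poweR_lty; apply: (@le_lt_trans _ _ (\int[haar d]_x (M ^+ 2)%:E)%E); last first.
  by rewrite integral_cst// [X in (_ * X)%E]probability_setT mule1 ltry.
apply: ae_ge0_le_integral => //.
- by move=> x _; rewrite lee_fin powR_ge0.
- apply/measurable_EFinP.
  apply: (@measurableT_comp _ _ _ _ _ _ (fun y : R => y `^ 2)) => //.
  exact: measurableT_comp.
- by move=> x _; rewrite lee_fin sqr_ge0.
- apply: filterS fM => x xM _; rewrite lee_fin powR_mulrn//.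
  by rewrite lerXn2r ?nnegrE// (le_trans _ xM).
Qed.

Lemma L2_bounded u M : periodicT u -> cmeas u ->
  (\forall x \ae haar d, nc (u x) <= M) -> L2 u.
Proof.
move=> pu [m1 m2] uM; split=> //.
  by apply: (@Lfun2_bounded _ M) => //; apply: filterS uM => x; apply: le_trans; exact: nc_Re.
by apply: (@Lfun2_bounded _ M) => //; apply: filterS uM => x; apply: le_trans; exact: nc_Im.
Qed.

Lemma L2_synthesis a L : l1_le L (fun k => nc (a k)) -> L2 (synthesis a).
Proof.
move=> aL; apply: L2_bounded (periodicT_synthesis a) (cmeas_synthesis aL) _.
by apply: aeW => x; exact: nc_synthesis aL x.
Qed.

Lemma cintegrable_echarJ u k : cintegrable (haar d) u ->
  cintegrable (haar d) (fun x => u x * (echar k x)^*).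
Proof.
move=> ui; apply: (cintegrableM (M := 1)) => //.
  by apply: cmeasJ; exact: cmeas_echar.
by move=> x; rewrite ncJ nc_echar.
Qed.

Lemma fourierB u v k : cintegrable (haar d) u -> cintegrable (haar d) v ->
  fourier (fun x => u x - v x) k = fourier u k - fourier v k.
Proof.
move=> ui vi; rewrite !fourierE -cintB; try exact: cintegrable_echarJ.
by apply: eq_cint => x; rewrite mulrBl.
Qed.

Lemma fourierZ u c k : cintegrable (haar d) u ->
  fourier (fun x => c * u x) k = c * fourier u k.
Proof.
move=> ui; rewrite !fourierE -cintZ; last exact: cintegrable_echarJ.
by apply: eq_cint => x; rewrite mulrA.
Qed.

Lemma fourierJ u k : cintegrable (haar d) u -> fourier (fun x => (u x)^*) k =
  (fourier u [tuple - tnth k i | i < d])^* :> R[i].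
Proof.
move=> ui; rewrite !fourierE -cintJ; last exact: cintegrable_echarJ.
by apply: eq_cint => x; rewrite -[(echar [tuple - tnth k i | i < d] x)^*]echarJN [RHS]rmorphM.
Qed.

Lemma nc_fourierB_le u v k e : 0 <= e -> cintegrable (haar d) u -> cintegrable (haar d) v ->
  (\forall x \ae haar d, nc (u x - v x) <= e) ->
  nc (fourier u k - fourier v k) <= 2 * e.
Proof.
move=> e0 ui vi uve; rewrite -fourierB// fourierE.
apply: nc_cint_le => //.
  apply: cmeasM; last by apply: cmeasJ; exact: cmeas_echar.
  by apply: (@cintegrable_meas _ _ _ (haar d)); exact: cintegrableB.
by apply: filterS uve => x; rewrite ncM ncJ nc_echar mulr1.
Qed.

Lemma cintegrable_syn a N : cintegrable (haar d) (syn a N).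
Proof.
apply: (@cintegrable_bounded _ _ _ _ _ (\sum_(k <- cube N) nc (a k))); first exact: cmeas_syn.
apply: aeW => x; apply: le_trans (nc_sum _ _ _) _; apply: ler_sum => k _.
by rewrite ncM nc_echar mulr1.
Qed.

(** Partial sums over large cubes have the coefficient a k exactly, and they converge uniformly. *)
Lemma fourier_synthesis a L k : l1_le L (fun k => nc (a k)) ->
  fourier (synthesis a) k = a k.
Proof.
move=> aL; have [N0 kN] := seq_sub_cube [:: k].
apply/eqP; rewrite -subr_eq0; apply/eqP/ComplexField.Normc.eq0_normc/eqP.
rewrite eq_le nc_ge0 andbT.
have cv : 2 * (2 * l1_tail a N) @[N --> \oo] --> (0 : R).
  rewrite -(mulr0 2) -[X in 2 * X](mulr0 2).
  by do 2!(apply: cvgM; first exact: cvg_cst); exact: l1_tail_cvg aL.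
apply: (cvgr_to_ge cv); exists N0 => // N /= NN.
rewrite -(fourier_syn a (sub_cube NN (kN k _))) ?mem_head//.
apply: nc_fourierB_le.
- by rewrite mulr_ge0// (l1_tail_ge0 aL).
- exact/L2_cintegrable/L2_synthesis/aL.
- exact: cintegrable_syn.
- by apply: aeW => x; have [_ _] := synthesis_cvg aL x.
Qed.

(** The difference is integrable with zero Fourier coefficients. This is where uniqueness enters: it
    gives a bounded representative of u and uniform approximation by partial sums. *)
Lemma ae_synthesis u L : L2 u -> l1_le L (fun k => nc (fourier u k)) ->
  \forall x \ae haar d, u x = synthesis (fourier u) x.
Proof.
move=> u2 uL; have ui := L2_cintegrable u2.
have si := L2_cintegrable (L2_synthesis uL).
have h k : fourier (fun x => u x - synthesis (fourier u) x) k = 0.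
  by rewrite fourierB// (fourier_synthesis _ uL) subrr.
by apply: filterS (fourier_unique (cintegrableB ui si) h) => x /eqP; rewrite subr_eq0 => /eqP.
Qed.

Lemma fDelta_synthesis (f : R -> R[i]) v :
  fDelta f v = synthesis (fun k => f (- normsq k) * fourier v k).
Proof.
apply: funext => x; rewrite /fDelta /synthesis; congr climn; apply: funext => N.
by rewrite /syn /cube big_map big_enum.
Qed.

End synthesis.

(** * Fourier coefficients of cubic expressions *)

Section cubic.
Context {R : realType} {d : nat}.
Implicit Types (k l : freq d) (x : @tpoint R d) (u v w : @torus_fun R d).
Implicit Types (a b c : freq d -> R[i]).

Definition cubic u v w : @torus_fun R d := fun x => u x * v x * (w x)^*.

Definition ctri N a b c := tri (cube N) (fun k1 k2 k3 => a k1 * b k2 * (c k3)^*).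

Lemma conjM (z t : R[i]) : (z * t)^* = z^* * t^*.
Proof. exact: rmorphM. Qed.

Lemma conj_sum (I : Type) (s : seq I) (F : I -> R[i]) :
  (\sum_(i <- s) F i)^* = \sum_(i <- s) (F i)^*.
Proof.
elim: s => [|i s IH]; first by rewrite !big_nil; exact: rmorph0.
by rewrite !big_cons -IH rmorphD.
Qed.

Lemma echar_reso k1 k2 k3 x :
  echar k1 x * echar k2 x * (echar k3 x)^* = echar (reso k1 k2 k3) x :> R[i].
Proof.
rewrite !echarE cisJ -!cisD; congr cis; rewrite -sumrN -!big_split/=.
by apply: eq_bigr => i _; rewrite tnth_mktuple rmorphB rmorphD/=; ring.
Qed.

Lemma fourier_cubic_syn a b c N k :
  fourier (cubic (syn a N) (syn b N) (syn c N)) k = ctri N a b c k.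
Proof.
pose E k1 k2 k3 x : R[i] :=
  a k1 * b k2 * (c k3)^* * (echar (reso k1 k2 k3) x * (echar k x)^*).
have ie k1 k2 k3 : cintegrable (haar d) (E k1 k2 k3).
  apply: cintegrableZ; apply: cintegrable_echarJ.
  apply: (@cintegrable_bounded _ _ _ _ _ 1); first exact: cmeas_echar.
  by apply: aeW => x; rewrite nc_echar.
rewrite fourierE (_ : (fun x => _) = (fun x => \sum_(k1 <- cube N)
    \sum_(k2 <- cube N) \sum_(k3 <- cube N) E k1 k2 k3 x)); last first.
  apply: funext => x; rewrite /cubic /syn.
  rewrite conj_sum.
  rewrite -!mulrA mulr_suml; apply: eq_bigr => k1 _.
  rewrite mulr_suml mulr_sumr; apply: eq_bigr => k2 _.
  rewrite mulr_suml !mulr_sumr; apply: eq_bigr => k3 _.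
  rewrite /E -echar_reso (conjM (c k3) (echar k3 x)).
  move: (echar k1 x) (echar k2 x) (echar k3 x) (echar k x) => e1 e2 e3 e4; ring.
rewrite cint_sum; last by move=> k1; do 2!(apply: cintegrable_sum => ?); exact: ie.
apply: eq_bigr => k1 _.
rewrite cint_sum; last by move=> k2; apply: cintegrable_sum => ?; exact: ie.
apply: eq_bigr => k2 _; rewrite cint_sum; last by move=> k3; exact: ie.
rewrite [RHS]big_mkcond; apply: eq_bigr => k3 _.
rewrite /E cintZ; last first.
  apply: cintegrable_echarJ; apply: (@cintegrable_bounded _ _ _ _ _ 1); first exact: cmeas_echar.
  by apply: aeW => x; rewrite nc_echar.
by rewrite cint_echar_mulJ; case: (_ == _); rewrite ?mulr1 ?mulr0.
Qed.

Lemma nc_mul3B (p q r p' q' r' : R[i]) (B e1 e2 e3 : R) :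
  nc q <= B -> nc r <= B -> nc p' <= B -> nc q' <= B ->
  nc (p - p') <= e1 -> nc (q - q') <= e2 -> nc (r - r') <= e3 ->
  nc (p * q * r^* - p' * q' * r'^*) <= B ^+ 2 * (e1 + e2 + e3).
Proof.
move=> qB rB p'B q'B pp qq rr.
have -> : p * q * r^* - p' * q' * r'^* =
    (p - p') * q * r^* + p' * (q - q') * r^* + p' * q' * (r - r')^*.
  by rewrite rmorphB/=; ring.
have -> : B ^+ 2 * (e1 + e2 + e3) = e1 * B * B + B * e2 * B + B * B * e3 by ring.
have mul3 (x y z X Y Z : R) : 0 <= x -> 0 <= y -> 0 <= z -> x <= X -> y <= Y -> z <= Z ->
    x * y * z <= X * Y * Z.
  by move=> x0 y0 z0 xX yY zZ; rewrite ler_pM ?mulr_ge0// ler_pM.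
apply: le_trans (ncD _ _) _; apply: lerD; last first.
  by rewrite !ncM ncJ mul3 ?nc_ge0.
apply: le_trans (ncD _ _) _; apply: lerD; by rewrite !ncM ncJ mul3 ?nc_ge0.
Qed.

(** [ctri N] gives exactly the coefficients of the product of partial sums, and almost everywhere
    this product approaches the true one uniformly. *)
Lemma cubic_fourier u v w L : L2 u -> L2 v -> L2 w ->
  l1_le L (fun k => nc (fourier u k)) -> l1_le L (fun k => nc (fourier v k)) ->
  l1_le L (fun k => nc (fourier w k)) ->
  L2 (cubic u v w) /\ forall k,
    nc (fourier (cubic u v w) k -
        ctri N (fourier u) (fourier v) (fourier w) k) @[N --> \oo] --> 0.
Proof.
move=> u2 v2 w2 uL vL wL; have [L0 _] := uL.
have [[pu _ _] [pv _ _]] := (u2, v2); have [pw _ _] := w2.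
have mu := cintegrable_meas (L2_cintegrable u2).
have mv := cintegrable_meas (L2_cintegrable v2).
have mw := cintegrable_meas (L2_cintegrable w2).
have [tu tv tw] := And3 (l1_tail_ge0 uL) (l1_tail_ge0 vL) (l1_tail_ge0 wL).
pose tl N := l1_tail (fourier u) N + l1_tail (fourier v) N + l1_tail (fourier w) N.
(* A common bound for the three functions, almost everywhere, and for all their partial sums. *)
pose B := L + 2 * tl 0%N.
have tl0 N : 0 <= tl N by apply: addr_ge0 => //; exact: addr_ge0.
have B0 : 0 <= B by rewrite addr_ge0// mulr_ge0.
have bd z : L2 z -> l1_le L (fun k => nc (fourier z k)) ->
    l1_tail (fourier z) 0 <= tl 0%N -> \forall x \ae haar d, nc (z x) <= B.
  move=> z2 zL zt; apply: filterS (ae_synthesis z2 zL) => x ->.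
  by apply: le_trans (nc_synthesis zL x) _; rewrite lerD2l ler_wpM2l.
have uB : \forall x \ae haar d, nc (u x) <= B.
  by apply: bd => //; move: (tu 0%N) (tv 0%N) (tw 0%N); rewrite /tl; lra.
have vB : \forall x \ae haar d, nc (v x) <= B.
  by apply: bd => //; move: (tu 0%N) (tv 0%N) (tw 0%N); rewrite /tl; lra.
have wB : \forall x \ae haar d, nc (w x) <= B by apply: bd => //; move: (tu 0%N) (tv 0%N) (tw 0%N); rewrite /tl; lra.
have c2 : L2 (cubic u v w).
  apply: (@L2_bounded _ _ _ (B * B * B)).
  - by move=> x y i yi yj; rewrite /cubic (pu _ _ _ yi yj) (pv _ _ _ yi yj) (pw _ _ _ yi yj).
  - by apply: cmeasM; [exact: cmeasM|exact: cmeasJ].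
  - apply: filterS3 uB vB wB => x h1 h2 h3; rewrite !ncM ncJ.
    by rewrite ler_pM ?mulr_ge0 ?nc_ge0// ler_pM ?nc_ge0.
split=> // k.
have sB z N x : l1_le L (fun k => nc (fourier z k)) -> nc (syn (fourier z) N x) <= B.
  by move=> zL; apply: le_trans (nc_syn zL N x) _; rewrite lerDl mulr_ge0.
have cv : 2 * (B ^+ 2 * (2 * tl N)) @[N --> \oo] --> (0 : R).
  have ct : tl N @[N --> \oo] --> (0 + 0 + 0 : R).
    apply: cvgD; last exact: l1_tail_cvg wL.
    by apply: cvgD; [exact: l1_tail_cvg uL|exact: l1_tail_cvg vL].
  rewrite !addr0 in ct; pose C := 2 * (B ^+ 2 * 2).
  have {}ct : C * tl N @[N --> \oo] --> C * 0 by apply: cvgM => //; exact: cvg_cst.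
  rewrite mulr0 in ct; apply: cvg_trans ct; apply: near_eq_cvg.
  by apply: nearW => N; rewrite /C; ring.
apply: (squeeze_cvgr _ (cvg_cst (0 : R)) cv); apply: nearW => N.
rewrite nc_ge0/= -fourier_cubic_syn; apply: nc_fourierB_le.
- by rewrite !mulr_ge0.
- exact: L2_cintegrable.
- apply: (@cintegrable_bounded _ _ _ _ _ (B * B * B)).
    by apply: cmeasM; [apply: cmeasM|apply: cmeasJ]; exact: cmeas_syn.
  apply: aeW => x; rewrite !ncM ncJ.
  by rewrite ler_pM ?mulr_ge0 ?nc_ge0 ?sB// ler_pM ?nc_ge0 ?sB.
have near_syn z : L2 z -> l1_le L (fun k => nc (fourier z k)) ->
    \forall x \ae haar d, nc (z x - syn (fourier z) N x) <= 2 * l1_tail (fourier z) N.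
  move=> z2 zL; apply: filterS (ae_synthesis z2 zL) => x ->.
  by have [_ _] := synthesis_cvg zL x.
apply: filterS2 (filterI vB wB) (filterI (near_syn _ u2 uL)
  (filterI (near_syn _ v2 vL) (near_syn _ w2 wL))) => x [xv xw] [h1 [h2 h3]].
have -> : 2 * tl N = 2 * l1_tail (fourier u) N + 2 * l1_tail (fourier v) N +
    2 * l1_tail (fourier w) N by rewrite /tl; ring.
by apply: nc_mul3B => //; exact: sB.
Qed.

End cubic.

(** * Differential calculus for complex-valued functions of time *)

Section cderiv.
Context {R : realType}.
Implicit Types (f g : R -> R[i]) (t a b th : R).

Lemma is_cderiv_cst (c : R[i]) t : is_cderiv (fun=> c) t 0.
Proof. by split; apply: is_derive_cst. Qed.

Lemma is_cderivD f g t v w : is_cderiv f t v -> is_cderiv g t w ->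
  is_cderiv (fun s => f s + g s) t (v + w).
Proof.
move=> [f1 f2] [g1 g2]; split; rewrite raddfD; under eq_fun do rewrite raddfD.
  exact: (is_deriveD f1 g1).
exact: (is_deriveD f2 g2).
Qed.

Lemma is_cderivM f g t v w : is_cderiv f t v -> is_cderiv g t w ->
  is_cderiv (fun s => f s * g s) t (v * g t + f t * w).
Proof.
move=> [f1 f2] [g1 g2]; split.
  under eq_fun do rewrite cReM.
  apply: is_derive_eq (is_deriveB (is_deriveM f1 g1) (is_deriveM f2 g2)) _.
  by rewrite cReD !cReM /GRing.scale/=; ring.
under eq_fun do rewrite cImM.
apply: is_derive_eq (is_deriveD (is_deriveM f1 g2) (is_deriveM f2 g1)) _.
by rewrite cImD !cImM /GRing.scale/=; ring.
Qed.

Lemma is_cderivZ f t v (c : R[i]) : is_cderiv f t v ->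
  is_cderiv (fun s => c * f s) t (c * v).
Proof.
by move=> /(is_cderivM (is_cderiv_cst c t)); rewrite mul0r add0r.
Qed.

Lemma is_cderiv_sum (I : Type) (K : seq I) (p : pred I) (F : I -> R -> R[i]) (v : I -> R[i]) t :
  (forall i, is_cderiv (F i) t (v i)) ->
  is_cderiv (fun s => \sum_(i <- K | p i) F i s) t (\sum_(i <- K | p i) v i).
Proof.
move=> hF; elim: K => [|i K IH].
  by rewrite big_nil; under eq_fun do rewrite big_nil; exact: is_cderiv_cst.
rewrite big_cons; under eq_fun do rewrite big_cons.
by case: (p i) => //; exact: is_cderivD.
Qed.

Lemma is_cderiv_cis a b t :
  is_cderiv (fun s => cis (a * s + b)) t ('i%C * a%:C * cis (a * t + b)).
Proof.
pose l s := a * s + b.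
have lin : is_derive t 1 l a.
  apply: is_derive_eq (is_deriveD (is_deriveZ a (is_derive_id t 1)) (is_derive_cst b t 1)) _.
  by rewrite addr0 /GRing.scale/= mulr1.
split.
  apply: (is_derive_eq (is_derive1_comp (is_derive_cos (l t)) lin)).
  by rewrite !cReM !cImM/= /GRing.scale/= /l; ring.
apply: (is_derive_eq (is_derive1_comp (is_derive_sin (l t)) lin)).
by rewrite !cImM !cReM/= /GRing.scale/= /l; ring.
Qed.

Lemma abs_sin_le (x : R) : `|sin x| <= `|x|.
Proof.
wlog x0 : x / 0 < x.
  move=> H; have [x0|x0|->] := ltgtP x 0; last by rewrite sin0.
    by rewrite -normrN -sinN -[leRHS]normrN; apply: H; rewrite oppr_gt0.
  exact: H.
have [c _] := @MVT R sin cos 0 x x0 (fun y _ => is_derive_sin y)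
  (continuous_subspaceT (@continuous_sin R)).
rewrite sin0 !subr0 => ->; rewrite normrM ler_piMl//.
by rewrite ler_norml cos_geN1 cos_le1.
Qed.

(** A chord is shorter than its arc: |e^(it) - 1| = 2 |sin(t / 2)|. *)
Lemma cis_lip (x y : R) : nc (cis x - cis y) <= `|x - y|.
Proof.
have -> : cis x - cis y = cis y * (cis (x - y) - 1).
  by rewrite mulrBr mulr1 -cisD [y + _]addrC subrK.
rewrite ncM nc_cis mul1r; set t := x - y.
rewrite -(@ler_pXn2r _ 2)// ?nnegrE ?nc_ge0// nc_sqr /= subr0.
have -> : (cos t - 1) ^+ 2 + sin t ^+ 2 = 2 * (1 - cos t).
  by have := cos2Dsin2 t; move: (cos t) (sin t) => c s cs; rewrite sqrrB -addrA addrCA; nra.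
have -> : cos t = 1 - 2 * sin (t / 2) ^+ 2.
  rewrite {1}[t]splitr cosD -!expr2; have := cos2Dsin2 (t / 2).
  by move=> /(canRL (addrK _)) ->; ring.
have h : sin (t / 2) ^+ 2 <= (t / 2) ^+ 2.
  rewrite -(real_normK (num_real (sin _))) -(real_normK (num_real (t / 2))).
  by rewrite lerXn2r ?nnegrE// abs_sin_le.
by rewrite real_normK ?num_real//; move: h; rewrite expr_div_n; lra.
Qed.

(* [gam th s = \int_0^s exp(2 i r th) dr] *)
Definition gam th (s : R) : R[i] :=
  if th == 0 then s%:C else (cis (2 * th * s) - 1) / ('i%C * (2 * th)%:C).

Lemma is_cderiv_gam th a t : is_cderiv (fun s => gam th (s - a)) t (cis (2 * th * (t - a))).
Proof.
rewrite /gam; case: eqVneq => [->|th0].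
  rewrite mulr0 mul0r cis0; split => /=.
    apply: is_derive_eq (is_deriveB (is_derive_id t 1) (is_derive_cst a t 1)) _.
    by rewrite subr0.
  exact: is_derive_cst.
have i0 : 'i%C * (2 * th)%:C != 0 :> R[i].
  by rewrite mulf_neq0 ?complexiE// ?neq0Ci// fmorph_eq0 mulf_neq0.
have := is_cderivZ ('i%C * (2 * th)%:C)^-1
  (is_cderivD (is_cderiv_cis (2 * th) (- (2 * th * a)) t) (is_cderiv_cst (- 1) t)).
rewrite addr0 mulrA mulVf// mul1r -mulrBr.
by under eq_fun do rewrite -mulrBr mulrC.
Qed.

(** The integral of the retained phase over [-t, t]. The sign in [- th] matches multipliers, whose
    symbol is taken at -|k|^2 while th = |k|^2. *)
Lemma gam_sym th t : t != 0 ->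
  gam th t - gam th (- t) = (2 * t)%:C * (phis (2 * t * - th))%:C.
Proof.
move=> t0; rewrite /gam /phis mulf_eq0 oppr_eq0 mulf_eq0 (negPf t0) orbF pnatr_eq0/=.
case: ifPn => [_|th0]; first by rewrite -rmorphB/= mulr1; congr (_ +i* _); ring.
have c0 : 2 * t * th != 0 by rewrite !mulf_neq0.
have i0 : 'i%C * (2 * th)%:C != 0 :> R[i].
  by rewrite mulf_neq0 ?complexiE// ?neq0Ci// fmorph_eq0 mulf_neq0.
apply: (mulIf i0); rewrite -mulrBl divfK// [2 * t * - th]mulrN sinN invrN mulrNN.
rewrite [2 * th * - t]mulrN [2 * th * t]mulrAC opprB addrA subrK -cisJ.
apply/eqP; rewrite eq_complex !cReM !cImM /=; apply/andP; split; apply/eqP; first by ring.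
by field; rewrite t0 th0.
Qed.

(** The integral over [0, t], which is the origin of phi_1 in the starting step. *)
Lemma gam_half th t : t != 0 ->
  gam th t - gam th 0 = t%:C * phi1 (- 2 * 'i%C * (t * - th)%:C).
Proof.
move=> t0; have i0 : 'i%C != 0 :> R[i] by rewrite complexiE neq0Ci.
have e : - 2 * 'i%C * (t * - th)%:C = 'i%C * (2 * th * t)%:C.
  rewrite mulrN rmorphN !rmorphM/= rmorph_nat; ring.
rewrite e /gam /phi1 cexp_i !mulf_eq0 (negPf i0) !fmorph_eq0 !mulf_eq0 (negPf t0) orbF pnatr_eq0/=.
case: ifPn => [_|th0]; first by rewrite subr0 mulr1.
rewrite mulr0 cis0 subrr mul0r subr0 [(2 * th * t)%:C]rmorphM/=.
have h0 : (2 * th)%:C != 0 :> R[i] by rewrite fmorph_eq0 mulf_neq0.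
have t0' : t%:C != 0 :> R[i] by rewrite fmorph_eq0.
move: i0 h0 t0'; move: 'i%C (2 * th)%:C t%:C => I A B i0 h0 t0'.
by field; rewrite ?i0 ?h0 ?t0'.
Qed.

Lemma phis_le1 (x : R) : `|phis x| <= 1.
Proof.
rewrite /phis; case: ifPn => [_|x0]; first by rewrite normr1.
by rewrite normrM normfV ler_pdivrMr ?normr_gt0// mul1r abs_sin_le.
Qed.

Lemma phi1_le1 (x : R) : nc (phi1 ('i%C * x%:C)) <= 1.
Proof.
rewrite /phi1; case: ifPn => [_|x0]; first by rewrite nc1.
rewrite ncM ComplexField.Normc.normcV cexp_i ncM nc_i mul1r nc_real.
have {}x0 : x != 0 by apply: contra_neq x0 => ->; rewrite mulr0.
rewrite ler_pdivrMr ?normr_gt0// mul1r -cis0.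
by apply: le_trans (cis_lip _ _) _; rewrite subr0.
Qed.

Lemma l2_mvt (d : nat) s C (f df : R -> freq d -> R[i]) a b : a < b ->
  (forall k, {within `[a, b], continuous (fun r => complex.Re (f r k))}) ->
  (forall k, {within `[a, b], continuous (fun r => complex.Im (f r k))}) ->
  (forall r, a < r < b -> forall k, is_cderiv (f^~ k) r (df r k)) ->
  (forall r, a < r < b -> hs_le s C (fun k => nc (df r k))) ->
  hs_le s ((b - a) * C) (fun k => nc (f b k - f a k)).
Proof.
move=> ab cRe cIm fd dC.
have ba0 : 0 < b - a by rewrite subr_gt0.
have [C0 _] : hs_le s C (fun k => nc (df ((a + b) / 2) k)).
  by apply: dC; rewrite !(midf_lt ab).
split=> [|K uK]; first by rewrite mulr_ge0// ltW.
pose z k := f b k - f a k.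
pose W (k : freq d) : R := sobw s k ^+ 2.
have W0 k : 0 <= W k by exact: sqr_ge0.
(* The weighted real inner product of f r with the increment z over K, so that g b - g a is the
   squared norm of z and the scalar mean value theorem applies. *)
pose g r := \sum_(k <- K) W k * (complex.Re (z k) * complex.Re (f r k) +
  complex.Im (z k) * complex.Im (f r k)).
pose dg r := \sum_(k <- K) W k * (complex.Re (z k) * complex.Re (df r k) +
  complex.Im (z k) * complex.Im (df r k)).
have gd r : r \in `]a, b[ -> is_derive r 1 g (dg r).
  rewrite in_itv/= => rab; rewrite /g /dg; elim: (K) => [|k L IH].
    by rewrite big_nil; under eq_fun do rewrite big_nil; exact: is_derive_cst.
  rewrite big_cons; under eq_fun do rewrite big_cons.
  have [d1 d2] := fd r rab k.
  exact: (is_deriveD (is_deriveZ (W k) (is_deriveD (is_deriveZ (complex.Re (z k)) d1)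
    (is_deriveZ (complex.Im (z k)) d2))) IH).
have gc : {within `[a, b], continuous g}.
  pose G L r := \sum_(k <- L) W k * (complex.Re (z k) * complex.Re (f r k) +
    complex.Im (z k) * complex.Im (f r k)).
  rewrite -[g]/(G K); elim: (K) => [|k L IH].
    have -> : G [::] = cst 0 by apply: funext => r; rewrite /G big_nil.
    by move=> ?; exact: cvg_cst.
  have -> : G (k :: L) = (fun r => W k * (complex.Re (z k) * complex.Re (f r k) +
      complex.Im (z k) * complex.Im (f r k)) + G L r).
    by apply: funext => r; rewrite /G big_cons.
  move=> r; apply: cvgD; last exact: IH.
  apply: cvgM; first exact: cvg_cst.
  by apply: cvgD; apply: cvgM; try exact: cvg_cst; [exact: cRe|exact: cIm].
have [c cab] := MVT ab gd gc; move: cab; rewrite in_itv/= => cab.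
have -> : g b - g a = \sum_(k <- K) (sobw s k * nc (z k)) ^+ 2.
  rewrite /g -sumrB; apply: eq_bigr => k _; rewrite exprMn nc_sqr -/(W k).
  by rewrite {3 6}/z cReB cImB; ring.
set S := \sum_(k <- K) _ => e.
have [_ /(_ K uK) hC] := dC c cab.
have key k : (b - a) * (W k * (complex.Re (z k) * complex.Re (df c k) +
    complex.Im (z k) * complex.Im (df c k))) <=
    ((sobw s k * nc (z k)) ^+ 2 + (b - a) ^+ 2 * (sobw s k * nc (df c k)) ^+ 2) / 2.
  rewrite !exprMn !nc_sqr -/(W k); move: (W k) (W0 k) (b - a) => v v0 h.
  move: (complex.Re _) (complex.Im _) (complex.Re _) (complex.Im _) => p q r t.
  rewrite -subr_ge0; set X := (X in 0 <= X).
  have -> : X = v * ((r - h * p) ^+ 2 + (t - h * q) ^+ 2) / 2 by rewrite /X; field.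
  by rewrite divr_ge0// mulr_ge0// addr_ge0// sqr_ge0.
(* Half of S is absorbed on the left, which avoids dividing by the norm of the increment. *)
have : S <= (S + (b - a) ^+ 2 * C ^+ 2) / 2.
  rewrite {1}e mulrC /dg mulr_sumr; apply: le_trans (ler_sum _ (fun k _ => key k)) _.
  rewrite -mulr_suml ler_wpM2r ?invr_ge0// big_split/= lerD2l -mulr_sumr.
  by rewrite ler_wpM2l ?sqr_ge0.
by rewrite exprMn; lra.
Qed.

End cderiv.

(** * Trilinear estimates for functions *)

Section trilinear.
Context {R : realType} {d : nat}.
Implicit Types (k l : freq d) (u v w : @torus_fun R d).
Implicit Types (a b c : freq d -> R[i]).

Lemma nc_tri N (F : freq d -> freq d -> freq d -> R[i]) k :
  nc (tri (cube N) F k) <= tri (cube N) (fun k1 k2 k3 => nc (F k1 k2 k3)) k.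
Proof.
apply: le_trans (nc_sum _ _ _) _; apply: ler_sum => k1 _.
apply: le_trans (nc_sum _ _ _) _; apply: ler_sum => k2 _.
exact: nc_sum.
Qed.

Definition trunc N a k : R[i] := if k \in cube N then a k else 0.

Lemma tri_filter (V : nmodType) N P (F : freq d -> freq d -> freq d -> V) k : (N <= P)%N ->
  (forall k1 k2 k3, ~~ [&& k1 \in cube N, k2 \in cube N & k3 \in cube N] ->
     F k1 k2 k3 = 0) -> tri (cube P) F k = tri (cube N) F k.
Proof.
move=> NP F0.
have red (G : freq d -> V) : (forall l, l \notin cube N -> G l = 0) ->
    \sum_(l <- cube P) G l = \sum_(l <- cube N) G l.
  move=> G0; rewrite (bigID (mem (cube N)))/= [X in _ + X]big1 ?addr0// -big_filter.
  apply: perm_big; apply: uniq_perm; rewrite ?filter_uniq ?cube_uniq//.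
  by move=> l; rewrite mem_filter; case: (boolP (l \in cube N)) => //= /(sub_cube NP).
rewrite /tri red => [|k1 k1N]; last first.
  by rewrite big1// => k2 _; rewrite big1// => k3 _; rewrite F0// negb_and k1N.
apply: eq_bigr => k1 _; rewrite red => [|k2 k2N]; last first.
  by rewrite big1// => k3 _; rewrite F0// !negb_and k2N orbT.
apply: eq_bigr => k2 _; rewrite big_mkcond [RHS]big_mkcond red// => k3 k3N.
by rewrite F0 ?if_same// !negb_and k3N !orbT.
Qed.

(** With inputs supported in the cube of size N the form is stationary in P, so the limit in P can
    be taken while N stays fixed. *)
Lemma ctri_trunc N P a k : (N <= P)%N ->
  ctri P (trunc N a) (trunc N a) (trunc N a) k = ctri N a a a k.
Proof.
move=> NP; rewrite /ctri (tri_filter _ NP) => [|k1 k2 k3]; last first.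
  rewrite /trunc !negb_and => /or3P[] /negPf->; rewrite ?(mul0r, mulr0)//.
  by rewrite rmorph0 mulr0.
by apply: eq_tri => k1 k2 k3 h1 h2 h3; rewrite /trunc h1 h2 h3.
Qed.

(** [K] is the constant of the algebra property [hs_tri], fixed here so that all later bounds share
    it. *)
Variables alpha K : R.
Hypothesis HK : forall S X Y Z (x y z : freq d -> R), uniq S ->
  (forall k, 0 <= x k) -> (forall k, 0 <= y k) -> (forall k, 0 <= z k) ->
  hs_le alpha X x -> hs_le alpha Y y -> hs_le alpha Z z ->
  hs_le alpha (K * X * Y * Z) (tri S (fun k1 k2 k3 => x k1 * y k2 * z k3)).

Notation hsc B a := (hs_le alpha B (fun k => nc (a k))).

Lemma hsc_tri N X Y Z (x y z : freq d -> R) (F : freq d -> freq d -> freq d -> R[i]) :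
  (forall k, 0 <= x k) -> (forall k, 0 <= y k) -> (forall k, 0 <= z k) ->
  hs_le alpha X x -> hs_le alpha Y y -> hs_le alpha Z z ->
  (forall k1 k2 k3, nc (F k1 k2 k3) <= x k1 * y k2 * z k3) ->
  hsc (K * X * Y * Z) (tri (cube N) F).
Proof.
move=> x0 y0 z0 hx hy hz FB.
apply: hs_le_mono (HK (cube_uniq N) x0 y0 z0 hx hy hz) => k.
rewrite ger0_norm ?nc_ge0// ger0_norm; last by apply: tri_ge0 => *; rewrite !mulr_ge0.
by apply: le_trans (nc_tri _ _ _) _; apply: ler_tri => *; exact: FB.
Qed.

Lemma hsc_ctri N A B C a b c : hsc A a -> hsc B b -> hsc C c ->
  hsc (K * A * B * C) (ctri N a b c).
Proof.
move=> ha hb hc; apply: (@hsc_tri N A B C _ _ _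
  (fun k1 k2 k3 => a k1 * b k2 * (c k3)^*) _ _ _ ha hb hc) => *; rewrite ?nc_ge0//.
by rewrite !ncM ncJ.
Qed.

Lemma hscD A B a b : hsc A a -> hsc B b -> hsc (A + B) (fun k => a k + b k).
Proof.
move=> ha hb; apply: hs_le_mono (hs_leD ha hb) => k.
by rewrite ger0_norm ?nc_ge0// ger0_norm ?addr_ge0 ?nc_ge0// ncD.
Qed.

Lemma hscM A a (m : freq d -> R[i]) r : 0 <= r -> (forall k, nc (m k) <= r) -> hsc A a ->
  hsc (r * A) (fun k => m k * a k).
Proof.
move=> r0 mr ha; have := hs_leZ r ha; rewrite ger0_norm//.
apply: hs_le_mono => k; rewrite ger0_norm ?nc_ge0// ncM ger0_norm ?mulr_ge0 ?nc_ge0//.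
by rewrite ler_wpM2r ?nc_ge0.
Qed.

Lemma eq_hsc A a b : a =1 b -> hsc A a -> hsc A b.
Proof. by move=> ab; apply: hs_le_mono => k; rewrite ab. Qed.

Lemma hsc_weaken A B a : A <= B -> hsc A a -> hsc B a.
Proof. exact: l2_le_weaken. Qed.

Lemma hsc_ge0 A a : hsc A a -> 0 <= A.
Proof. by case. Qed.

(** Telescoping, one factor changed at a time. *)
Lemma hsc_ctri_lip N M e1 e2 e3 a b c a' b' c' :
  hsc M b -> hsc M c -> hsc M a' -> hsc M b' ->
  hsc e1 (fun k => a k - a' k) -> hsc e2 (fun k => b k - b' k) ->
  hsc e3 (fun k => c k - c' k) ->
  hsc (K * M ^+ 2 * (e1 + e2 + e3)) (fun k => ctri N a b c k - ctri N a' b' c' k).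
Proof.
move=> hb hc ha' hb' h1 h2 h3.
have := hscD (hscD (hsc_ctri N h1 hb hc) (hsc_ctri N ha' h2 hc)) (hsc_ctri N ha' hb' h3).
have -> : K * e1 * M * M + K * M * e2 * M + K * M * M * e3 = K * M ^+ 2 * (e1 + e2 + e3) by ring.
apply: eq_hsc => k; rewrite /ctri -!triD -triN -triD; apply: eq_tri => k1 k2 k3 _ _ _.
by rewrite rmorphB/=; ring.
Qed.

Lemma hsc_lim B (z : nat -> freq d -> R[i]) a : 0 <= B ->
  (forall e, 0 < e -> \forall n \near \oo, hsc (B + e) (z n)) ->
  (forall k, nc (a k - z n k) @[n --> \oo] --> 0) -> hsc B a.
Proof.
move=> B0 H za; apply: (hs_le_lim B0 H) => k.
apply: cvg_zero; apply/cvgr0Pnorm_le => e e0.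
near=> n; apply: (@le_trans _ _ (nc (a k - z n k))); last first.
  apply: le_trans (ler_norm _) _.
  by near: n; have /cvgr0Pnorm_le := za k; apply.
rewrite ler_norml; apply/andP; split.
  rewrite lerNl opprB lerBlDr; apply: le_trans (ncD _ _).
  by rewrite subrK.
rewrite lerBlDr nc_distC; apply: le_trans (ncD _ _).
by rewrite subrK.
Unshelve. all: by end_near. Qed.

Lemma nc_lim0B (z z' : nat -> R[i]) (p q : R[i]) :
  nc (p - z n) @[n --> \oo] --> (0 : R) -> nc (q - z' n) @[n --> \oo] --> (0 : R) ->
  nc ((p - q) - (z n - z' n)) @[n --> \oo] --> (0 : R).
Proof.
move=> h h'.
have cv : nc (p - z n) + nc (q - z' n) @[n --> \oo] --> (0 : R).
  by rewrite -[X in _ --> X]addr0; exact: cvgD.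
apply: (squeeze_cvgr _ (cvg_cst (0 : R)) cv); apply: nearW => n.
rewrite nc_ge0/= -[nc (q - z' n)]ncN; apply: le_trans (ncD _ _).
by rewrite (_ : p - q - (z n - z' n) = p - z n + - (q - z' n))//; ring.
Qed.

(** [Lam] is the constant of the embedding of H^alpha into absolutely summable families. *)
Variable Lam : R.
Hypothesis HL : forall B (x : freq d -> R), hs_le alpha B x -> l1_le (B * Lam) x.

Lemma cubic_hs u v w B : L2 u -> L2 v -> L2 w -> hsc B (fourier u) ->
  hsc B (fourier v) -> hsc B (fourier w) ->
  L2 (cubic u v w) /\ forall k,
    nc (fourier (cubic u v w) k -
        ctri N (fourier u) (fourier v) (fourier w) k) @[N --> \oo] --> 0.
Proof. by move=> u2 v2 w2 /HL hu /HL hv /HL hw; exact: cubic_fourier hu hv hw. Qed.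

Lemma hsc_cubic u v w B : L2 u -> L2 v -> L2 w -> hsc B (fourier u) ->
  hsc B (fourier v) -> hsc B (fourier w) ->
  hsc (K * B ^+ 3) (fourier (cubic u v w)).
Proof.
move=> u2 v2 w2 hu hv hw; have [_ cv] := cubic_hs u2 v2 w2 hu hv hw.
have e : K * B ^+ 3 = K * B * B * B by ring.
have h N := hsc_ctri N hu hv hw.
apply: (hsc_lim _ _ cv); first by rewrite e; exact: hsc_ge0 (h 0%N).
by move=> r r0; apply: nearW => n; apply: hsc_weaken (h n); rewrite -e lerDl ltW.
Qed.

Lemma hsc_cubic_lip u v w u' v' w' M e1 e2 e3 :
  L2 u -> L2 v -> L2 w -> L2 u' -> L2 v' -> L2 w' ->
  hsc M (fourier u) -> hsc M (fourier v) -> hsc M (fourier w) ->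
  hsc M (fourier u') -> hsc M (fourier v') -> hsc M (fourier w') ->
  hsc e1 (fun k => fourier u k - fourier u' k) ->
  hsc e2 (fun k => fourier v k - fourier v' k) ->
  hsc e3 (fun k => fourier w k - fourier w' k) ->
  hsc (K * M ^+ 2 * (e1 + e2 + e3))
    (fun k => fourier (cubic u v w) k - fourier (cubic u' v' w') k).
Proof.
move=> u2 v2 w2 u2' v2' w2' hu hv hw hu' hv' hw' h1 h2 h3.
have [_ cv] := cubic_hs u2 v2 w2 hu hv hw.
have [_ cv'] := cubic_hs u2' v2' w2' hu' hv' hw'.
have h N := hsc_ctri_lip N hv hw hu' hv' h1 h2 h3.
apply: (hsc_lim (hsc_ge0 (h 0%N))) => [r r0|k]; last exact: nc_lim0B (cv k) (cv' k).
by apply: nearW => n; apply: hsc_weaken (h n); rewrite lerDl ltW.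
Qed.

Lemma fDelta_hs (f : R -> R[i]) v B : (forall y, nc (f y) <= 1) -> hsc B (fourier v) ->
  L2 (fDelta f v) /\ forall k, fourier (fDelta f v) k = f (- normsq k) * fourier v k.
Proof.
move=> f1 hv; rewrite fDelta_synthesis.
have /HL h := hscM ler01 (fun k => f1 (- normsq k)) hv.
by split=> [|k]; [exact: L2_synthesis h|exact: fourier_synthesis h].
Qed.

Lemma L2J v : L2 v -> L2 (fun x => (v x)^*).
Proof.
move=> [pv v1 v2]; split.
- by move=> x y i yi yj; rewrite (pv _ _ _ yi yj).
- by under eq_fun do rewrite cReJ.
- under eq_fun do rewrite cImJ.
  rewrite (_ : (fun x => _) = (-1 : R) \o* (fun x => complex.Im (v x))); last first.
    by apply: funext => x /=; rewrite mulrN1.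
  by apply: Lfun_scale v2; rewrite ler1n.
Qed.

(** Conjugation reflects the frequencies, and the Sobolev weight is even. *)
Lemma hs_leJ B v : L2 v -> hsc B (fourier v) -> hsc B (fourier (fun x => (v x)^*)).
Proof.
move=> v2 hv.
have nI : injective (fun k : freq d => [tuple - tnth k i | i < d] : freq d).
  move=> k l e; apply: eq_from_tnth => i.
  have := congr1 (fun t : freq d => tnth t i) e; rewrite !tnth_mktuple.
  exact: oppr_inj.
apply: l2_le_mono (l2_le_comp nI hv) => k.
rewrite (fourierJ _ (L2_cintegrable v2)) ncJ.
suff -> : sobw alpha [tuple - tnth k i | i < d] = sobw alpha k :> R by [].
rewrite /sobw /jap /normsq; congr ((_ + _) `^ _); apply: eq_bigr => i _.
by rewrite tnth_mktuple rmorphN/= sqrrN.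
Qed.

Lemma LfunD (f g : tpoint d -> R) :
  f \in Lfun (haar d) 2%:E -> g \in Lfun (haar d) 2%:E ->
  (fun x => f x + g x) \in Lfun (haar d) 2%:E.
Proof.
have p1 : (1 <= 2%:E :> \bar R)%E by rewrite lee_fin ler1n.
by case: (Lfun_addr_closed (haar d) p1) => _; apply.
Qed.

Lemma L2Z v (c : R[i]) : L2 v -> L2 (fun x => c * v x).
Proof.
move=> [pv v1 v3]; have r12 : (1 <= 2 :> R) by rewrite ler1n.
split; first by move=> x y i yi yj; rewrite (pv _ _ _ yi yj).
  rewrite (_ : (fun x => _) = (fun x => (complex.Re c \o* (fun x => complex.Re (v x))) x +
    ((- complex.Im c) \o* (fun x => complex.Im (v x))) x)).
    by apply: LfunD; apply: Lfun_scale.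
  apply: funext => x; rewrite cReM.
  rewrite -[RHS]/(complex.Re (v x) * complex.Re c + complex.Im (v x) * - complex.Im c).
  by move: (complex.Re _) (complex.Im _) (complex.Re _) (complex.Im _) => *; ring.
rewrite (_ : (fun x => _) = (fun x => (complex.Re c \o* (fun x => complex.Im (v x))) x +
  (complex.Im c \o* (fun x => complex.Re (v x))) x)).
  by apply: LfunD; apply: Lfun_scale.
apply: funext => x; rewrite cImM.
rewrite -[RHS]/(complex.Im (v x) * complex.Re c + complex.Re (v x) * complex.Im c).
by move: (complex.Re _) (complex.Im _) (complex.Re _) (complex.Im _) => *; ring.
Qed.

Lemma L2B u v : L2 u -> L2 v -> L2 (fun x => u x - v x).
Proof.
move=> [pu u1 u2] /(L2Z (-1))[pv v1 v2]; split.
- move=> x y i yi yj; have := pv _ _ _ yi yj; rewrite !mulN1r => /oppr_inj ->.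
  by rewrite (pu _ _ _ yi yj).
- rewrite (_ : (fun x => _) = (fun x => complex.Re (u x) + complex.Re (-1 * v x))).
    exact: LfunD.
  by apply: funext => x; rewrite mulN1r -cReD.
- rewrite (_ : (fun x => _) = (fun x => complex.Im (u x) + complex.Im (-1 * v x))).
    exact: LfunD.
  by apply: funext => x; rewrite mulN1r -cImD.
Qed.

(* [fDelta m (conj v)] enters the cubic expression as the conjugate of this
   function, whose Fourier symbol is [conj m]. *)
Definition conj_mult (m : R -> R[i]) v : @torus_fun R d :=
  fun x => (fDelta m (fun y => (v y)^*) x)^*.

Lemma conj_mult_hs m v B : (forall y, nc (m y) <= 1) -> L2 v -> hsc B (fourier v) ->
  L2 (conj_mult m v) /\
  forall k, fourier (conj_mult m v) k = (m (- normsq k))^* * fourier v k.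
Proof.
move=> m1 v2 hv; have [L2D fD] := fDelta_hs m1 (hs_leJ v2 hv).
split=> [|k]; first exact: L2J.
rewrite (fourierJ _ (L2_cintegrable L2D)) fD (fourierJ _ (L2_cintegrable v2)) conjM conjCK.
congr ((m (- _))^* * fourier v _).
  by apply: eq_bigr => i _; rewrite tnth_mktuple rmorphN/= sqrrN.
by apply: eq_from_tnth => i; rewrite !tnth_mktuple opprK.
Qed.

Lemma cubic_conj_mult u m v : cubic u u (conj_mult m v) =
  fun x => u x ^+ 2 * fDelta m (fun y => (v y)^*) x.
Proof. by apply: funext => x; rewrite /cubic /conj_mult conjCK expr2. Qed.

(** * Local error *)

Definition dot k l : R := \sum_(i < d) (tnth k i)%:~R * (tnth l i)%:~R.

(** A coordinatewise bound in place of Cauchy-Schwarz, at the price of the factor d. *)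
Lemma dot_le k l : `|dot k l| <= d%:R * (Num.sqrt (normsq k) * Num.sqrt (normsq l)).
Proof.
apply: le_trans (ler_norm_sum _ _ _) _.
have -> : d%:R * (Num.sqrt (normsq k) * Num.sqrt (normsq l)) =
    \sum_(i < d) (Num.sqrt (normsq k) * Num.sqrt (normsq l)) :> R.
  by rewrite sumr_const card_ord mulr_natl.
apply: ler_sum => i _; rewrite normrM -!sqrtr_sqr.
by rewrite ler_pM ?sqrtr_ge0// ler_sqrt ?normsq_ge0// normsq_ge.
Qed.

(** Hence |k|^2 - |k1|^2 - |k2|^2 + |k3|^2 is 2 |k3|^2 plus mixed products only. *)
Lemma normsq_reso k1 k2 k3 : normsq (reso k1 k2 k3) - normsq k1 - normsq k2 - normsq k3 =
  2 * (dot k1 k2 - dot k1 k3 - dot k2 k3) :> R.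
Proof.
rewrite /normsq /dot -!sumrB mulr_sumr; apply: eq_bigr => i _.
by rewrite tnth_mktuple rmorphB rmorphD/=; ring.
Qed.

(* Only the phase [2 s |k3|^2] is kept; the rest of the phase involves products of
   two different frequencies and thus costs a single derivative on two factors. *)
Lemma hsc_phase N s M (w : freq d -> R[i]) : hs_le (alpha + 1) M (fun k => nc (w k)) ->
  hsc (6 * d%:R * K * M ^+ 3 * `|s|)
    (fun k => cis (s * normsq k) * ctri N (fun k => cis (- (s * normsq k)) * w k)
        (fun k => cis (- (s * normsq k)) * w k) (fun k => cis (- (s * normsq k)) * w k) k
      - tri (cube N) (fun k1 k2 k3 =>
          w k1 * w k2 * (w k3)^* * cis (2 * normsq k3 * s)) k).
Proof.
move=> wM; have wA := hs_le_drop wM; have wD := hs_le_weight wM.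
pose y k := nc (w k); pose x k := Num.sqrt (normsq k) * nc (w k).
have y0 k : 0 <= y k by exact: nc_ge0.
have x0 k : 0 <= x k by rewrite mulr_ge0 ?sqrtr_ge0 ?nc_ge0.
have uN : uniq (cube N : seq (freq d)) := cube_uniq N.
have h1 := HK uN x0 x0 y0 wD wD wA; have h2 := HK uN x0 y0 x0 wD wA wD.
have h3 := HK uN y0 x0 x0 wA wD wD.
(* The 2 comes from [normsq_reso] and d from [dot_le]; the three ways to place two derivatives turn
   this into 6 d. *)
have := hs_leZ (2 * d%:R * `|s|) (hs_leD (hs_leD h1 h2) h3).
have r0 : 0 <= 2 * d%:R * `|s| by rewrite !mulr_ge0.
rewrite (ger0_norm r0).
have -> : 2 * d%:R * `|s| * (K * M * M * M + K * M * M * M + K * M * M * M) =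
  6 * d%:R * K * M ^+ 3 * `|s| by ring.
apply: hs_le_mono => k; rewrite -!triD -triZ ger0_norm ?nc_ge0//.
rewrite /ctri -triZ -triN -triD.
apply: le_trans (nc_tri _ _ _) _; apply: le_trans (ler_norm _).
rewrite /tri; apply: ler_sum => k1 _; apply: ler_sum => k2 _.
apply: ler_sum => k3 /eqP kk.
set p := w k1; set q := w k2; set r := w k3.
have -> : cis (s * normsq k) * (cis (- (s * normsq k1)) * p * (cis (- (s * normsq k2)) * q) *
    (cis (- (s * normsq k3)) * r)^*) - p * q * r^* * cis (2 * normsq k3 * s) =
    p * q * r^* * (cis (s * (normsq k - normsq k1 - normsq k2 + normsq k3)) -
      cis (2 * normsq k3 * s)).
  rewrite conjM cisJ opprK.
  have -> : s * (normsq k - normsq k1 - normsq k2 + normsq k3) =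
    s * normsq k + - (s * normsq k1) + - (s * normsq k2) + s * normsq k3 by ring.
  by rewrite !cisD; ring.
rewrite !ncM ncJ.
have le1 : nc (cis (s * (normsq k - normsq k1 - normsq k2 + normsq k3)) -
    cis (2 * normsq k3 * s)) <= 2 * d%:R * `|s| *
    (Num.sqrt (normsq k1) * Num.sqrt (normsq k2) + Num.sqrt (normsq k1) * Num.sqrt (normsq k3)
     + Num.sqrt (normsq k2) * Num.sqrt (normsq k3)).
  apply: le_trans (cis_lip _ _) _.
  have -> : s * (normsq k - normsq k1 - normsq k2 + normsq k3) - 2 * normsq k3 * s =
    s * (normsq k - normsq k1 - normsq k2 - normsq k3) by ring.
  rewrite -kk normsq_reso !normrM normr_nat.
  have -> (z : R) : 2 * d%:R * `|s| * z = `|s| * (2 * (d%:R * z)) by ring.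
  rewrite ler_wpM2l// ler_wpM2l//.
  apply: le_trans (ler_normB _ _) _; rewrite !mulrDr lerD ?dot_le//.
  by apply: le_trans (ler_normB _ _) _; rewrite lerD ?dot_le.
apply: le_trans (ler_wpM2l _ le1) _; first by rewrite !mulr_ge0 ?nc_ge0.
by rewrite le_eqVlt /x /y; apply/orP; left; apply/eqP; rewrite -/p -/q -/r; ring.
Qed.

Section solution.
Variables (mu T M : R) (u : R -> @torus_fun R d).
Hypothesis K0 : 0 <= K.
Hypothesis u2 : forall t, 0 <= t <= T -> L2 (u t).
Hypothesis uM : forall t, 0 <= t <= T ->
  hs_le (alpha + 1) M (fun k => nc (fourier (u t) k)).
Hypothesis uRe : forall k,
  {within `[0, T], continuous (fun t => complex.Re (fourier (u t) k))}.
Hypothesis uIm : forall k,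
  {within `[0, T], continuous (fun t => complex.Im (fourier (u t) k))}.
Hypothesis ud : forall t, 0 < t < T -> forall k,
  is_cderiv (fun s => fourier (u s) k) t (- 'i%C * ((normsq k)%:C * fourier (u t) k
    + mu%:C * fourier (cubic (u t) (u t) (u t)) k)).

(** Fourier coefficients of e^(-it Delta) u(t); the symbol -|k|^2 of Delta makes the exponent
    positive. *)
Definition twist t k : R[i] := cis (t * normsq k) * fourier (u t) k.

Lemma hsc_sol t : 0 <= t <= T -> hsc M (fourier (u t)).
Proof. by move=> /uM /hs_le_drop. Qed.

Lemma twist_cderiv t k : 0 < t < T -> is_cderiv (twist^~ k) t
  (- 'i%C * mu%:C * (cis (t * normsq k) * fourier (cubic (u t) (u t) (u t)) k)).
Proof.
move=> ht; have := is_cderivM (is_cderiv_cis (normsq k) 0 t) (ud ht k).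
have -> : (fun s => cis (normsq k * s + 0) * fourier (u s) k) = twist^~ k.
  by apply: funext => s; rewrite /twist addr0 [normsq k * s]mulrC.
rewrite addr0 [normsq k * t]mulrC.
have -> // : 'i%C * (normsq k)%:C * cis (t * normsq k) * fourier (u t) k +
   cis (t * normsq k) * (- 'i%C * ((normsq k)%:C * fourier (u t) k +
      mu%:C * fourier (cubic (u t) (u t) (u t)) k)) =
  - 'i%C * mu%:C * (cis (t * normsq k) * fourier (cubic (u t) (u t) (u t)) k).
by ring.
Qed.

Lemma within_sub (a b : R) (f : R -> R) : 0 <= a -> b <= T ->
  {within `[0, T], continuous f} -> {within `[a, b], continuous f}.
Proof.
move=> a0 bT; apply: continuous_subspaceW => x /=; rewrite !in_itv/= => /andP[ax xb].
by rewrite (le_trans a0 ax) (le_trans xb bT).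
Qed.

Lemma continuous_cos_lin n : continuous (fun t : R => cos (t * n)).
Proof.
move=> x; apply: (@continuous_comp _ _ _ (fun t : R => t * n) cos).
  by apply: cvgM => //; exact: cvg_cst.
exact: continuous_cos.
Qed.

Lemma continuous_sin_lin n : continuous (fun t : R => sin (t * n)).
Proof.
move=> x; apply: (@continuous_comp _ _ _ (fun t : R => t * n) sin).
  by apply: cvgM => //; exact: cvg_cst.
exact: continuous_sin.
Qed.

Lemma twist_cont (a b : R) k : 0 <= a -> b <= T ->
  {within `[a, b], continuous (fun t => complex.Re (twist t k))} /\
  {within `[a, b], continuous (fun t => complex.Im (twist t k))}.
Proof.
move=> a0 bT.
have c1 : {within `[a, b], continuous (fun t : R => cos (t * normsq k))}.
  by apply: continuous_subspaceT; exact: continuous_cos_lin.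
have c2 : {within `[a, b], continuous (fun t : R => sin (t * normsq k))}.
  by apply: continuous_subspaceT; exact: continuous_sin_lin.
have r1 : {within `[a, b], continuous (fun t => complex.Re (fourier (u t) k))}.
  by apply: (within_sub a0 bT); exact: uRe.
have r2 : {within `[a, b], continuous (fun t => complex.Im (fourier (u t) k))}.
  by apply: (within_sub a0 bT); exact: uIm.
split.
  have -> : (fun t => complex.Re (twist t k)) = (fun t => cos (t * normsq k) *
      complex.Re (fourier (u t) k) - sin (t * normsq k) * complex.Im (fourier (u t) k)).
    by apply: funext => t; rewrite /twist cReM.
  by move=> x; apply: cvgB; apply: cvgM; [exact: c1|exact: r1|exact: c2|exact: r2].
have -> : (fun t => complex.Im (twist t k)) = (fun t => cos (t * normsq k) *
    complex.Im (fourier (u t) k) + sin (t * normsq k) * complex.Re (fourier (u t) k)).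
  by apply: funext => t; rewrite /twist cImM.
by move=> x; apply: cvgD; apply: cvgM; [exact: c1|exact: r2|exact: c2|exact: r1].
Qed.

Lemma M_ge0 t : 0 <= t <= T -> 0 <= M.
Proof. by move=> /hsc_sol /hsc_ge0. Qed.

(** Only the cubic term is left in the derivative of [twist], so its variation in H^alpha costs no
    derivative. *)
Lemma twist_lip t r : 0 <= t <= T -> 0 <= r <= T ->
  hsc (`|r - t| * (`|mu| * (K * M ^+ 3))) (fun k => twist r k - twist t k).
Proof.
have main (a b : R) : a < b -> 0 <= a <= T -> 0 <= b <= T ->
    hsc ((b - a) * (`|mu| * (K * M ^+ 3))) (fun k => twist b k - twist a k).
  move=> ab /andP[a0 aT] /andP[b0 bT].
  apply: (l2_mvt (f := twist) (df := fun q k => - 'i%C * mu%:C *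
      (cis (q * normsq k) * fourier (cubic (u q) (u q) (u q)) k)) ab).
  - by move=> k; have [] := twist_cont k a0 bT.
  - by move=> k; have [] := twist_cont k a0 bT.
  - move=> q /andP[aq qb] k; apply: twist_cderiv.
    by rewrite (le_lt_trans a0 aq) (lt_le_trans qb bT).
  move=> q /andP[aq qb].
  have hq : 0 <= q <= T by rewrite (le_trans a0 (ltW aq)) (le_trans (ltW qb) bT).
  have hN := hsc_cubic (u2 hq) (u2 hq) (u2 hq) (hsc_sol hq) (hsc_sol hq) (hsc_sol hq).
  have m2 k : nc (- 'i%C * mu%:C * cis (q * normsq k)) <= `|mu|.
    by rewrite !ncM ncN nc_i nc_cis nc_real mul1r mulr1.
  by apply: eq_hsc (hscM (normr_ge0 mu) m2 hN) => k; rewrite !mulrA.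
move=> ht hr; have [rt|tr|<-] := ltgtP r t.
- rewrite ltr0_norm ?subr_lt0// opprB.
  by apply: hs_le_mono (main _ _ rt hr ht) => k; rewrite nc_distC.
- by rewrite gtr0_norm ?subr_gt0//; exact: main.
- rewrite subrr normr0 mul0r; apply: l2_le_mono (l2_le0 _) => k.
  by rewrite subrr nc0 mulr0.
Qed.

(** The primitive of [dfilt] in r that vanishes at r = t, with u frozen at time t. *)
Definition filt N t k r := tri (cube N) (fun k1 k2 k3 => fourier (u t) k1 *
  fourier (u t) k2 * (fourier (u t) k3)^* * gam (normsq k3) (r - t)) k.

Definition dfilt N t k r := tri (cube N) (fun k1 k2 k3 => fourier (u t) k1 *
  fourier (u t) k2 * (fourier (u t) k3)^* * cis (2 * normsq k3 * (r - t))) k.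

Lemma filt_cderiv N t k r : is_cderiv (filt N t k) r (dfilt N t k r).
Proof.
do 3!apply: is_cderiv_sum => ?; apply: is_cderivZ; exact: is_cderiv_gam.
Qed.

(** The first summand comes from freezing the twisted variable at t in each of three factors, the
    second from the discarded phase. *)
Definition locerr : R := 3 * K * M ^+ 2 * (`|mu| * (K * M ^+ 3)) + 6 * d%:R * K * M ^+ 3.

(** Two replacements, each of order |r - t|: u(r) by the free evolution of u(t), then the full phase
    by the retained one. The last term of the bound is the truncation to the cube. *)
Lemma hsc_dfilt N t r : 0 <= t <= T -> 0 <= r <= T ->
  hsc (`|r - t| * locerr + 3 * K * M ^+ 2 * (N.+1%:R^-1 * M))
    (fun k => cis ((r - t) * normsq k) * fourier (cubic (u r) (u r) (u r)) k - dfilt N t k r).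
Proof.
move=> ht hr; set s := r - t.
(* The free evolution of u(t) up to time r. *)
pose b k := cis (- (s * normsq k)) * fourier (u t) k.
have nb k : nc (b k) = nc (fourier (u t) k) by rewrite ncM nc_cis mul1r.
pose del := `|s| * (`|mu| * (K * M ^+ 3)) + N.+1%:R^-1 * M.
have d1 : hsc (`|s| * (`|mu| * (K * M ^+ 3))) (fun k => fourier (u r) k - b k).
  apply: hs_le_mono (twist_lip ht hr) => k; rewrite !ger0_norm ?nc_ge0//.
  have -> : fourier (u r) k - b k = cis (- (r * normsq k)) * (twist r k - twist t k).
    have e1 : cis (- (r * normsq k)) * cis (r * normsq k) = 1 by rewrite -cisD addNr cis0.
    have e2 : cis (- (s * normsq k)) = cis (- (r * normsq k)) * cis (t * normsq k).
      by rewrite -cisD /s; congr cis; ring.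
    by rewrite /twist /b e2 mulrBr !mulrA e1 mul1r.
  by rewrite ncM nc_cis mul1r.
have d2 : hsc (N.+1%:R^-1 * M) (fun k => b k - trunc N b k).
  apply: hs_le_mono (hs_le_tail N (uM ht)) => k; rewrite /trunc.
  by case: ifP; rewrite ?subrr ?nc0 ?normr0// subr0 nb.
have dd : hsc del (fun k => fourier (u r) k - trunc N b k).
  by apply: eq_hsc (hscD d1 d2) => k; rewrite addrA subrK.
have tb : hsc M (trunc N b).
  apply: hs_le_mono (hsc_sol ht) => k; rewrite !ger0_norm ?nc_ge0// /trunc.
  by case: ifP => _; rewrite ?nc0 ?nc_ge0// nb.
have part1 : hsc (K * M ^+ 2 * (del + del + del))
    (fun k => fourier (cubic (u r) (u r) (u r)) k - ctri N b b b k).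
  have ur := hsc_sol hr; have [_ cv] := cubic_hs (u2 hr) (u2 hr) (u2 hr) ur ur ur.
  have h P := hsc_ctri_lip P ur ur tb tb dd dd dd.
  apply: (hsc_lim (hsc_ge0 (h 0%N)) (z := fun P k =>
      ctri P (fourier (u r)) (fourier (u r)) (fourier (u r)) k -
      ctri P (trunc N b) (trunc N b) (trunc N b) k)) => [e e0|k].
    by apply: nearW => P; apply: hsc_weaken (h P); rewrite lerDl ltW.
  apply: cvg_trans (cv k); apply: near_eq_cvg; exists N => // P /= NP.
  rewrite ctri_trunc//; congr nc; ring.
have part1' := @hscM _ _ (fun k => cis (s * normsq k)) 1 ler01 _ part1.
have {}part1' := part1' (fun k => eq_ind_r (fun z => z <= 1) (lexx 1) (nc_cis _)).
have := hscD part1' (hsc_phase N s (uM ht)).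
have -> : 1 * (K * M ^+ 2 * (del + del + del)) + 6 * d%:R * K * M ^+ 3 * `|s| =
    `|s| * locerr + 3 * K * M ^+ 2 * (N.+1%:R^-1 * M) by rewrite /locerr /del; ring.
apply: eq_hsc => k; rewrite mulrBr; cbv beta.
by rewrite /dfilt addrA subrK.
Qed.

Lemma cderiv_cont (f df : R -> R[i]) : (forall t, is_cderiv f t (df t)) ->
  continuous (fun t => complex.Re (f t)) /\ continuous (fun t => complex.Im (f t)).
Proof.
move=> fd; split=> t; apply: differentiable_continuous; apply/derivable1_diffP.
  by have [[]] := fd t.
by have [_ []] := fd t.
Qed.

(** Here [a, b] is the time interval of the step, t the time at which u is frozen, and m the filter
    obtained by integrating the retained phase from a to b. *)
Lemma local_error (a b t tau h : R) (m : R -> R[i]) : 0 <= a -> a < b -> b <= T ->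
  a <= t <= b -> b - t <= tau -> t - a <= tau -> (forall y, nc (m y) <= 1) ->
  (forall th, gam th (b - t) - gam th (a - t) = h%:C * m (- th)) ->
  hsc ((b - a) * (`|mu| * (tau * locerr))) (fun k => twist b k - twist a k +
    'i%C * mu%:C * h%:C * cis (t * normsq k) *
    fourier (cubic (u t) (u t) (conj_mult m (u t))) k).
Proof.
move=> a0 ab bT /andP[at_ tb] bt ta m1 gm.
have ht : 0 <= t <= T by rewrite (le_trans a0 at_) (le_trans tb bT).
have M0 := M_ge0 ht.
have L0 : 0 <= locerr by rewrite /locerr addr_ge0// !mulr_ge0// ?exprn_ge0.
(* Adding [filt] cancels the leading part of the derivative of [twist], so the mean value inequality
   gives a bound quadratic in the step, up to the truncation error [E N]. *)
pose f N r k := twist r k + 'i%C * mu%:C * cis (t * normsq k) * filt N t k r.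
pose df N r k := - 'i%C * mu%:C * (cis (r * normsq k) * fourier (cubic (u r) (u r) (u r)) k) +
  'i%C * mu%:C * cis (t * normsq k) * dfilt N t k r.
pose E N := 3 * K * M ^+ 2 * (N.+1%:R^-1 * M).
have step1 N : hsc ((b - a) * (`|mu| * (tau * locerr + E N))) (fun k => f N b k - f N a k).
  have fc k := cderiv_cont (fun r => is_cderivZ ('i%C * mu%:C * cis (t * normsq k)) (filt_cderiv N t k r)).
  apply: (l2_mvt (f := f N) (df := df N) ab).
  - move=> k; have [c1 _] := twist_cont k a0 bT; have [c2 _] := fc k.
    rewrite (_ : (fun r => _) = (fun r => complex.Re (twist r k) +
      complex.Re ('i%C * mu%:C * cis (t * normsq k) * filt N t k r))); last first.
      by apply: funext => r; rewrite /f cReD.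
    by move=> r; apply: cvgD; [exact: c1|exact: (continuous_subspaceT c2)].
  - move=> k; have [_ c1] := twist_cont k a0 bT; have [_ c2] := fc k.
    rewrite (_ : (fun r => _) = (fun r => complex.Im (twist r k) +
      complex.Im ('i%C * mu%:C * cis (t * normsq k) * filt N t k r))); last first.
      by apply: funext => r; rewrite /f cImD.
    by move=> r; apply: cvgD; [exact: c1|exact: (continuous_subspaceT c2)].
  - move=> r /andP[ar rb] k; apply: is_cderivD.
      by apply: twist_cderiv; rewrite (le_lt_trans a0 ar) (lt_le_trans rb bT).
    by apply: is_cderivZ; exact: filt_cderiv.
  move=> r /andP[ar rb].
  have hr : 0 <= r <= T by rewrite (le_trans a0 (ltW ar)) (le_trans (ltW rb) bT).
  have := @hscM _ _ (fun k => - 'i%C * mu%:C * cis (t * normsq k)) `|mu| (normr_ge0 _) _ (hsc_dfilt N ht hr).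
  have m2 k : nc (- 'i%C * mu%:C * cis (t * normsq k)) <= `|mu|.
    by rewrite !ncM ncN nc_i nc_cis nc_real mul1r mulr1.
  move=> /(_ m2) H; apply: (@hsc_weaken (`|mu| * (`|r - t| * locerr + E N))).
    rewrite ler_wpM2l// lerD2r ler_wpM2r// ler_norml; apply/andP; split; lra.
  apply: eq_hsc H => k; rewrite /df.
  have -> : r * normsq k = t * normsq k + (r - t) * normsq k by ring.
  by rewrite cisD; ring.
have [g2 fg] := conj_mult_hs m1 (u2 ht) (hsc_sol ht).
have gM : hsc M (fourier (conj_mult m (u t))).
  apply: hs_le_mono (hsc_sol ht) => k; rewrite !ger0_norm ?nc_ge0// fg ncM ncJ.
  by rewrite ler_piMl ?nc_ge0.
have [_ cv] := cubic_hs (u2 ht) (u2 ht) g2 (hsc_sol ht) (hsc_sol ht) gM.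
apply: (hsc_lim _ _ (z := fun N k => f N b k - f N a k)).
- have tau0 : 0 <= tau by apply: le_trans bt; rewrite subr_ge0.
  by apply: mulr_ge0; [rewrite subr_ge0 ltW|rewrite !mulr_ge0].
- move=> e e0.
  have c0 : (b - a) * `|mu| * (3 * K * M ^+ 2 * M) * N.+1%:R^-1 @[N --> \oo] -->
      (b - a) * `|mu| * (3 * K * M ^+ 2 * M) * 0.
    by apply: cvgM; [exact: cvg_cst|exact: cvg_harmonic].
  rewrite mulr0 in c0; apply: filterS (cvgr_le _ c0 e e0) => N hN.
  apply: hsc_weaken (step1 N); rewrite !mulrDr lerD2l; apply: le_trans hN.
  by rewrite /E le_eqVlt; apply/orP; left; apply/eqP; ring.
move=> k; cbv beta; set F := fourier (cubic _ _ _) k.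
have eN N : f N b k - f N a k = twist b k - twist a k + 'i%C * mu%:C * h%:C *
    cis (t * normsq k) * ctri N (fourier (u t)) (fourier (u t)) (fourier (conj_mult m (u t))) k.
  have -> : f N b k - f N a k = twist b k - twist a k + 'i%C * mu%:C *
      cis (t * normsq k) * (filt N t k b - filt N t k a) by rewrite /f; ring.
  (* By [gm], the increment of [gam] is the filter acting on the third factor, with no further
     error. *)
  have -> : filt N t k b - filt N t k a = h%:C *
      ctri N (fourier (u t)) (fourier (u t)) (fourier (conj_mult m (u t))) k.
    rewrite /filt /ctri -triN -triD -triZ; apply: eq_tri => k1 k2 k3 _ _ _.
    by rewrite -mulrBr gm fg conjM conjCK; ring.
  by ring.
have c0 : `|mu| * `|h| * nc (F - ctri N (fourier (u t)) (fourier (u t))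
    (fourier (conj_mult m (u t))) k) @[N --> \oo] --> `|mu| * `|h| * 0.
  by apply: cvgM; [exact: cvg_cst|exact: cv].
rewrite mulr0 in c0; apply: cvg_trans c0; apply: near_eq_cvg; apply: nearW => N; cbv beta.
rewrite eN; set c := ctri _ _ _ _ _.
have -> : twist b k - twist a k + 'i%C * mu%:C * h%:C * cis (t * normsq k) * F -
    (twist b k - twist a k + 'i%C * mu%:C * h%:C * cis (t * normsq k) * c) =
    'i%C * mu%:C * h%:C * cis (t * normsq k) * (F - c) by ring.
by rewrite !ncM nc_i nc_cis !nc_real mul1r mulr1.
Qed.

(** Consistency and stability together: [ep] is the error at the left end a, carried along
    isometrically, and [e] is the error at t, amplified by the Lipschitz constant of the cubic
    term. *)
Lemma one_step (a b t tau h e ep : R) (c : R[i]) (m fA fB : R -> R[i]) v vp :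
  0 <= a -> a < b -> b <= T -> a <= t <= b -> b - t <= tau -> t - a <= tau ->
  (forall y, nc (m y) <= 1) -> (forall y, nc (fA y) <= 1) -> (forall y, nc (fB y) <= 1) ->
  (forall th, gam th (b - t) - gam th (a - t) = h%:C * m (- th)) ->
  c = 'i%C * mu%:C * h%:C -> (forall y, fA y = cis ((b - a) * y)) ->
  (forall y, fB y = cis ((b - t) * y)) -> L2 v -> L2 vp -> e <= 1 ->
  hsc ep (fun k => fourier (u a) k - fourier vp k) ->
  hsc e (fun k => fourier (u t) k - fourier v k) ->
  let new := fun x => fDelta fA vp x -
    c * fDelta fB (fun y => v y ^+ 2 * fDelta m (fun z => (v z)^*) y) x in
  L2 new /\ hsc ((b - a) * (`|mu| * (tau * locerr)) + ep +
      `|mu| * `|h| * (K * (M + 1) ^+ 2 * (e + e + e)))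
    (fun k => fourier (u b) k - fourier new k).
Proof.
move=> a0 ab bT atb bt ta m1 A1 B1 gm cE AE BE v2 vp2 e1 hp he new.
have /andP[at_ tb] := atb.
have ht : 0 <= t <= T by rewrite (le_trans a0 at_) (le_trans tb bT).
have ha : 0 <= a <= T by rewrite a0 (le_trans (ltW ab) bT).
have swap (r : R) (f g : freq d -> R[i]) : hsc r (fun k => f k - g k) -> hsc r (fun k => g k - f k).
  by apply: hs_le_mono => k; rewrite nc_distC.
(* The bound [e <= 1] puts v in the ball of radius M + 1. *)
have hv : hsc (M + 1) (fourier v).
  apply: (@hsc_weaken (M + e)); first by rewrite lerD2l.
  by apply: eq_hsc (hscD (hsc_sol ht) (swap _ _ _ he)) => k; rewrite addrC subrK.
have hvp : hsc (M + ep) (fourier vp).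
  by apply: eq_hsc (hscD (hsc_sol ha) (swap _ _ _ hp)) => k; rewrite addrC subrK.
have hu : hsc (M + 1) (fourier (u t)) by apply: hsc_weaken (hsc_sol ht); rewrite lerDl.
have [g2 gE] := conj_mult_hs m1 v2 hv; have [g2' gE'] := conj_mult_hs m1 (u2 ht) (hsc_sol ht).
have mJ k : nc ((m (- normsq k))^*) <= 1 by rewrite ncJ.
have hg : hsc (M + 1) (fourier (conj_mult m v)).
  by have := hscM ler01 mJ hv; rewrite mul1r; apply: eq_hsc => k; rewrite gE.
have hg' : hsc (M + 1) (fourier (conj_mult m (u t))).
  by have := hscM ler01 mJ hu; rewrite mul1r; apply: eq_hsc => k; rewrite gE'.
have hd : hsc e (fun k => fourier (conj_mult m (u t)) k - fourier (conj_mult m v) k).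
  have := hscM ler01 mJ he; rewrite mul1r; apply: eq_hsc => k.
  exact: etrans (mulrBr _ _ _) (esym (f_equal2 (fun p q : R[i] => p - q) (gE' k) (gE k))).
have [F2 _] := cubic_hs v2 v2 g2 hv hv hg.
have hF := hsc_cubic v2 v2 g2 hv hv hg.
have hL := hsc_cubic_lip (u2 ht) (u2 ht) g2' v2 v2 g2 hu hu hg' hv hv hg he he hd.
have hLE := local_error a0 ab bT atb bt ta m1 gm.
have [nA nAE] := fDelta_hs A1 hvp; have [nB nBE] := fDelta_hs B1 hF.
have cB : fDelta fB (fun y => v y ^+ 2 * fDelta m (fun z => (v z)^*) y) =
    fDelta fB (cubic v v (conj_mult m v)) by rewrite cubic_conj_mult.
have newE : new = fun x => fDelta fA vp x - c * fDelta fB (cubic v v (conj_mult m v)) x.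
  by rewrite /new cB.
have iA := L2_cintegrable nA; have iB := L2_cintegrable nB.
have n2 : L2 new.
  rewrite newE; exact: L2B nA (L2Z c nB).
split; first exact: n2.
have fn k : fourier new k = cis ((b - a) * - normsq k) * fourier vp k -
    c * (cis ((b - t) * - normsq k) * fourier (cubic v v (conj_mult m v)) k).
  have f0 : fourier new k =
      fourier (fun x => fDelta fA vp x - c * fDelta fB (cubic v v (conj_mult m v)) x) k.
    by rewrite newE.
  have f1 : fourier (fun x => fDelta fA vp x - c * fDelta fB (cubic v v (conj_mult m v)) x) k =
      fourier (fDelta fA vp) k - fourier (fun x => c * fDelta fB (cubic v v (conj_mult m v)) x) k.
    by apply: fourierB; [exact: iA|exact: L2_cintegrable (L2Z c nB)].
  have f2 : fourier (fun x => c * fDelta fB (cubic v v (conj_mult m v)) x) k =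
      c * fourier (fDelta fB (cubic v v (conj_mult m v))) k.
    exact: fourierZ _ _ iB.
  have f3 := nAE k; have f4 := nBE k; rewrite AE in f3; rewrite BE in f4.
  exact: etrans f0 (etrans f1 (f_equal2 (fun p q : R[i] => p - q) f3
    (etrans f2 (f_equal (fun q => c * q) f4)))).
have u1 (x : freq d -> R) k : nc (cis (x k)) <= 1 by rewrite nc_cis.
have p1 := hscM ler01 (u1 (fun k => - (b * normsq k))) hLE.
have p2 := hscM ler01 (u1 (fun k => (b - a) * - normsq k)) hp.
have m3 k : nc (- (c * cis ((b - t) * - normsq k))) <= `|mu| * `|h|.
  by rewrite ncN cE !ncM nc_i nc_cis !nc_real mul1r mulr1.
have mh0 : 0 <= `|mu| * `|h| by rewrite mulr_ge0.
have p3 := hscM mh0 m3 hL.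
(* The error is the sum of the local error, the propagated error at a and the nonlinear error at
   t. *)
have H := hscD (hscD p1 p2) p3; rewrite !mul1r in H.
apply: eq_hsc H => k.
refine (etrans _ (f_equal (fun q => fourier (u b) k - q) (esym (fn k)))).
cbv beta; rewrite /twist -cE.
have q1 : cis ((b - a) * - normsq k) = cis (- (b * normsq k)) * cis (a * normsq k) :> R[i].
  by rewrite -cisD; congr cis; ring.
have q2 : cis ((b - t) * - normsq k) = cis (- (b * normsq k)) * cis (t * normsq k) :> R[i].
  by rewrite -cisD; congr cis; ring.
have q3 : cis (- (b * normsq k)) * cis (b * normsq k) = 1 :> R[i] by rewrite -cisD addNr cis0.
(* Vanilla [generalize] is purely syntactic; matching these terms up to
   conversion unfolds the Fourier coefficients. *)
revert q1 q2 q3.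
generalize (cis ((b - a) * - normsq k)) => D1; generalize (cis ((b - t) * - normsq k)) => D2.
generalize (cis (- (b * normsq k))) => E; generalize (cis (b * normsq k)) => B.
generalize (cis (a * normsq k)) => A; generalize (cis (t * normsq k)) => X.
generalize (fourier (u b) k) => ub; generalize (fourier (u a) k) => ua.
generalize (fourier vp k) => w; generalize (fourier (cubic v v (conj_mult m v)) k) => G.
generalize (fourier (cubic (u t) (u t) (conj_mult m (u t))) k) => G'.
move=> -> -> q3.
transitivity (E * B * ub - (E * A * w - c * (E * X * G))); first by ring.
by rewrite q3 mul1r.
Qed.

End solution.

End trilinear.

Arguments one_step : clear implicits.

(** * From the Sobolev norm to sequences, and the global error *)

Section sobolev.
Context {R : realType} {d : nat}.
Implicit Types (u v : @torus_fun R d) (s B : R).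

Lemma EFin_sqrte B : 0 <= B -> B%:E = sqrte (B ^+ 2)%:E.
Proof. by move=> B0; rewrite /= sqrtr_sqr ger0_norm. Qed.

Lemma sum_hs_terms s u (K : seq (freq d)) : uniq K ->
  (\sum_(k \in [set` K]) ((1 + normsq k) `^ s * nc (fourier u k) ^+ 2)%:E)%E =
  (\sum_(k <- K) (sobw s k * nc (fourier u k)) ^+ 2)%:E.
Proof.
move=> uK; rewrite -fsbig_seq// -sumEFin; apply: eq_bigr => k _.
by rewrite exprMn sobw_sq.
Qed.

Lemma sobolev_norm_hs s B u : 0 <= B -> (sobolev_norm s u <= B%:E)%E ->
  L2 u /\ hs_le s B (fun k => nc (fourier u k)).
Proof.
move=> B0; rewrite /sobolev_norm; case: asboolP => [u2 h|_]; last by rewrite leye_eq.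
split=> //; split=> // K uK.
move: h; rewrite (EFin_sqrte B0) lee_sqrt ?lee_fin ?sqr_ge0// => h.
rewrite -lee_fin -sum_hs_terms//; apply: le_trans h.
by apply: ereal_sup_ubound; exists [set` K] => //; split=> //; exact: finite_seq.
Qed.

Lemma hs_sobolev_norm s B u : L2 u -> hs_le s B (fun k => nc (fourier u k)) ->
  (sobolev_norm s u <= B%:E)%E.
Proof.
move=> u2 [B0 h]; rewrite /sobolev_norm asboolT//.
rewrite (EFin_sqrte B0) lee_sqrt ?lee_fin ?sqr_ge0//.
apply: ge_ereal_sup => _ [X [finX _] <-].
have [r Xr] := (finite_seqP X).1 finX.
have -> : X = [set` undup r] by rewrite Xr; apply/seteqP; split => k /=; rewrite mem_undup.
by rewrite sum_hs_terms ?undup_uniq// lee_fin h ?undup_uniq.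
Qed.

Lemma sobolev_norm_ge0 s u : (0 <= sobolev_norm s u)%E.
Proof. by rewrite /sobolev_norm; case: ifP => _; rewrite ?sqrte_ge0. Qed.

End sobolev.

(** * Properties of the Fourier coefficients of a solution *)

Section solution_facts.
Context {R : realType} {d : nat}.
Variables (mu alpha T M : R) (u0 : @torus_fun R d) (Tmax : \bar R) (u : R -> @torus_fun R d).
Hypotheses (alpha0 : 0 <= alpha) (sol : nls_solution mu alpha u0 Tmax u).
Hypothesis TT : (T%:E < Tmax)%E.
Hypothesis u2 : forall t, 0 <= t <= T -> L2 (u t).

(** For alpha >= 0 each coefficient is bounded by the norm of H^alpha, in which the solution is
    continuous. *)
Lemma nls_cont k t : 0 <= t <= T -> forall e, 0 < e ->
  \forall s \near within `[0, T]%classic (nbhs t),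
    nc (fourier (u s) k - fourier (u t) k) <= e.
Proof.
move=> /andP[t0 tT] e e0; have [_ _ cu _] := sol.
have tS : (t%:E < Tmax)%E by apply: le_lt_trans TT; rewrite lee_fin.
have e0' : (0 < e%:E)%E by rewrite lte_fin.
have H : \forall x \near nbhs (0%E : \bar R), (x < e%:E)%E.
  by apply: open_nbhs_nbhs; split => //; exact: open_ereal_lt_ereal.
have {}H : \forall s \near nbhs t, (0 <= s /\ (s%:E < Tmax)%E) ->
    (sobolev_norm alpha (fun x => (u s x - u t x)%R) < e%:E)%E by exact: (cu t t0 tS _ H).
rewrite near_withinE; apply: filterS H => s H /=; rewrite in_itv/= => /andP[s0 sT].
have /H/ltW : 0 <= s /\ (s%:E < Tmax)%E.
  by split=> //; apply: le_lt_trans TT; rewrite lee_fin.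
move=> /(sobolev_norm_hs (ltW e0))[_ /(hs_le_at k alpha0)].
rewrite fourierB; try by apply: L2_cintegrable; apply: u2; rewrite ?t0 ?s0.
by rewrite ger0_norm// nc_ge0.
Qed.

Lemma nls_cont_Re k : {within `[0, T], continuous (fun t => complex.Re (fourier (u t) k))}.
Proof.
apply/subspace_continuousP => t /=; rewrite in_itv/= => ht.
apply/cvgrPdist_le => e e0; apply: filterS (nls_cont k ht e0) => s hs.
apply: le_trans hs; rewrite nc_distC.
by have := nc_Re (fourier (u t) k - fourier (u s) k); rewrite cReB.
Qed.

Lemma nls_cont_Im k : {within `[0, T], continuous (fun t => complex.Im (fourier (u t) k))}.
Proof.
apply/subspace_continuousP => t /=; rewrite in_itv/= => ht.
apply/cvgrPdist_le => e e0; apply: filterS (nls_cont k ht e0) => s hs.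
apply: le_trans hs; rewrite nc_distC.
by have := nc_Im (fourier (u t) k - fourier (u s) k); rewrite cImB.
Qed.

Lemma nls_cderiv t : 0 < t < T -> forall k,
  is_cderiv (fun s => fourier (u s) k) t (- 'i%C * ((normsq k)%:C * fourier (u t) k
    + mu%:C * fourier (cubic (u t) (u t) (u t)) k)).
Proof.
move=> /andP[t0 tT] k; have [_ _ _ ode] := sol.
have tS : (t%:E < Tmax)%E by apply: lt_trans TT; rewrite lte_fin.
have [w dw ew] := ode t t0 tS k.
have ii : - 'i%C * 'i%C = 1 :> R[i] by rewrite mulNr -expr2 sqr_i opprK.
have -> : cubic (u t) (u t) (u t) = (fun x => `|u t x| ^+ 2 * u t x).
  by apply: funext => x; rewrite normCK /cubic; ring.
have ew' : 'i%C * w = (normsq k)%:C * fourier (u t) k +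
    mu%:C * fourier (fun x => `|u t x| ^+ 2 * u t x) k.
  by rewrite ew; congr (_ * _ + _); rewrite rmorphN opprK.
by rewrite -ew' mulrA ii mul1r.
Qed.

End solution_facts.

Theorem corollary3p5 (R : realType) (d : nat) (mu alpha T : R)
    (hd : (1 <= d <= 3)%N) (hmu : mu != 0) (halpha : d%:R / 2 < alpha)
    (hT : 0 < T) :
  exists C tau0 : R -> R,
    (forall M, 0 < C M /\ 0 < tau0 M) /\
    forall (u0 : torus_fun d) (Tmax : \bar R) (u : R -> torus_fun d),
      maximal_nls_solution mu alpha u0 Tmax u ->
      (T%:E < Tmax)%E ->
      (sup_sobolev_norm T (alpha + 1) u < +oo)%E ->
      let M := fine (sup_sobolev_norm T (alpha + 1) u) in
      forall tau : R, 0 < tau -> tau <= tau0 M ->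
      forall n : nat, n%:R <= T / tau ->
        (sobolev_norm alpha (fun x => (u (n%:R * tau) x - sLRI1 mu tau u0 n x)%R)
           <= (C M * tau)%:E)%E.
Proof.
have a0 : 0 <= alpha by apply: le_trans (ltW halpha); rewrite divr_ge0.
have [K Kgt0 HK'] := @hs_tri R d alpha halpha a0.
have HK S X Y Z (x y z : freq d -> R) := @HK' S X Y Z x y z.
have [S hS] := @jap_l1 R d alpha halpha.
have HL B (x : freq d -> R) : hs_le alpha B x -> l1_le (B * (1 + S)) x.
  apply: l2_le_l1; first by move=> k; exact: sobw_gt0.
  by apply: l1_le_mono hS => k; rewrite sobw_sq.
have K0 := ltW Kgt0.
(* The Lipschitz part of [one_step] with h = 2 tau and three factors gives 6 |mu|. The absolute
   value of M keeps the constants nonnegative for every real M. *)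
pose L (M : R) : R := 6 * `|mu| * (K * (`|M| + 1) ^+ 2).
pose C1 (M : R) : R := 2 * `|mu| * @locerr R d K mu `|M|.
(* At most T / tau local errors C1 tau^2, with a discrete Gronwall factor. *)
pose C0 (M : R) : R := C1 M * T * expR (L M * T).
have L0 M : 0 <= L M by rewrite !mulr_ge0// exprn_ge0// addr_ge0.
have C10 M : 0 <= C1 M.
  rewrite mulr_ge0// ?mulr_ge0// /locerr.
  by apply: addr_ge0; rewrite !mulr_ge0// exprn_ge0.
have C00 M : 0 <= C0 M.
  by apply: mulr_ge0; [exact: mulr_ge0 (C10 M) (ltW hT)|exact: expR_ge0].
have c1 M : 0 < C0 M + 1 by apply: ltr_wpDl.
(* This threshold makes the global bound at most 1, as [one_step] requires; adding 1 to C0 ensures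
   positivity. *)
exists (fun M => C0 M + 1), (fun M => (C0 M + 1)^-1); split.
  by move=> M; split; rewrite ?invr_gt0; exact: c1.
move=> u0 Tmax u [sol _] TT supT M tau tau0 tauM; cbv beta in tauM; cbv beta.
have [u0E _ _ _] := sol.
have nM t : 0 <= t <= T -> (sobolev_norm (alpha + 1) (u t) <= sup_sobolev_norm T (alpha + 1) u)%E.
  by move=> ht; apply: ereal_sup_ubound; exists t => //; rewrite /= in_itv/=.
have sup0 : (0 <= sup_sobolev_norm T (alpha + 1) u)%E.
  have h0 : 0 <= (0 : R) <= T by rewrite lexx ltW.
  exact: le_trans (sobolev_norm_ge0 _ _) (nM 0 h0).
have supE : sup_sobolev_norm T (alpha + 1) u = M%:E by rewrite /M fineK// ge0_fin_numE.
have M0 : 0 <= M by rewrite /M fine_ge0.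
clearbody M.
have uM' t : 0 <= t <= T -> L2 (u t) /\ hs_le (alpha + 1) M (fun k => nc (fourier (u t) k)).
  by move=> ht; apply: sobolev_norm_hs => //; rewrite -supE; exact: nM.
have u2 t : 0 <= t <= T -> L2 (u t) by move=> /uM'[].
have uM t : 0 <= t <= T -> hs_le (alpha + 1) M (fun k => nc (fourier (u t) k)) by move=> /uM'[].
have uRe := nls_cont_Re a0 sol TT u2; have uIm := nls_cont_Im a0 sol TT u2.
have ud := nls_cderiv sol TT.
have step := one_step _ _ _ _ HK _ HL _ _ _ _ K0 u2 uM uRe uIm ud.
have ME : `|M| = M by rewrite ger0_norm.
pose P := 1 + L M * tau.
have P1 : 1 <= P by rewrite /P lerDl; exact: mulr_ge0 (L0 M) (ltW tau0).
have P0 : 0 <= P := le_trans ler01 P1.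
(* A supersolution of the recursion g_(n+2) = C1 tau^2 + g_n + L tau g_(n+1) produced by
   [one_step]. *)
pose ga (n : nat) := n%:R * C1 M * tau ^+ 2 * P ^+ n.
have ga_le n : n%:R * tau <= T -> ga n <= C0 M * tau.
  move=> nT.
  have PT : P ^+ n <= expR (L M * T).
    apply: (@le_trans _ _ (expR (L M * tau) ^+ n)).
      by apply: lerXn2r; rewrite ?nnegrE ?expR_ge0//; exact: expR_ge1Dx.
    by rewrite -expRM_natl ler_expR mulrCA; apply: ler_wpM2l (L0 M) _ _ nT.
  have -> : ga n = C1 M * tau * ((n%:R * tau) * P ^+ n) by rewrite /ga; ring.
  have -> : C0 M * tau = C1 M * tau * (T * expR (L M * T)) by rewrite /C0; ring.
  apply: ler_wpM2l; first exact: mulr_ge0 (C10 M) (ltW tau0).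
  by apply: ler_pM => //; [exact: mulr_ge0 (ler0n _ _) (ltW tau0)|exact: exprn_ge0].
have ga1 n : n%:R * tau <= T -> ga n <= 1.
  move=> nT; apply: le_trans (ga_le n nT) _.
  apply: (@le_trans _ _ ((C0 M + 1) * tau)); first by apply: ler_wpM2r; [exact: ltW|rewrite lerDl].
  by rewrite mulrC -ler_pdivlMr ?c1// div1r.
have cexp1 (y : R) : cexp ('i%C * (tau * y)%:C) = cis (tau * y) by rewrite cexp_i.
have cexp2 (y : R) : cexp (2 * 'i%C * (tau * y)%:C) = cis (2 * tau * y).
  have -> : 2 * 'i%C * (tau * y)%:C = 'i%C * (2 * tau * y)%:C :> R[i].
    by rewrite !rmorphM/= rmorph_nat; ring.
  by rewrite cexp_i.
pose err n k := fourier (u (n%:R * tau)) k - fourier (sLRI1 mu tau u0 n) k.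
pose good n := L2 (sLRI1 mu tau u0 n) /\ hs_le alpha (ga n) (fun k => nc (err n k)).
have good0 : good 0%N.
  split.
    rewrite -[sLRI1 mu tau u0 0]/u0 -u0E; apply: u2.
    by rewrite lexx ltW.
  rewrite /ga mulr0n !mul0r; apply: l2_le_mono (l2_le0 _) => k.
  by rewrite /err mulr0n mul0r u0E -[sLRI1 mu tau u0 0]/u0 subrr nc0 mulr0.
have good1 : 1%:R * tau <= T -> good 1%N.
  rewrite mulr1n mul1r => tT; have [s0 e0] := good0.
  have hz : hs_le alpha 0 (fun k => nc (fourier (u 0) k - fourier u0 k)).
    by apply: l2_le_mono (l2_le0 _) => k; rewrite u0E subrr nc0 mulr0.
  have bnd : 0 <= (0 : R) <= tau by rewrite lexx ltW.
  have m1 y : nc (phi1 (- 2 * 'i%C * (tau * y)%:C)) <= 1.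
    have -> : - 2 * 'i%C * (tau * y)%:C = 'i%C * (- 2 * tau * y)%:C :> R[i].
      by rewrite !rmorphM rmorphN rmorph_nat; ring.
    exact: phi1_le1.
  have A1 y : nc (cexp ('i%C * (tau * y)%:C)) <= 1 by rewrite cexp1 nc_cis.
  have gm th : gam th (tau - 0) - gam th (0 - 0) =
      tau%:C * phi1 (- 2 * 'i%C * (tau * - th)%:C).
    by rewrite !subr0 gam_half// gt_eqF.
  have cE : 'i%C * (mu * tau)%:C = 'i%C * mu%:C * tau%:C :> R[i] by rewrite rmorphM mulrA.
  have AE y : cexp ('i%C * (tau * y)%:C) = cis ((tau - 0) * y) by rewrite subr0.
  have t1 : tau - 0 <= tau by rewrite subr0.
  have t2 : 0 - 0 <= tau by rewrite subr0 ltW.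
  (* The starting step freezes u at the left end 0, where the data are exact: both incoming errors
     are 0. *)
  have [n2 hn] := step 0 tau 0 tau tau 0 0 ('i%C * (mu * tau)%:C)
    (fun l => phi1 (- 2 * 'i%C * (tau * l)%:C))
    (fun l => cexp ('i%C * (tau * l)%:C)) (fun l => cexp ('i%C * (tau * l)%:C)) u0 u0
    (lexx 0) tau0 tT bnd t1 t2 m1 A1 A1 gm cE AE AE s0 s0 ler01 hz hz.
  split; first exact: n2.
  rewrite !subr0 in hn.
  have hle : tau * (`|mu| * (tau * locerr (d := d) K mu M)) + 0 +
      `|mu| * `|tau| * (K * (M + 1) ^+ 2 * (0 + 0 + 0)) <= ga 1%N.
    have l0 : 0 <= C1 M * tau ^+ 2 by exact: mulr_ge0 (C10 M) (sqr_ge0 _).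
    have -> : ga 1%N = C1 M * tau ^+ 2 * P by rewrite /ga mulr1n mul1r expr1.
    apply: (@le_trans _ _ (C1 M * tau ^+ 2)); last by apply: ler_peMr.
    (* This interval has length tau instead of 2 tau, so half of C1 suffices. *)
    have -> : C1 M * tau ^+ 2 = 2 * (tau * (`|mu| * (tau * locerr (d := d) K mu M))).
      by rewrite /C1 ME; ring.
    have : 0 <= tau * (`|mu| * (tau * locerr (d := d) K mu M)).
      have lc0 : 0 <= locerr (d := d) K mu M.
        by rewrite /locerr; apply: addr_ge0; rewrite !mulr_ge0// exprn_ge0.
      apply: mulr_ge0; first exact: ltW.
      by apply: mulr_ge0 => //; exact: mulr_ge0 (ltW tau0) lc0.
    have -> : `|mu| * `|tau| * (K * (M + 1) ^+ 2 * (0 + 0 + 0)) = 0 by rewrite !addr0 !mulr0.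
    by move=> X0; rewrite !addr0 mulr_natl mulr2n lerDl.
  have t11 : 1%:R * tau = tau by rewrite mulr1n mul1r.
  rewrite /err t11; exact: l2_le_weaken hle hn.
have goodS n : n.+2%:R * tau <= T -> good n -> good n.+1 -> good n.+2.
  move=> nT [sn en] [sn1 en1].
  have n1T : n.+1%:R * tau <= T by apply: le_trans nT; rewrite ler_pM2r// ler_nat.
  have nS : n.+1%:R * tau - n%:R * tau = tau by rewrite -natr1; ring.
  have nSS : n.+2%:R * tau - n.+1%:R * tau = tau by rewrite -natr1; ring.
  have nS2 : n.+2%:R * tau - n%:R * tau = 2 * tau by rewrite -!natr1; ring.
  have nS' : n%:R * tau - n.+1%:R * tau = - tau by rewrite -opprB nS.
  have p1 : 0 <= n%:R * tau by rewrite mulr_ge0// ltW.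
  have p2 : n%:R * tau < n.+2%:R * tau by rewrite ltr_pM2r// ltr_nat.
  have p3 : n%:R * tau <= n.+1%:R * tau <= n.+2%:R * tau.
    by rewrite !ler_pM2r// !ler_nat !leqnSn.
  have p4 : n.+2%:R * tau - n.+1%:R * tau <= tau by rewrite nSS.
  have p5 : n.+1%:R * tau - n%:R * tau <= tau by rewrite nS.
  have m1 y : nc ((phis (2 * tau * y))%:C) <= 1 by rewrite nc_real phis_le1.
  have A1 y : nc (cexp (2 * 'i%C * (tau * y)%:C)) <= 1 by rewrite cexp2 nc_cis.
  have B1 y : nc (cexp ('i%C * (tau * y)%:C)) <= 1 by rewrite cexp1 nc_cis.
  have gm th : gam th (n.+2%:R * tau - n.+1%:R * tau) - gam th (n%:R * tau - n.+1%:R * tau) =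
      (2 * tau)%:C * (phis (2 * tau * - th))%:C.
    by rewrite nSS nS' gam_sym// gt_eqF.
  have cE : 2 * 'i%C * (mu * tau)%:C = 'i%C * mu%:C * (2 * tau)%:C :> R[i].
    by rewrite !rmorphM rmorph_nat; ring.
  have AE y : cexp (2 * 'i%C * (tau * y)%:C) = cis ((n.+2%:R * tau - n%:R * tau) * y).
    by rewrite nS2.
  have BE y : cexp ('i%C * (tau * y)%:C) = cis ((n.+2%:R * tau - n.+1%:R * tau) * y).
    by rewrite nSS.
  (* The interval is symmetric about the freezing time t_(n+1), which gives h = 2 tau and the filter
     phi_s. *)
  have [n2 hn] := step (n%:R * tau) (n.+2%:R * tau) (n.+1%:R * tau) tau (2 * tau) (ga n.+1) (ga n)
    (2 * 'i%C * (mu * tau)%:C) (fun l => (phis (2 * tau * l))%:C)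
    (fun l => cexp (2 * 'i%C * (tau * l)%:C)) (fun l => cexp ('i%C * (tau * l)%:C))
    (sLRI1 mu tau u0 n.+1) (sLRI1 mu tau u0 n)
    p1 p2 nT p3 p4 p5 m1 A1 B1 gm cE AE BE sn1 sn (ga1 _ n1T) en en1.
  split; first exact: n2.
  rewrite nS2 in hn; apply: l2_le_weaken hn.
  have -> : `|2 * tau| = 2 * tau by rewrite ger0_norm// mulr_ge0// ltW.
  have -> : 2 * tau * (`|mu| * (tau * locerr (d := d) K mu M)) + ga n +
      `|mu| * (2 * tau) * (K * (M + 1) ^+ 2 * (ga n.+1 + ga n.+1 + ga n.+1)) =
      C1 M * tau ^+ 2 + ga n + L M * tau * ga n.+1 by rewrite /C1 /L ME; ring.
  have Pn : 1 <= P ^+ n.+1 by rewrite exprn_ege1.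
  have Pn' : P ^+ n <= P ^+ n.+1 by rewrite ler_weXn2l.
  have c0 : 0 <= C1 M * tau ^+ 2 by exact: mulr_ge0 (C10 M) (sqr_ge0 _).
  (* Expanding one factor P = 1 + L tau and n + 2 = (n + 1) + 1 exhibits every term of the
     recursion, once [ga n] is bounded by [ga n.+1]. *)
  have -> : ga n.+2 = C1 M * tau ^+ 2 * P ^+ n.+1 + ga n.+1 + L M * tau * ga n.+1
      + (C1 M * tau ^+ 2 * P ^+ n.+1) * (L M * tau).
    rewrite /ga [P ^+ n.+2]exprSr; set p := P ^+ n.+1.
    by have -> : n.+2%:R = n.+1%:R + 1 :> R; [rewrite natr1|rewrite /P; ring].
  have gn : ga n <= ga n.+1.
    rewrite /ga; apply: ler_pM => //.
    - exact: mulr_ge0 (mulr_ge0 (ler0n _ _) (C10 M)) (sqr_ge0 _).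
    - exact: exprn_ge0.
    - by apply: ler_wpM2r (sqr_ge0 _) _ _ _; apply: ler_wpM2r (C10 M) _ _ _; rewrite ler_nat.
  have h1 := mulr_ge0 (mulr_ge0 c0 (le_trans ler01 Pn)) (mulr_ge0 (L0 M) (ltW tau0)).
  have h2 : C1 M * tau ^+ 2 <= C1 M * tau ^+ 2 * P ^+ n.+1 by apply: ler_peMr.
  move: gn h1 h2; move: (ga n) (ga n.+1) (C1 M * tau ^+ 2 * P ^+ n.+1) (C1 M * tau ^+ 2).
  by move=> x y z w gn h1 h2; lra.
(* Two consecutive indices are carried for the two-step recursion; the second is conditional because
   t_(n+1) may exceed T. *)
have allgood n : n%:R * tau <= T -> good n /\ (n.+1%:R * tau <= T -> good n.+1).
  elim: n => [_|n IH nT]; first by split.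
  have n'T : n%:R * tau <= T by apply: le_trans nT; rewrite ler_pM2r// ler_nat.
  have [gn gn1] := IH n'T.
  by split=> [|nT2]; [exact: gn1 nT|exact: (goodS n nT2 gn (gn1 nT))].
move=> n; rewrite ler_pdivlMr// => nT.
have [[s2 es] _] := allgood n nT.
have hnT : 0 <= n%:R * tau <= T by rewrite nT andbT; exact: mulr_ge0 (ler0n _ _) (ltW tau0).
apply: hs_sobolev_norm; first exact: L2B (u2 _ hnT) s2.
apply: (@l2_le_weaken _ _ (ga n)).
  by apply: le_trans (ga_le n nT) _; apply: ler_wpM2r; [exact: ltW|rewrite lerDl].
apply: hs_le_mono es => k.
rewrite /err fourierB; [exact: lexx|exact: L2_cintegrable (u2 _ hnT)|exact: L2_cintegrable].
Qed.
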